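(* Let $(t_n)$ be a sequence of positive integers and $(p_n)$ a sequence in $[0,1]$ such that $t_n\to\infty$ and $p_n\to 0$ as $n\to\infty$, and let $\lambda=\pi^2/18$. Then: (i) if $\liminf_{n\to\infty} p_n\log t_n>\lambda$ then $\lim_{n\to\infty} J(t_n,p_n)=1$; (ii) if $\limsup_{n\to\infty} p_n\log t_n<\lambda$ then $\lim_{n\to\infty} J(t_n,p_n)=0$.
   Context: Bootstrap percolation on $\mathbb{Z}^2$. For a site $x\in\mathbb{Z}^2$ let $N(x)=\{y\in\mathbb{Z}^2:\|x-y\|=1\}$ (Euclidean norm). For $K\subseteq\mathbb{Z}^2$ let $\mathcal{B}(K)=K\cup\{x\in\mathbb{Z}^2:|N(x)\cap K|\ge 2\}$, and let $\mathcal{B}^t$ be the $t$-th iterate of $\mathcal{B}$. For $p\in[0,1]$, let $X\subseteq\mathbb{Z}^2$ be the random set in which each site is included independently with probability $p$, and let $P_p$ denote the corresponding product probability measure. Define $J(t,p)=P_p\bigl((0,0)\in\mathcal{B}^t(X)\bigr)$, the probability that the origin is active by time $t$ in the process on the infinite lattice. *)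

(* Defs.v *)
From HB Require Import structures.
From mathcomp Require Import all_boot all_order all_algebra finmap.
From mathcomp Require Import all_classical all_reals all_analysis.
From mathcomp Require Import measurable_realfun.

Set Implicit Arguments.
Unset Strict Implicit.
Unset Printing Implicit Defensive.

Import Order.TTheory GRing.Theory Num.Theory.
Import numFieldNormedType.Exports.

Local Open Scope classical_set_scope.
Local Open Scope ring_scope.
Local Open Scope card_scope.

Notation site := (int * int)%type.

Definition euclid_norm (R : realType) (v : site) : R :=
  Num.sqrt (v.1%:~R ^+ 2 + v.2%:~R ^+ 2).

Definition nbrs (R : realType) (x : site) : set site :=
  [set y | euclid_norm R (x - y) = 1].

Definition bootstrap (R : realType) (K : set site) : set site :=
  K `|` [set x | `I_2 #<= nbrs R x `&` K].

Definition site_event (x : site) : set (set site) := [set X | X x].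

(* Subsets of Z^2, i.e. {0,1}^(Z^2), with the product sigma-algebra. *)
Notation config := (g_sigma_algebraType (range site_event)).

(* The product rule over every finite subfamily. *)
Definition mutually_independent d (T : measurableType d) (R : realType)
    (P : probability T R) (I : choiceType) (E : I -> set T) : Prop :=
  forall F : {fset I},
    P (\bigcap_(i in [set` F]) E i) = (\prod_(i <- F) P (E i))%E.

Definition is_bernoulli_product (R : realType) (p : R)
    (P : probability config R) : Prop :=
  (forall x, P (site_event x) = p%:E) /\
  mutually_independent P site_event.

(* Existence: split [0, 1[ at p, rescale both pieces to [0, 1[ and iterate; for
   a uniform x, the events [digit n x] are independent of probability p. *)
Section existence.
Variables (R : realType) (p : R).
Hypothesis p01 : 0 <= p <= 1.

Let p0 : 0 <= p. Proof. by case/andP: p01. Qed.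
Let p1 : p <= 1. Proof. by case/andP: p01. Qed.

Definition split_map (x : R) : R := if x < p then x / p else (x - p) / (1 - p).

Definition digit (n : nat) (x : R) : bool := iter n split_map x < p.

Definition wgt (c : bool) : R := if c then p else 1 - p.

Definition cyl (b : seq bool) : set R :=
  [set x : R | (x \in `[0, 1[) /\
    (forall i, (i < size b)%N -> digit i x = nth false b i)].

Lemma split_map01 x : x \in `[0, 1[ -> split_map x \in `[0, 1[.
Proof.
rewrite !in_itv/= /split_map => /andP[x0 x1]; case: ltP => [xp|px].
  have pp : 0 < p by exact: le_lt_trans xp.
  by rewrite divr_ge0//= ltr_pdivrMr// mul1r.
have qq : 0 < 1 - p by rewrite subr_gt0; exact: le_lt_trans x1.
by rewrite divr_ge0 ?subr_ge0//= ltr_pdivrMr// mul1r ltrD2r.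
Qed.

Lemma cyl_cons c b : cyl (c :: b) =
  [set x : R | [/\ (x \in `[0, 1[), (x < p) = c & cyl b (split_map x)]].
Proof.
apply/seteqP; split => x /=.
  move=> [x01 h]; split => //; first exact: (h 0%N).
  split; first exact: split_map01.
  by move=> i ib; have := h i.+1 ib; rewrite /digit iterSr.
move=> [x01 xp [_ h]]; split => // -[|i] //= ib.
by rewrite -h// /digit iterSr.
Qed.

Lemma cyl_itv b : exists l : R, [/\ 0 <= l, l + \prod_(c <- b) wgt c <= 1,
  0 <= \prod_(c <- b) wgt c & cyl b = `[l, l + \prod_(c <- b) wgt c[%classic].
Proof.
elim: b => [|c b [l [l0 lw w0 IH]]].
  exists 0; rewrite big_nil add0r; split=> //.
  by apply/seteqP; split=> x //= -[].
rewrite cyl_cons IH big_cons; set w := \prod_(c <- b) wgt c in lw w0 *.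
clear IH; case: c => /=.
- exists (p * l); rewrite -mulrDr; split.
  + exact: mulr_ge0.
  + by rewrite mulr_ile1// addr_ge0.
  + exact: mulr_ge0.
  + have [pE|pn0] := eqVneq p 0.
      apply/seteqP; split=> x /=; rewrite !in_itv/= pE.
        by move=> [/andP[x0 _] xp _]; move: xp; rewrite ltNge x0.
      by rewrite !mul0r => /andP[x0]; rewrite ltNge x0.
    have pp : 0 < p by rewrite lt_neqAle eq_sym pn0.
    apply/seteqP; split=> x /=; rewrite !in_itv/= /split_map.
      move=> [_ ->]; rewrite ler_pdivlMr// ltr_pdivrMr//.
      by rewrite mulrC [(_ + _) * p]mulrC.
    move=> /andP[h1 h2].
    have xp : x < p.
      by apply: (lt_le_trans h2); rewrite ler_piMr.
    split => //.
      by rewrite (le_trans _ h1) ?mulr_ge0//= (lt_le_trans xp).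
    by rewrite xp ler_pdivlMr// ltr_pdivrMr// mulrC h1 mulrC h2.
- have q0 : 0 <= 1 - p by rewrite subr_ge0.
  exists (p + (1 - p) * l); rewrite -addrA -mulrDr; split.
  + by rewrite addr_ge0// mulr_ge0.
  + by rewrite -lerBrDl ler_piMr.
  + exact: mulr_ge0.
  + have [pE|pn1] := eqVneq p 1.
      apply/seteqP; split=> x /=; rewrite !in_itv/= pE.
        by move=> [/andP[_ x1]]; rewrite x1.
      by rewrite subrr !mul0r addr0 => /andP[x0]; rewrite ltNge x0.
    have qq : 0 < 1 - p by rewrite subr_gt0 lt_neqAle pn1.
    apply/seteqP; split=> x /=; rewrite !in_itv/= /split_map.
      move=> [_ ->]; rewrite ler_pdivlMr// ltr_pdivrMr//.
      by rewrite lerBrDl ltrBlDl mulrC [(_ + w) * _]mulrC.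
    move=> /andP[h1 h2].
    have px : p <= x.
      by apply: le_trans h1; rewrite lerDl mulr_ge0.
    have -> : (x < p) = false by rewrite ltNge px.
    split => //.
      rewrite (le_trans p0)//=; apply: (lt_le_trans h2).
      by rewrite -lerBrDl ler_piMr.
    by rewrite ler_pdivlMr// ltr_pdivrMr// lerBrDl ltrBlDl mulrC h1 mulrC h2.
Qed.

Let mu : probability (measurableTypeR R) R :=
  uniform_prob (ltr01 : (0 : R) < 1).

Lemma mu_itv (l r : R) : 0 <= l -> l <= r -> r <= 1 ->
  mu `[l, r[%classic = (r - l)%:E.
Proof.
move=> l0 lr r1; rewrite /mu /= /uniform_prob integral_uniform_pdf.
have -> : `[l, r[ `&` `[0, 1] = `[l, r[%classic :> set R.
  apply/setIidPl => x /=; rewrite !in_itv/= => /andP[lx xr].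
  by rewrite (le_trans l0)//= ltW// (lt_le_trans xr).
rewrite (eq_integral (fun=> 1%:E)); last first.
  move=> x; rewrite inE/= in_itv/= /uniform_pdf => /andP[lx xr].
  by rewrite (le_trans l0 lx) (ltW (lt_le_trans xr r1))/= subr0 invr1.
rewrite integral_cst//= mul1e lebesgue_measure_itv/= lte_fin.
by move: lr; rewrite le_eqVlt => /orP[/eqP ->|->//]; rewrite ltxx subrr.
Qed.

Lemma mu_cyl b : mu (cyl b) = (\prod_(c <- b) wgt c)%:E.
Proof.
have [l [l0 lw w0 ->]] := cyl_itv b.
by rewrite mu_itv ?lerDl// addrC addKr.
Qed.

Lemma measurable_split_map : measurable_fun [set: R] split_map.
Proof.
apply: measurable_fun_if => //=.
- exact: measurable_fun_ltr.
- exact: measurable_funM.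
- by apply: measurable_funM => //; exact: measurable_funB.
Qed.

Lemma measurable_digit n : measurable_fun [set: R] (digit n).
Proof.
apply: measurable_fun_ltr => //.
elim: n => [|n IH]; first exact: measurable_id.
by apply: measurableT_comp IH; exact: measurable_split_map.
Qed.

Lemma measurable_digit_set n : measurable [set x | digit n x].
Proof.
by have := @measurable_digit n measurableT [set true] I; rewrite setTI.
Qed.

Definition cylm (b m : seq bool) : set R :=
  cyl b `&` [set x | forall i, nth false m i -> digit (size b + i) x].

Lemma measurable_cyl b : measurable (cyl b).
Proof. by have [l [_ _ _ ->]] := cyl_itv b; exact: measurable_itv. Qed.

Lemma measurable_cylm b m : measurable (cylm b m).
Proof.
apply: measurableI; first exact: measurable_cyl.
rewrite (_ : [set _ | _] = \bigcap_(i in [set i | nth false m i])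
    [set x | digit (size b + i) x]).
  by apply: bigcap_measurableType => i _; exact: measurable_digit_set.
by apply/seteqP; split => x.
Qed.

Lemma cyl_rcons b c : cyl (rcons b c) = cyl b `&` [set x | digit (size b) x = c].
Proof.
apply/seteqP; split => x /=.
  move=> [x01 h]; split; last first.
    by rewrite h ?size_rcons// nth_rcons ltnn eqxx.
  split=> // i ib; rewrite h ?size_rcons 1?ltnS 1?ltnW//.
  by rewrite nth_rcons ib.
move=> [[x01 h] xc]; split=> // i; rewrite size_rcons ltnS leq_eqVlt nth_rcons.
by case/predU1P => [->|ib]; [rewrite ltnn eqxx|rewrite ib h].
Qed.

Lemma cylm_consT b m : cylm b (true :: m) = cylm (rcons b true) m.
Proof.
rewrite /cylm cyl_rcons; apply/seteqP; split => x /=.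
  move=> [bx h]; split.
    by split => //; have := h 0%N isT; rewrite addn0.
  by move=> i mi; rewrite size_rcons addSnnS; exact: h.
move=> [[bx bT] h]; split => // -[|i] /= mi; first by rewrite addn0.
by rewrite -addSnnS -(size_rcons b true); exact: h.
Qed.

Lemma cylm_consF b m :
  cylm b (false :: m) = cylm (rcons b true) m `|` cylm (rcons b false) m.
Proof.
rewrite /cylm !cyl_rcons; apply/seteqP; split => x /=.
  move=> [bx h].
  have h' c i : nth false m i -> digit (size (rcons b c) + i) x.
    by move=> mi; rewrite size_rcons addSnnS; exact: h.
  by case dx : (digit (size b) x); [left|right]; split => // i; exact: h'.
have h' c : (forall i, nth false m i -> digit (size (rcons b c) + i) x) ->
    forall i, nth false (false :: m) i -> digit (size b + i) x.
  by move=> h [|i] //= mi; rewrite -addSnnS -(size_rcons b c); exact: h.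
by move=> [] [[bx _] h]; split => //; exact: h' h.
Qed.

Lemma mu_cylm m b :
  mu (cylm b m) = (\prod_(c <- b) wgt c * p ^+ count id m)%:E.
Proof.
elim: m b => [|c m IH] b.
  rewrite mulr1 -mu_cyl; congr (mu _).
  by apply/seteqP; split => x /=; [case|move=> bx; split => // i; rewrite nth_nil].
case: c => /=.
  by rewrite cylm_consT IH -cats1 big_cat big_seq1 /= -mulrA -exprS.
rewrite cylm_consF.
transitivity (mu (cylm (rcons b true) m) + mu (cylm (rcons b false) m))%E.
  apply: measureU; [exact: measurable_cylm|exact: measurable_cylm|].
  by rewrite -subset0 /cylm !cyl_rcons => x [[[_ /= ->] _] [[_ //]]].
rewrite !IH -!cats1 !big_cat !big_seq1 /= -EFinD -mulrDl -mulrDr add0n.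
by rewrite addrC subrK mulr1.
Qed.

Definition random_set (x : measurableTypeR R) : config := [set z : site | digit (choice.pickle z) x].

Lemma measurable_random_set :
  measurable_fun [set: measurableTypeR R] random_set.
Proof.
apply: (@measurability _ _ (measurableTypeR R) config setT random_set (range site_event)) => //.
move=> _ [_ [z _ <-] <-]; rewrite setTI.
exact: measurable_digit_set.
Qed.

HB.instance Definition _ :=
  isMeasurableFun.Build _ _ _ _ random_set measurable_random_set.

Lemma random_set_law (F : {fset site}) :
  distribution mu random_set (\bigcap_(z in [set` F]) site_event z) =
  (p ^+ #|` F|)%:E.
Proof.
pose s := map choice.pickle (enum_fset F).
pose n := (\max_(i <- s) i).+1.
pose m := mkseq (mem s) n.
have sn i : i \in s -> (i < n)%N.
  by move=> si; rewrite ltnS; exact: (@leq_bigmax_seq _ s xpredT id i).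
have us : uniq s.
  by rewrite map_inj_uniq ?fset_uniq//; exact: (pcan_inj choice.pickleK).
have mE i : nth false m i = (i \in s).
  have [ni|ni] := ltnP i n; first by rewrite nth_mkseq.
  rewrite nth_default ?size_mkseq//; apply/esym/negbTE.
  by apply: contraL ni => /sn; rewrite ltnNge.
have cm : count id m = #|` F|.
  rewrite count_map -size_filter.
  have -> : #|` F| = size s by rewrite size_map.
  apply/perm_size/uniq_perm => //; first by rewrite filter_uniq// iota_uniq.
  move=> i; rewrite mem_filter mem_iota /= add0n.
  by apply/andP/idP => [[]//|si]; split => //; exact: sn.
rewrite -cm -[RHS]/((p ^+ count id m)%:E) -[p ^+ _]mul1r.
rewrite -[X in X * _](@big_nil _ 1 *%R bool xpredT wgt) -mu_cylm.
rewrite /distribution /pushforward.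
have -> : cylm [::] m =
    `[0, 1[ `&` (random_set @^-1` \bigcap_(z in [set` F]) site_event z).
  apply/seteqP; split => x /=.
    move=> [[x01 _] h]; split => // z /= zF.
    by apply: h; rewrite mE; exact: map_f.
  move=> [x01 h]; split; first by split.
  by move=> i; rewrite mE => /mapP[z zF ->]; exact: h.
have mA : measurable (random_set @^-1` \bigcap_(z in [set` F]) site_event z).
  rewrite preimage_bigcap; apply: fin_bigcap_measurable => // z _.
  exact: measurable_digit_set.
have mI : measurable (`[0, 1[%classic : set (measurableTypeR R)).
  exact: measurable_itv.
set A := _ @^-1` _ in mA *.
have I0 : mu (A `\` `[0, 1[) = 0%E.
  apply: (@subset_measure0 _ _ _ mu _ (~` `[0, 1[%classic)) => //.
  - exact: measurableD.
  - exact: measurableC.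
  - apply: etrans (probability_setC mu mI) _.
    by rewrite mu_itv// subr0 subee.
apply: etrans (measureDI mu mA mI) _.
apply: etrans (congr2 adde I0 erefl) _; exact: etrans (add0e _) (congr1 mu (setIC _ _)).
Qed.

Lemma exists_bernoulli_product : exists P, @is_bernoulli_product R p P.
Proof.
exists (distribution mu random_set); split.
  move=> x; have := random_set_law [fset x]%fset.
  by rewrite set_fset1 bigcap_set1 cardfs1.
move=> F; apply: etrans (random_set_law F) _.
transitivity (\prod_(z <- F) p%:E)%E.
  by rewrite prodEFin big_const_seq count_predT iter_mulr_1.
apply: eq_bigr => z _; have := random_set_law [fset z]%fset.
by rewrite set_fset1 bigcap_set1 cardfs1 expr1 => h; exact: esym h.
Qed.

End existence.

Lemma measurable_site_event x : measurable (site_event x : set config).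
Proof. by apply: sub_sigma_algebra; exists x. Qed.

Lemma bernoulli_product_unique (R : realType) (p : R)
    (P Q : probability config R) (A : set config) :
  is_bernoulli_product p P -> is_bernoulli_product p Q ->
  measurable A -> P A = Q A.
Proof.
move=> [P1 Pi] [Q1 Qi].
pose cylinder (F : {fset site}) : set config :=
  \bigcap_(z in [set` F]) site_event z.
apply: (@measure_unique _ R config (range cylinder) (fun=> setT)).
- rewrite eqEsubset; split.
    apply: smallest_sub; first exact: smallest_sigma_algebra.
    move=> _ [x _ <-]; apply: sub_sigma_algebra; exists [fset x]%fset => //.
    by rewrite /cylinder set_fset1 bigcap_set1.
  apply: smallest_sub; first exact: sigma_algebra_measurable.
  move=> _ [F _ <-]; apply: fin_bigcap_measurable => // z _.
  exact: measurable_site_event.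
- move=> _ _ [F _ <-] [G _ <-]; exists (F `|` G)%fset => //.
  by rewrite /cylinder set_fsetU bigcap_setU.
- move=> _; exists fset0 => //.
  by rewrite /cylinder set_fset0 bigcap_set0.
- by rewrite bigcup_const.
- move=> _ [F _ <-]; apply: etrans (Pi F) _; apply: etrans _ (esym (Qi F)).
  by apply: eq_bigr => z _; exact: etrans (P1 z) (esym (Q1 z)).
- move=> _; apply: le_lt_trans (ltry 1); exact: (probability_le1 P measurableT).
Qed.

(* Outside the range 0 <= p <= 1 the value is a dummy measure. *)
Definition bernoulli_product (R : realType) (p : R) : probability config R :=
  match pselect (exists P : probability config R, is_bernoulli_product p P) with
  | left e => projT1 (cid e)
  | right _ => \d_ (set0 : config)
  end.

Lemma bernoulli_productP (R : realType) (p : R) :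
  0 <= p <= 1 -> is_bernoulli_product p (bernoulli_product p).
Proof.
move=> p01; rewrite /bernoulli_product; case: pselect => [e|].
  exact: projT2 (cid e).
by move=> /(_ (exists_bernoulli_product p01)).
Qed.

Definition J (R : realType) (t : nat) (p : R) : R :=
  fine (bernoulli_product p [set X | iter t (bootstrap R) X (0, 0)]).

(* Main.v *)
Require Import Defs.
From HB Require Import structures.
From mathcomp Require Import all_boot all_order all_algebra finmap.
From mathcomp Require Import all_classical all_reals all_analysis.
From mathcomp Require Import ring lra zify.

(* Put q = - ln (1 - p), so that a given line of k sites is empty with probability
   exp (- q k).  A run of lines of length k without two adjacent empty ones has
   probability about b^n, where b = exp (- g (q k)) is the positive root of
   b^2 = u b + u (1 - u), u = 1 - exp (- q k), and the integral of g over (0, oo) is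
   lambda = pi^2 / 18.

   Lower bound on the speed: a full square of constant side n grows by n columns and
   n rows at a time as long as the new lines have no two adjacent empty ones.  It
   reaches any side with probability at least exp (- (2 lambda + o(1)) / p), so one of
   exp (2 (lambda + eps) / p) disjoint squares of side about p^-2 becomes full.  Every
   segment of that length near the origin is occupied, and the full square therefore
   moves to the origin in time exp ((lambda + eps + o(1)) / p).

   Upper bound: if the origin becomes active, there is an internally spanned rectangle
   of side of order 1 / p at distance at most t, or else a smaller one near the origin.
   An internally spanned rectangle R larger than a threshold contains two disjointly
   spanned rectangles S1, S2 below the threshold whose join S is above it, and
   the frame between S and R has no two adjacent empty lines.  By the van den
   Berg-Kesten inequality the probability that R is spanned is then at most
   (polynomial in 1 / p) * exp (- rho cost R), by induction on the number of
   thresholds, which stays bounded as p tends to 0.  The cost is a discrete integral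
   of g along the path that follows the diagonal of R and then its longer side.  It is
   minimal along this path because g is convex and decreasing, which makes the cost
   of the join at most the sum of the costs.  For squares of side B / p the cost
   tends to 2 lambda / p as B grows. *)

Set Implicit Arguments.
Unset Strict Implicit.
Unset Printing Implicit Defensive.

Import Order.TTheory GRing.Theory Num.Theory.
Import numFieldNormedType.Exports.
Local Open Scope ring_scope.

(** * Independent sites *)

(** The rows and columns of a frame share its corner sites, so their coverings are not independent.
    Fixing the corners restores independence, and an occupied corner site then costs a constant
    factor [expR (4 * M)]. For frames at most [T] lines thick, [T] a small multiple of [1 / p], this
    loss is a fraction [1 - rho] of the exponent. It requires a finite [M], while g blows up at 0;
    hence the weight g (z + eta), a weaker but still valid exponent.

    In the lower bound, each run of n lines loses a factor 1 - exp (- q k) besides b^n. Over all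
    runs these losses amount to O(1 / (n p)) in the exponent, which is why n is a large constant and
    not 1.

    Integrals of g are replaced by two-sided bounds on the increments of an explicit primitive. The
    primitive exists in closed form because the equation linking exp (- z) and exp (- g) can be
    solved for z in terms of g - z, and the solution is a difference of functions whose primitives
    are dilogarithms. *)

Section expectation.
Variables (R : realType) (T : eqType) (p : R).
Implicit Types (s : seq T) (w : T -> bool) (F G : (T -> bool) -> R).
Implicit Types (A B : (T -> bool) -> bool) (D : pred T).

Definition upd w x b : T -> bool := fun z => if z == x then b else w z.

(** Sites in [s] are averaged one at a time and all others keep their value in [w], so the estimates
    need finite sums only. In a list with repetitions the update of the first occurrence is
    outermost and overrides the later ones. *)
Fixpoint Ex s F w : R :=
  if s is x :: s' then
    p * Ex s' (fun w => F (upd w x true)) w +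
    (1 - p) * Ex s' (fun w => F (upd w x false)) w
  else F w.

Definition Pr s A : R := Ex s (fun w => (A w)%:R) (fun=> false).

Lemma eq_Ex s F G w : (forall w, F w = G w) -> Ex s F w = Ex s G w.
Proof. by move=> /funext ->. Qed.

Lemma ExD s F G w : Ex s (fun w => F w + G w) w = Ex s F w + Ex s G w.
Proof. by elim: s F G => [|x s IH] F G //=; rewrite !IH; ring. Qed.

Lemma ExZ s c F w : Ex s (fun w => c * F w) w = c * Ex s F w.
Proof. by elim: s F => [|x s IH] F //=; rewrite !IH; ring. Qed.

Lemma ExN s F w : Ex s (fun w => - F w) w = - Ex s F w.
Proof. by elim: s F => [|x s IH] F //=; rewrite !IH; ring. Qed.

Lemma ExB s F G w : Ex s (fun w => F w - G w) w = Ex s F w - Ex s G w.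
Proof. by rewrite ExD ExN. Qed.

Lemma Ex_cst s c w : Ex s (fun=> c) w = c.
Proof. by elim: s => [|x s IH] //=; rewrite IH; ring. Qed.

Lemma Ex_sum s I (r : seq I) (F : I -> (T -> bool) -> R) w :
  Ex s (fun w => \sum_(i <- r) F i w) w = \sum_(i <- r) Ex s (F i) w.
Proof.
elim: r => [|i r IH].
  by under eq_Ex do rewrite big_nil; rewrite Ex_cst big_nil.
by under eq_Ex do rewrite big_cons; rewrite ExD IH big_cons.
Qed.

Definition merge D w0 w1 : T -> bool := fun z => if D z then w0 z else w1 z.

Definition dep {V} D (F : (T -> bool) -> V) :=
  forall w w', (forall z, D z -> w z = w' z) -> F w = F w'.

(** Every site is read from only one of two independent copies and averages out of the other. This
    makes it possible to fix the sites of [D] and then average over the rest. *)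
Lemma Ex_fubini D s F w w' : Ex s F (merge D w w') =
  Ex s (fun w0 => Ex s (fun w1 => F (merge D w0 w1)) w') w.
Proof.
elim: s F => [|x s IH] F //=.
have [Dx|Dx] := boolP (D x).
- have e b w0 b' : Ex s (fun w1 => F (merge D (upd w0 x b) (upd w1 x b'))) w'
      = Ex s (fun w1 => F (upd (merge D w0 w1) x b)) w'.
    apply: eq_Ex => w1; congr F; apply/funext => z; rewrite /merge /upd.
    by have [->|] := eqVneq z x; rewrite ?Dx.
  rewrite !IH; congr (_ * _ + _ * _); apply: eq_Ex => w0; rewrite !e; ring.
- have e b w0 b' : Ex s (fun w1 => F (merge D (upd w0 x b) (upd w1 x b'))) w'
      = Ex s (fun w1 => F (upd (merge D w0 w1) x b')) w'.
    apply: eq_Ex => w1; congr F; apply/funext => z; rewrite /merge /upd.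
    by have [->|] := eqVneq z x; rewrite ?(negbTE Dx).
  rewrite !IH.
  set H1 := Ex s (fun w0 => Ex s (fun w1 => F (upd (merge D w0 w1) x true)) w') w.
  set H0 := Ex s (fun w0 => Ex s (fun w1 => F (upd (merge D w0 w1) x false)) w') w.
  have H b : Ex s (fun w0 => p * Ex s (fun w1 => F (merge D (upd w0 x b) (upd w1 x true))) w' +
     (1 - p) * Ex s (fun w1 => F (merge D (upd w0 x b) (upd w1 x false))) w') w = p * H1 + (1 - p) * H0.
    rewrite /H1 /H0 -!ExZ -ExD; apply: eq_Ex => w0; by rewrite !e.
  rewrite !H -/H1 -/H0.
  ring.
Qed.

Lemma dep_upd V D x b (F : (T -> bool) -> V) : dep D F -> dep D (fun w => F (upd w x b)).
Proof.
move=> dF w w' ww'; apply: dF => z Dz; rewrite /upd; case: eqP => // _; exact: ww'.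
Qed.

Lemma dep_notin V D x b (F : (T -> bool) -> V) w : dep D F -> ~~ D x -> F (upd w x b) = F w.
Proof.
move=> dF Dx; apply: dF => z Dz; rewrite /upd; case: eqP => // zx.
by rewrite -zx Dz in Dx.
Qed.

Lemma depS V D D' (F : (T -> bool) -> V) : (forall z, D z -> D' z) -> dep D F -> dep D' F.
Proof. by move=> DD' dF w w' ww'; apply: dF => z /DD'; exact: ww'. Qed.

Lemma dep_comp V V' D (h : V -> V') (F : (T -> bool) -> V) : dep D F -> dep D (fun w => h (F w)).
Proof. by move=> dF w w' ww'; rewrite (dF _ _ ww'). Qed.

Lemma dep_comp2 V1 V2 V' D (h : V1 -> V2 -> V') (F : (T -> bool) -> V1) (G : (T -> bool) -> V2) :
  dep D F -> dep D G -> dep D (fun w => h (F w) (G w)).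
Proof. by move=> dF dG w w' ww'; rewrite (dF _ _ ww') (dG _ _ ww'). Qed.

Lemma Ex_indep D1 D2 s F G w : dep D1 F -> dep D2 G ->
  (forall z, D1 z -> ~~ D2 z) ->
  Ex s (fun w => F w * G w) w = Ex s F w * Ex s G w.
Proof.
move=> + + D12; elim: s F G => [//|x s IH] F G dF dG /=.
have := dep_upd x _ dF; have := dep_upd x _ dG => dG' dF'.
rewrite !IH //.
have [D2x|D2x] := boolP (D2 x).
- have D1x : ~~ D1 x by apply: contraL D2x => /D12.
  have e b : Ex s (fun w => F (upd w x b)) w = Ex s F w.
    by apply: eq_Ex => w'; rewrite (dep_notin _ _ dF).
  rewrite !e; ring.
- have e b : Ex s (fun w => G (upd w x b)) w = Ex s G w.
    by apply: eq_Ex => w'; rewrite (dep_notin _ _ dG).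
  rewrite !e; ring.
Qed.

Hypothesis p01 : 0 <= p <= 1.

Lemma ler_Ex s F G w : (forall w, F w <= G w) -> Ex s F w <= Ex s G w.
Proof.
have [p0 p1] := andP p01.
elim: s F G => [|x s IH] F G FG //=.
by apply: lerD; apply: ler_wpM2l; rewrite ?subr_ge0 //; apply: IH.
Qed.

Lemma Ex_ge0 s F w : (forall w, 0 <= F w) -> 0 <= Ex s F w.
Proof. by move=> F0; rewrite -(Ex_cst s 0 w); apply: ler_Ex. Qed.

Lemma Pr_ge0 s A : 0 <= Pr s A.
Proof. exact: Ex_ge0. Qed.

Lemma le_Pr s A B : (forall w, A w -> B w) -> Pr s A <= Pr s B.
Proof.
move=> AB; apply: ler_Ex => w; rewrite ler_nat; case: (A w) (AB w) => // /(_ isT) -> //.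
Qed.

Lemma Pr_le1 s A : Pr s A <= 1.
Proof. by rewrite -(Ex_cst s 1 (fun=> false)); apply: ler_Ex => w; case: (A w); rewrite ?ler01. Qed.

Lemma Pr_setC s A : Pr s (fun w => ~~ A w) = 1 - Pr s A.
Proof.
rewrite -(Ex_cst s 1 (fun=> false)) -ExB; apply: eq_Ex => w.
by case: (A w); rewrite ?subr0 ?subrr.
Qed.

Lemma Pr_union s A (I : eqType) (r : seq I) (B : I -> (T -> bool) -> bool) :
  (forall w, A w -> exists2 i, i \in r & B i w) ->
  Pr s A <= \sum_(i <- r) Pr s (B i).
Proof.
move=> AB; rewrite /Pr -Ex_sum; apply: ler_Ex => w.
case: (boolP (A w)) => [/AB[i ir Bi]|_]; last exact: sumr_ge0.
rewrite -natr_sum ler_nat; elim: r ir {AB} => //= j r IH.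
rewrite inE big_cons => /predU1P[<-|/IH]; first by rewrite Bi.
by move=> /leq_trans; apply; rewrite leq_addl.
Qed.

Lemma Pr_indep D1 D2 s A B : dep D1 A -> dep D2 B ->
  (forall z, D1 z -> ~~ D2 z) ->
  Pr s (fun w => A w && B w) = Pr s A * Pr s B.
Proof.
move=> dA dB D12; rewrite /Pr -(@Ex_indep D1 D2)//.
- by apply: eq_Ex => w; rewrite -natrM mulnb.
- exact: (dep_comp (fun b : bool => b%:R)).
- exact: (dep_comp (fun b : bool => b%:R)).
Qed.

(** * Increasing events and disjoint occurrence *)

Definition inc A := forall w w', (forall z, w z -> w' z) -> A w -> A w'.

(** Disjoint occurrence. The witnesses are configurations below [w], which for increasing events
    amounts to disjoint sets of open sites. *)
Definition box A B w := exists w1 w2 : T -> bool,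
  [/\ forall z, w1 z -> w z, forall z, w2 z -> w z, forall z, w1 z -> ~~ w2 z, A w1 & B w2].

Lemma inc_upd A x b : inc A -> inc (fun w => A (upd w x b)).
Proof.
by move=> iA w w' ww'; apply: iA => z; rewrite /upd; case: eqP => // _; exact: ww'.
Qed.

(* The induction only uses [1 - 2 * p >= 0]: the two ways of using the
   coordinate [x] overlap at least in the event that uses it for neither. *)
Lemma van_den_Berg_Kesten s A B w : p <= 2^-1 -> inc A -> inc B ->
  Ex s (fun w => `[< box A B w >]%:R) w <=
  Ex s (fun w => (A w)%:R) w * Ex s (fun w => (B w)%:R) w.
Proof.
move=> p2; have [p0 p1] := andP p01.
elim: s A B => [|x s IH] A B iA iB /=.
  rewrite -natrM mulnb ler_nat; case: asboolP => // -[w1 [w2 [h1 h2 _ A1 B2]]].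
  by rewrite (iA _ _ h1 A1) (iB _ _ h2 B2).
pose A_ b w := A (upd w x b); pose B_ b w := B (upd w x b).
pose E (A B : (T -> bool) -> bool) := Ex s (fun w => `[< box A B w >]%:R) w : R.
have H0 : Ex s (fun w => `[< box A B (upd w x false) >]%:R) w <= E (A_ false) (B_ false).
  apply: ler_Ex => w'; rewrite ler_nat; case: asboolP => // -[w1 [w2 [h1 h2 h12 A1 B2]]].
  rewrite asboolT //; exists w1, w2; split => //.
  - by move=> z /h1; rewrite /upd; case: eqP.
  - by move=> z /h2; rewrite /upd; case: eqP.
  - apply: iA A1 => z wz; rewrite /upd; case: eqP => // zx.
    by have := h1 _ wz; rewrite /upd zx eqxx.
  - apply: iB B2 => z wz; rewrite /upd; case: eqP => // zx.
    by have := h2 _ wz; rewrite /upd zx eqxx.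
have H1 : Ex s (fun w => `[< box A B (upd w x true) >]%:R) w <=
    E (A_ true) (B_ false) + E (A_ false) (B_ true) - E (A_ false) (B_ false).
  rewrite /E -ExD -ExB; apply: ler_Ex => w'.
  have b1 : box (A_ false) (B_ false) w' -> box (A_ true) (B_ false) w'.
    move=> [w1 [w2 [h1 h2 h12 A1 B2]]]; exists w1, w2; split => //.
    by apply: iA A1 => z; rewrite /upd; case: eqP.
  have b2 : box (A_ false) (B_ false) w' -> box (A_ false) (B_ true) w'.
    move=> [w1 [w2 [h1 h2 h12 A1 B2]]]; exists w1, w2; split => //.
    by apply: iB B2 => z; rewrite /upd; case: eqP.
  have b3 : box A B (upd w' x true) -> box (A_ true) (B_ false) w' \/ box (A_ false) (B_ true) w'.
    move=> [w1 [w2 [h1 h2 h12 A1 B2]]].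
    have [w1x|w1x] := boolP (w1 x); [left|right].
    - exists (upd w1 x false), w2; split.
      + by move=> z; rewrite /upd; case: eqP => // zx /h1; rewrite /upd; case: eqP.
      + move=> z w2z; have := h2 _ w2z; rewrite /upd; case: eqP => // zx.
        by have := h12 x w1x; rewrite -zx w2z.
      + by move=> z; rewrite /upd; case: eqP => // _; exact: h12.
      + by apply: iA A1 => z; rewrite /upd; case: eqP.
      + apply: iB B2 => z; rewrite /upd; case: eqP => // ->.
        by rewrite (negbTE (h12 _ w1x)).
    - exists w1, (upd w2 x false); split.
      + move=> z w1z; have := h1 _ w1z; rewrite /upd; case: eqP => // zx.
        by rewrite zx (negbTE w1x) in w1z.
      + by move=> z; rewrite /upd; case: eqP => // zx /h2; rewrite /upd; case: eqP.
      + by move=> z w1z; rewrite /upd; case: eqP => // _; exact: h12.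
      + by apply: iA A1 => z; rewrite /upd; case: eqP => // ->; rewrite (negbTE w1x).
      + by apply: iB B2 => z; rewrite /upd; case: eqP.
  case: (asboolP (box (A_ false) (B_ false) _)) => [b|_].
    rewrite (asboolT (b1 b)) (asboolT (b2 b)); case: asboolP => _ /=; lra.
  case: (asboolP (box (A_ true) (B_ false) _)) => c1;
    case: (asboolP (box (A_ false) (B_ true) _)) => c2;
    case: asboolP => [/b3[b|b]|_] //=; lra.
pose a b := Ex s (fun w => (A_ b w)%:R) w : R.
pose c b := Ex s (fun w => (B_ b w)%:R) w : R.
have IH' b b' : E (A_ b) (B_ b') <= a b * c b' by apply: IH; exact: inc_upd.
have a01 : a false <= a true.
  by apply: ler_Ex => w'; rewrite ler_nat /A_; case: (boolP (A (upd w' x false))) => // h;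
    rewrite (_ : A (upd w' x true)) //; apply: iA h => z; rewrite /upd; case: eqP.
have c01 : c false <= c true.
  by apply: ler_Ex => w'; rewrite ler_nat /B_; case: (boolP (B (upd w' x false))) => // h;
    rewrite (_ : B (upd w' x true)) //; apply: iB h => z; rewrite /upd; case: eqP.
rewrite -/(a true) -/(a false) -/(c true) -/(c false).
have q0 : 0 <= 1 - 2 * p by lra.
have K1 := ler_wpM2l p0 (IH' true false); have K2 := ler_wpM2l p0 (IH' false true).
have K3 := ler_wpM2l q0 (IH' false false).
have K4 := ler_wpM2l p0 H1.
have q1 : 0 <= 1 - p by lra.
have K5 := ler_wpM2l q1 H0.
(* This product is exactly the difference between the right side and the bound obtained from the
   previous inequalities. *)
have K6 : 0 <= p * p * (a true - a false) * (c true - c false).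
  by rewrite !mulr_ge0 ?subr_ge0.
nra.
Qed.

End expectation.

(** * The process in finite boxes *)

Notation Site := (int * int)%type.

Definition nbr (x y : Site) := (`|x.1 - y.1| + `|x.2 - y.2|)%N == 1%N.

(** Naming two distinct active neighbours replaces the cardinality condition, and finite range and
    the link with rectangles become inductions on a derivation. *)
Inductive act (w : Site -> bool) : nat -> Site -> Prop :=
| act_init n x of w x : act w n x
| act_step n x of act w n x : act w n.+1 x
| act_nbrs n x y1 y2 of y1 != y2 & nbr x y1 & nbr x y2 & act w n y1 & act w n y2 : act w n.+1 x.

Lemma act_le (w : Site -> bool) m n x : (m <= n)%N -> act w m x -> act w n x.
Proof.
move=> /subnK <-; elim: (n - m)%N => [//|k IH] /IH h; rewrite addSn; exact: act_step.
Qed.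

Notation rect := ((int * int) * (int * int))%type.
Notation Rect l r b t := ((l, r), (b, t)).
Notation lft R := (R.1.1).
Notation rgt R := (R.1.2).
Notation bot R := (R.2.1).
Notation top R := (R.2.2).

Definition inR R (z : Site) := (lft R <= z.1 <= rgt R) && (bot R <= z.2 <= top R).

Definition zseq (l r : int) : seq int := [seq l + i%:Z | i <- iota 0 (absz (Num.max 0 (r - l + 1)))].

Lemma mem_zseq l r x : (x \in zseq l r) = (l <= x <= r).
Proof.
apply/mapP/idP => [[i]|h].
  rewrite mem_iota => /andP[_ h] ->; lia.
exists `|x - l|%N; last by lia.
rewrite mem_iota; lia.
Qed.

Lemma uniq_zseq l r : uniq (zseq l r).
Proof. rewrite map_inj_uniq ?iota_uniq // => i j /addrI; lia. Qed.

Lemma size_zseq l r : size (zseq l r) = (absz (Num.max 0 (r - l + 1))).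
Proof. by rewrite size_map size_iota. Qed.

Definition rsites (R : rect) : seq Site := [seq (x, y) | x <- zseq (lft R) (rgt R), y <- zseq (bot R) (top R)].

Lemma mem_rsites R z : (z \in rsites R) = inR R z.
Proof.
case: z => x y; apply/allpairsP/andP => /=.
  by move=> [[x' y'] /= [h1 h2 [-> ->]]]; rewrite -!mem_zseq.
by rewrite -!mem_zseq => -[h1 h2]; exists (x, y).
Qed.

Lemma uniq_rsites R : uniq (rsites R).
Proof. by apply: allpairs_uniq; rewrite ?uniq_zseq // => -[? ?] [? ?] _ _ [-> ->]. Qed.

Definition ball (t : nat) : rect := Rect (- t%:Z) t%:Z (- t%:Z) t%:Z.

Lemma act_local (w w' : Site -> bool) t x :
  (forall z, (`|z.1 - x.1| <= t)%N -> (`|z.2 - x.2| <= t)%N -> w z -> w' z) ->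
  act w t x -> act w' t x.
Proof.
move=> + a; elim: a => {t x} [n x h|n x _ IH|n x y1 y2 y12 n1 n2 _ h1 _ h2] H.
- apply: act_init; apply: H => //; lia.
- by apply: act_step; apply: IH => z z1 z2; apply: H; lia.
- apply: (act_nbrs y12 n1 n2); [apply: h1|apply: h2] => z z1 z2; apply: H;
  move: n1 n2; rewrite /nbr; lia.
Qed.

Lemma dep_act t : dep (mem (rsites (ball t))) (fun w => `[< act w t (0, 0) >]).
Proof.
move=> w w' ww'; apply: asbool_equiv_eq; split; apply: act_local => z /= z1 z2;
  rewrite ww' // inE mem_rsites /inR /ball /=; lia.
Qed.

(** * Runs of lines without two adjacent empty ones *)

(** The recurrence for runs of lines has order two. *)
Lemma seq2_ind {T : Type} (P : seq T -> Prop) : P [::] -> (forall x, P [:: x]) ->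
  (forall x y l, P l -> P (y :: l) -> P [:: x, y & l]) -> forall l, P l.
Proof.
move=> P0 P1 P2 l; suff [] : P l /\ forall x, P (x :: l) by [].
elim: l => [//|y l [Pl IH]]; split=> [|x]; first exact: IH.
exact: P2.
Qed.

Section blocks.
Variables (R : realType) (T : eqType) (p : R) (s : seq T).
Implicit Types (w : T -> bool) (L : seq (bool * seq T)) (x : bool * seq T).
Hypothesis p01 : 0 <= p <= 1.

Let p0 : 0 <= p. Proof. by case/andP: p01. Qed.
Let p1 : p <= 1. Proof. by case/andP: p01. Qed.

Lemma dep_site (z : T) : dep (pred1 z) (fun w : T -> bool => w z).
Proof. by move=> w w' /(_ z); apply; rewrite /= eqxx. Qed.

Lemma Ex_site z w : z \in s -> Ex p s (fun w => (w z)%:R) w = p.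
Proof.
elim: s => //= y r IH; rewrite inE; have [<-|zy] := eqVneq z y => /= [_|zr].
  rewrite (@eq_Ex _ _ _ _ _ (fun=> 1)) ?Ex_cst; last by move=> ?; rewrite /upd eqxx.
  rewrite (@eq_Ex _ _ _ _ _ (fun=> 0)) ?Ex_cst; last by move=> ?; rewrite /upd eqxx.
  ring.
rewrite !(@eq_Ex _ _ _ _ _ (fun w => (w z)%:R)) ?IH//; first ring.
- by move=> ?; rewrite /upd (negbTE zy).
- by move=> ?; rewrite /upd (negbTE zy).
Qed.

Lemma dep_has (l : seq T) : dep (mem l) (fun w => has w l).
Proof. by move=> w w' ww'; apply: eq_in_has => z; exact: ww'. Qed.

Lemma Ex_hasN (l : seq T) w : uniq l -> {subset l <= s} ->
  Ex p s (fun w => (~~ has w l)%:R) w = (1 - p) ^+ size l.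
Proof.
elim: l => [|z l IH] /=; first by rewrite Ex_cst expr0.
move=> /andP[zl ul] ls.
rewrite (@eq_Ex _ _ _ _ _ (fun w => (1 - (w z)%:R) * (~~ has w l)%:R)); last first.
  by move=> w'; case: (w' z); rewrite /= ?subrr ?mul0r ?subr0 ?mul1r.
rewrite (@Ex_indep _ _ _ (pred1 z) (mem l)); last 3 first.
- exact: (dep_comp (fun b : bool => 1 - b%:R : R) (@dep_site z)).
- exact: (dep_comp (fun b : bool => (~~ b)%:R : R) (dep_has (l:=l))).
- by move=> y /= /eqP ->.
rewrite IH // => [|y yl]; last by apply: ls; rewrite inE yl orbT.
by rewrite ExB Ex_cst Ex_site ?exprS // ls // inE eqxx.
Qed.

Lemma Ex_has (l : seq T) w : uniq l -> {subset l <= s} ->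
  Ex p s (fun w => (has w l)%:R) w = 1 - (1 - p) ^+ size l.
Proof.
move=> ul ls; rewrite -(Ex_hasN w ul ls) -[X in X - _](Ex_cst p s 1 w) -ExB.
by apply: eq_Ex => w'; case: (has _ _); rewrite /= ?subr0 ?subrr.
Qed.

(** The boolean marks a line known to be occupied through sites outside its list, such as those in
    the corners of a frame. A marked line also serves as a separator between two runs. *)
Definition occ w x := x.1 || has w x.2.

Definition sites L := flatten [seq x.2 | x <- L].

Lemma dep_occ L : dep (mem (sites L)) (fun w => [seq occ w x | x <- L]).
Proof.
move=> w w' ww'; apply/eq_in_map => x xL; rewrite /occ; congr (_ || _).
apply: eq_in_has => z zx; apply: ww'; apply/flattenP; exists x.2 => //.
exact: map_f.
Qed.

Lemma sorted_orb_true (l : seq bool) : sorted orb (true :: l) = sorted orb l.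
Proof. by case: l. Qed.

Let good w l L := (sorted orb ([seq occ w x | x <- L] ++ l))%:R : R.

Lemma dep_good l L : dep (mem (sites L)) (fun w => good w l L).
Proof. exact: (dep_comp (fun a => (sorted orb (a ++ l))%:R : R) (dep_occ (L:=L))). Qed.

Lemma Ex_good_true l x L w : x.1 -> Ex p s (fun w => good w l (x :: L)) w = Ex p s (fun w => good w l L) w.
Proof. by move=> x1; apply: eq_Ex => w'; rewrite /good /= /occ x1 -sorted_orb_true. Qed.

(** Either the first line is occupied and imposes nothing on the rest, or it is empty, the second is
    occupied, and the run restarts after it. For lines of equal size the characteristic equation is
    [b^2 = u * b + u * (1 - u)]. *)
Lemma Ex_good_step l x y L w : uniq (sites [:: x, y & L]) -> {subset sites [:: x, y & L] <= s} ->
  ~~ x.1 -> ~~ y.1 -> let u := 1 - (1 - p) ^+ size x.2 in let v := 1 - (1 - p) ^+ size y.2 in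
  Ex p s (fun w => good w l [:: x, y & L]) w =
    u * Ex p s (fun w => good w l (y :: L)) w + (1 - u) * v * Ex p s (fun w => good w l L) w.
Proof.
move=> uL Ls x1 y1 u v; have := uL; rewrite /sites /= cat_uniq => /and3P[ux xyL uyL].
have := uyL; rewrite cat_uniq => /and3P[uy yL _].
rewrite (@eq_Ex _ _ _ _ _ (fun w => (has w x.2)%:R * good w l (y :: L) +
    (~~ has w x.2)%:R * ((has w y.2)%:R * good w l L))); last first.
  move=> w'; rewrite /good /= /occ (negbTE x1) (negbTE y1) /=.
  case: (has w' x.2); rewrite /= ?mul1r ?mul0r ?addr0 ?add0r //.
  by case: (has w' y.2); rewrite /= ?mul1r ?mul0r // -sorted_orb_true.
have xs : {subset x.2 <= s}.
  by move=> z zx; apply: Ls; rewrite /sites /= mem_cat zx.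
have ys : {subset y.2 <= s}.
  by move=> z zx; apply: Ls; rewrite /sites /= !mem_cat zx orbT.
have dis (a b : seq T) : ~~ has (mem a) b -> forall z, z \in a -> ~~ (z \in b).
  by move=> /hasPn ab z za; apply/negP => /ab; rewrite /= za.
rewrite ExD (@Ex_indep _ _ _ (mem x.2) (mem (sites (y :: L)))); last 3 first.
- exact: (dep_comp (fun b : bool => b%:R : R) (dep_has (l:=x.2))).
- exact: dep_good.
- exact: dis.
rewrite (@Ex_indep _ _ _ (mem x.2) (mem (sites (y :: L)))); last 3 first.
- exact: (dep_comp (fun b : bool => (~~ b)%:R : R) (dep_has (l:=x.2))).
- apply: dep_comp2.
    apply: (depS _ (dep_comp (fun b : bool => b%:R : R) (dep_has (l:=y.2)))) => z /= zy.
    by rewrite /sites /= mem_cat zy.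
  apply: depS (@dep_good l L) => z /= zy.
  by rewrite /sites /= mem_cat -/(sites L) zy orbT.
- exact: dis.
rewrite (@Ex_indep _ _ _ (mem y.2) (mem (sites L))); last 3 first.
- exact: (dep_comp (fun b : bool => b%:R : R) (dep_has (l:=y.2))).
- exact: dep_good.
- exact: dis.
rewrite Ex_hasN // !Ex_has // /u /v; ring.
Qed.

Lemma good_le1 w l L : good w l L <= 1.
Proof. by rewrite /good lern1; case: (sorted _ _). Qed.

Lemma occ_prob01 (h : nat) : 0 <= 1 - (1 - p) ^+ h <= 1.
Proof.
have [a0 a1] := andP p01; have q0 : 0 <= 1 - p by lra.
have q1 : 1 - p <= 1 by lra.
have := exprn_ge0 h q0; have := exprn_ile1 h q0 q1; lra.
Qed.

(** [b] is a supersolution of the recurrence. A marked line gets [b^-1] rather than 1 because it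
    frees the unmarked line before it, whose factor [b] must be given back. The prefactor pays for a
    run of one line, whose probability is bounded by 1. *)
Lemma Ex_sorted_le (h : nat) (b : R) L w : let u := 1 - (1 - p) ^+ h in
  0 < b <= 1 -> u * b + u * (1 - u) <= b ^+ 2 ->
  (forall x, x \in L -> ~~ x.1 -> size x.2 = h) ->
  uniq (sites L) -> {subset sites L <= s} ->
  Ex p s (fun w => (sorted orb [seq occ w x | x <- L])%:R) w <=
  b^-1 * \prod_(x <- L) (if x.1 then b^-1 else b).
Proof.
move=> u /andP[b0 b1] ub.
have bi1 : 1 <= b^-1 by rewrite invf_ge1.
have u01 := occ_prob01 h; rewrite -/u in u01.
rewrite (@eq_Ex _ _ _ _ _ (fun w => good w [::] L)); last by move=> w'; rewrite /good cats0.
elim/(@seq2_ind (bool * seq T)%type): L => [|x|x y L IH1 IH2] Lh uL Ls.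
- rewrite big_nil mulr1 (le_trans _ bi1) // -(Ex_cst p s 1 w).
  by apply: ler_Ex => // w'; exact: good_le1.
- rewrite big_seq1; apply: (@le_trans _ _ 1).
    by rewrite -(Ex_cst p s 1 w); apply: ler_Ex => // w'; exact: good_le1.
  by case: ifP => _; rewrite ?mulVf ?gt_eqF // mulr_ege1.
- have uyL : uniq (sites (y :: L)) by move: uL; rewrite /sites /= cat_uniq => /and3P[].
  have uL' : uniq (sites L) by move: uyL; rewrite /sites /= cat_uniq => /and3P[].
  have yLs : {subset sites (y :: L) <= s}.
    by move=> z zL; apply: Ls; rewrite [sites _]/(x.2 ++ sites (y :: L)) mem_cat zL orbT.
  have Ls' : {subset sites L <= s}.
    by move=> z zL; apply: yLs; rewrite [sites _]/(y.2 ++ sites L) mem_cat zL orbT.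
  have yLh : forall x, x \in y :: L -> ~~ x.1 -> size x.2 = h.
    by move=> z zL; apply: Lh; rewrite inE zL orbT.
  have Lh' : forall x, x \in L -> ~~ x.1 -> size x.2 = h.
    by move=> z zL; apply: yLh; rewrite inE zL orbT.
  have {}IH1 := IH1 Lh' uL' Ls'; have {}IH2 := IH2 yLh uyL yLs.
  have P0 : 0 <= \prod_(x <- L) (if x.1 then b^-1 else b).
    by apply: prodr_ge0 => i _; case: ifP; rewrite ?invr_ge0 ltW.
  rewrite !big_cons in IH2 *.
  set c := b^-1 in bi1 P0 IH1 IH2 *; set Q := \prod_(_ <- L) _ in P0 IH1 IH2 *.
  have c0 : 0 <= c by lra.
  have cb : c * b = 1 by rewrite /c mulVf ?gt_eqF.
  clearbody c Q.
  case: (boolP x.1) => x1.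
    rewrite (Ex_good_true _ _ _ x1) (le_trans IH2) //=; apply: ler_peMl => //.
    by rewrite mulr_ge0 // mulr_ge0 //; case: ifP => _ //; exact: ltW.
  case: (boolP y.1) => y1.
    apply: (@le_trans _ _ (Ex p s (fun w => good w [::] L) w)).
      apply: ler_Ex => // w'; rewrite /good !cats0 /= ler_nat.
      rewrite [occ w' y]/occ y1 orbT /=; case: (boolP (path _ _ _)) => // /path_sorted.
      by move=> ->.
    apply: (le_trans IH1) => /=.
    by rewrite [X in _ <= _ * X]mulrA (mulrC b) cb mul1r.
  rewrite Ex_good_step //= (Lh x) ?inE ?eqxx // (Lh y) ?inE ?eqxx ?orbT // -/u.
  rewrite (negbTE y1) in IH2.
  have [u0 u1] := andP u01.
  have K1 := ler_wpM2l u0 IH2.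
  have v0 : 0 <= (1 - u) * u by rewrite mulr_ge0 // subr_ge0.
  have K2 := ler_wpM2l v0 IH1.
  apply: (le_trans (lerD K1 K2)).
  rewrite (_ : _ + _ = c * Q * (u * b + u * (1 - u))); last ring.
  rewrite (_ : c * (b * (b * Q)) = c * Q * b ^+ 2); last ring.
  by apply: ler_wpM2l => //; rewrite mulr_ge0.
Qed.

(** [b] is a subsolution. The appended [false] forces the last line to be occupied, so that growth
    reaches the end of the run; [u / b] is exact for a single line. *)
Lemma Ex_sorted_ge (h : nat) (b : R) (L : seq (seq T)) w : let u := 1 - (1 - p) ^+ h in
  0 < b -> u <= b -> b ^+ 2 <= u * b + u * (1 - u) ->
  (forall c, c \in L -> size c = h) ->
  uniq (flatten L) -> {subset flatten L <= s} ->
  u / b * b ^+ size L <=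
  Ex p s (fun w => (sorted orb (rcons [seq has w c | c <- L] false))%:R) w.
Proof.
move=> u b0 ubb ub.
have u01 := occ_prob01 h; rewrite -/u in u01.
have [u0 u1] := andP u01.
pose M := [seq (false, c) | c <- L].
have ML : sites M = flatten L by rewrite /sites /M -map_comp map_id.
rewrite (@eq_Ex _ _ _ _ _ (fun w => good w [:: false] M)); last first.
  by move=> w'; rewrite /good cats1 /M -map_comp.
rewrite -ML; have -> : size L = size M by rewrite size_map.
move=> Lh; have {Lh} : forall x, x \in M -> ~~ x.1 && (size x.2 == h).
  by move=> x /mapP[y yL -> /=]; rewrite Lh.
elim/(@seq2_ind (bool * seq T)%type): {ML} M => [|x|x y K IH1 IH2] Lh uL Ls /=.
- by rewrite mulr1 Ex_cst ler_pdivrMr // mul1r.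
- have /andP[x1 /eqP xh] := Lh x (mem_head _ _).
  move: uL Ls; rewrite /sites /= cats0 => ux xs.
  rewrite (@eq_Ex _ _ _ _ _ (fun w => (has w x.2)%:R)).
    by rewrite Ex_has // xh -/u mulfVK // gt_eqF.
  by move=> w'; rewrite /good /= /occ (negbTE x1) orbF andbT.
- have uyL : uniq (sites (y :: K)) by move: uL; rewrite /sites /= cat_uniq => /and3P[].
  have uL' : uniq (sites K) by move: uyL; rewrite /sites /= cat_uniq => /and3P[].
  have yLs : {subset sites (y :: K) <= s}.
    by move=> z zL; apply: Ls; rewrite [sites _]/(x.2 ++ sites (y :: K)) mem_cat zL orbT.
  have Ls' : {subset sites K <= s}.
    by move=> z zL; apply: yLs; rewrite [sites _]/(y.2 ++ sites K) mem_cat zL orbT.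
  have yLh : forall x, x \in y :: K -> ~~ x.1 && (size x.2 == h).
    by move=> z zL; apply: Lh; rewrite inE zL orbT.
  have Lh' : forall x, x \in K -> ~~ x.1 && (size x.2 == h).
    by move=> z zL; apply: yLh; rewrite inE zL orbT.
  have {}IH1 := IH1 Lh' uL' Ls'; have {}IH2 := IH2 yLh uyL yLs.
  have /andP[x1 /eqP xh] := Lh x (mem_head _ _).
  have /andP[y1 /eqP yh] := yLh y (mem_head _ _).
  rewrite Ex_good_step //= xh yh -/u.
  have K1 := ler_wpM2l u0 IH2.
  have v0 : 0 <= (1 - u) * u by rewrite mulr_ge0 // subr_ge0.
  have K2 := ler_wpM2l v0 IH1.
  apply: le_trans (lerD K1 K2).
  rewrite !exprS; set c := u / b; set Q := b ^+ size K.
  have cQ : 0 <= c * Q by rewrite !mulr_ge0 ?invr_ge0 ?exprn_ge0 // ltW.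
  clearbody c Q.
  rewrite (_ : u * _ + (1 - u) * u * _ = c * Q * (u * b + u * (1 - u))); last ring.
  rewrite (_ : c * (b * (b * Q)) = c * Q * b ^+ 2); last ring.
  exact: ler_wpM2l.
Qed.

End blocks.

(** * Internally spanned rectangles *)

Ltac rlia := repeat match goal with x : prod _ _ |- _ => destruct x end;
  cbn [fst snd] in *; lia.

Section spanning.
Implicit Types (w : Site -> bool) (R S : rect) (z : Site) (c : Site -> int).

Definition join R1 R2 : rect :=
  Rect (Num.min (lft R1) (lft R2)) (Num.max (rgt R1) (rgt R2))
       (Num.min (bot R1) (bot R2)) (Num.max (top R1) (top R2)).

(** Coarser than what the process allows: rectangles separated by one row and one column at once
    also count. This only enlarges the class of spanned rectangles, which is harmless for upper
    bounds. *)
Definition near R1 R2 :=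
  [&& lft R2 <= rgt R1 + 2, lft R1 <= rgt R2 + 2, bot R2 <= top R1 + 2 & bot R1 <= top R2 + 2].

Definition valid R := (lft R <= rgt R) && (bot R <= top R).

Definition subR R1 R2 :=
  [&& lft R2 <= lft R1, rgt R1 <= rgt R2, bot R2 <= bot R1 & top R1 <= top R2].

Definition width R := absz (rgt R - lft R + 1).
Definition height R := absz (top R - bot R + 1).
Definition phi R := (width R + height R)%N.
Definition long R := maxn (width R) (height R).

(** A join splits the configuration into disjoint parts, so a derivation exhibits the disjoint
    occurrence of the spanning of its two pieces. *)
Inductive Span w : rect -> Prop :=
| Span_site x of w x : Span w (Rect x.1 x.1 x.2 x.2)
| Span_join w1 w2 R1 R2 of (forall z, w1 z -> w z) & (forall z, w2 z -> w z) &
    (forall z, w1 z -> ~~ w2 z) & Span w1 R1 & Span w2 R2 & near R1 R2 : Span w (join R1 R2).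

Lemma Span_valid w R : Span w R -> valid R.
Proof.
elim=> {w R} [w x wx|w w1 w2 R1 R2 _ _ _ _ h1 _ h2 _]; rewrite /valid /join /= ?lexx //.
by move: h1 h2; rewrite /valid; rlia.
Qed.

Lemma Span_inc w w' R : (forall z, w z -> w' z) -> Span w R -> Span w' R.
Proof.
move=> ww' h; case: h ww' => {R} [x wx|w1 w2 R1 R2 h1 h2 h12 s1 s2 n12] ww'.
  by apply: Span_site; exact: ww'.
by apply: (Span_join _ _ h12 s1 s2 n12) => z; [move/h1|move/h2]; exact: ww'.
Qed.

Lemma subR_inR R1 R2 z : subR R1 R2 -> inR R1 z -> inR R2 z.
Proof. rewrite /subR /inR; rlia. Qed.

Lemma subR_trans R1 R2 R3 : subR R1 R2 -> subR R2 R3 -> subR R1 R3.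
Proof. rewrite /subR; rlia. Qed.

Lemma subRR R : subR R R.
Proof. rewrite /subR; rlia. Qed.

Lemma subR_joinl R1 R2 : subR R1 (join R1 R2).
Proof. rewrite /subR /join /=; rlia. Qed.

Lemma subR_joinr R1 R2 : subR R2 (join R1 R2).
Proof. rewrite /subR /join /=; rlia. Qed.

Lemma Span_restrict w R : Span w R -> Span (fun z => w z && inR R z) R.
Proof.
elim=> {w R} [w x wx|w w1 w2 R1 R2 h1 h2 h12 _ s1 _ s2 n12].
  by apply: Span_site; rewrite wx /inR /= !lexx.
apply: (Span_join _ _ _ s1 s2 n12) => z /andP[wz Rz].
- by rewrite h1 //= (subR_inR (subR_joinl _ _)).
- by rewrite h2 //= (subR_inR (subR_joinr _ _)).
- by rewrite (negbTE (h12 _ wz)).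
Qed.

Definition pieces_ok (L : seq (seq Site * rect)) :=
  (forall a, a \in L -> Span (mem a.1) a.2) /\
  (forall a b, a \in L -> b \in L -> a != b ->
     (forall z, z \in a.1 -> z \notin b.1) /\ ~~ near a.2 b.2).

Lemma nearC R1 R2 : near R1 R2 = near R2 R1.
Proof. rewrite /near; rlia. Qed.

(** The new piece absorbs one near piece and their join is inserted again; the number of old pieces
    drops each time. *)
Lemma insert_piece (L : seq (seq Site * rect)) (x : seq Site * rect) :
  pieces_ok L -> Span (mem x.1) x.2 ->
  (forall y, y \in L -> forall z, z \in x.1 -> z \notin y.1) ->
  exists L', [/\ pieces_ok L',
    (forall z y, y \in x :: L -> inR y.2 z -> exists2 y', y' \in L' & inR y'.2 z) &
    (forall z y, y \in L' -> z \in y.1 -> exists2 y', y' \in x :: L & z \in y'.1)].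
Proof.
have [n] := ubnP (size L); elim: n L x => // n IH L x /ltnSE Ln [L1 L2] sx dx.
have [/hasP[y yL nxy]|/hasPn far] := boolP (has (fun y => near x.2 y.2) L).
- pose x' := (x.1 ++ y.1, join x.2 y.2).
  pose L' := [seq b <- L | b != y].
  have L'L b : b \in L' -> b \in L by rewrite mem_filter => /andP[].
  have [||||L'' [H1 H2 H3]] := IH L' x'.
  + apply: leq_trans Ln; rewrite size_filter.
    by rewrite -(count_predC (pred1 y) L) -[ltnLHS]add0n ltn_add2r -has_count has_pred1.
  + split => [a /L'L /L1 //|a b /L'L aL /L'L bL]; exact: L2.
  + apply: (Span_join (w1 := mem x.1) (w2 := mem y.1)) => //.
    * by move=> z zx; rewrite /= mem_cat [z \in x.1]zx.
    * by move=> z zx; rewrite /= mem_cat [z \in y.1]zx orbT.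
    * exact: dx.
    * exact: L1.
  + move=> b bL' z; rewrite mem_cat => /orP[zx|zy]; first by apply: dx zx; exact: L'L.
    move: bL'; rewrite mem_filter => /andP[bNy bL].
    by apply: (L2 y b yL bL _).1 => //; rewrite eq_sym.
  exists L''; split => //.
  + move=> z b; rewrite inE => /predU1P[->|bL] bz.
      by apply: (H2 z x'); rewrite ?inE ?eqxx // (subR_inR (subR_joinl _ _)).
    have [by_|bNy] := eqVneq b y.
      by apply: (H2 z x'); rewrite ?inE ?eqxx // (subR_inR (subR_joinr _ _)) // -by_.
    by apply: (H2 z b) => //; rewrite inE mem_filter bNy bL orbT.
  + move=> z b /H3 h /h[b']; rewrite inE => /predU1P[->|/L'L b'L] zb'; last first.
      by exists b' => //; rewrite inE b'L orbT.
    move: zb'; rewrite mem_cat => /orP[zx|zy]; first by exists x; rewrite ?inE ?eqxx.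
    by exists y; rewrite ?inE ?yL ?orbT.
- exists (x :: L); split; last 2 first.
  + by move=> z y yL yz; exists y.
  + by move=> z y yL yz; exists y.
  split=> [a|a b]; rewrite inE; first by move=> /predU1P[->|/L1].
  move=> /predU1P[->|aL]; rewrite inE => /predU1P[->|bL]; rewrite ?eqxx //.
  + by move=> _; split; [exact: dx|exact: far].
  + move=> _; split; last by rewrite nearC; exact: far.
    by move=> z za; apply: contraL za; exact: dx.
  + exact: L2.
Qed.

Lemma exists_pieces (l : seq Site) : uniq l -> exists L, [/\ pieces_ok L,
  (forall z, z \in l -> exists2 y, y \in L & inR y.2 z) &
  (forall z y, y \in L -> z \in y.1 -> z \in l)].
Proof.
elim: l => [_|x l IH /= /andP[xl ul]]; first by exists [::].
have [L [ok H1 H2]] := IH ul.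
have [|||L' [ok' H1' H2']] := @insert_piece L ([:: x], Rect x.1 x.1 x.2 x.2).
- exact: ok.
- by apply: (Span_site (w := mem [:: x])); rewrite /= inE eqxx.
- move=> y yL z; rewrite inE => /eqP ->; apply: contra xl; exact: H2.
exists L'; split => //.
- move=> z; rewrite inE => /predU1P[->|/H1[y yL yz]].
    by apply: (H1' x ([:: x], Rect x.1 x.1 x.2 x.2)); rewrite ?inE ?eqxx // /inR; rlia.
  by apply: (H1' z y) => //; rewrite inE yL orbT.
- move=> z y /H2' h /h[y']; rewrite inE => /predU1P[->|y'L] /=.
    by rewrite inE => /eqP ->; rewrite inE eqxx.
  by move=> /(H2 _ _ y'L); rewrite inE orbC => ->.
Qed.

(** A family of rectangles that are pairwise not near is closed under the dynamics, so the
    rectangles built from the occupied sites within distance [n] of [x] contain everything these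
    sites activate. *)
Lemma act_Span w n x : act w n x ->
  exists R, [/\ Span (fun z => w z && (z \in [seq z + x | z <- rsites (ball n)])) R & inR R x].
Proof.
move=> a; pose l := [seq z <- [seq z + x | z <- rsites (ball n)] | w z].
have ul : uniq l by rewrite filter_uniq // map_inj_uniq ?uniq_rsites // => ? ? /addIr.
have [L [[ok1 ok2] H1 H2]] := exists_pieces ul.
have {}a : act (mem l) n x.
  apply: act_local a => z z1 z2 wz; rewrite /= mem_filter wz /=.
  apply/mapP; exists (z - x); last by rewrite subrK.
  rewrite mem_rsites /inR /ball /=; rlia.
suff H m y : act (mem l) m y -> exists2 b, b \in L & inR b.2 y.
  have [y yL yx] := H _ _ a.
  exists y.2; split => //; apply: Span_inc (ok1 _ yL) => z /= /(H2 _ _ yL).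
  by rewrite mem_filter.
clear a; elim=> {m y} [m y /= /H1 //|//|m y y1 y2 y12 n1 n2 _ [a aL ay] _ [b bL bz]].
clear - ok1 ok2 y12 n1 n2 aL ay bL bz; rename y into x.
(* Two distinct neighbours of a site in one rectangle force the site into it; in two rectangles they
   would make these near. *)
have [ab|ab] := eqVneq a b.
  rewrite -ab in bz; exists a => //; move: y12 n1 n2 ay bz.
  case: x => x1 x2; case: y1 => y11 y12; case: y2 => y21 y22; rewrite xpair_eqE /nbr /inR /=; rlia.
have [_] := ok2 _ _ aL bL ab.
rewrite /near; move: n1 n2 ay bz; rewrite /nbr /inR /=; rlia.
Qed.

(** Descend the derivation while some part has long side at least [m]. At the stop both parts have
    long side at most [m - 1], and joining them adds at most one line. *)
Lemma Span_scale w R m : (0 < m)%N -> Span w R -> (m <= long R)%N ->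
  exists R', [/\ Span w R', subR R' R & (m <= long R' <= 2 * m)%N].
Proof.
move=> m0; elim=> {w R} [w x wx|w w1 w2 R1 R2 h1 h2 h12 s1 IH1 s2 IH2 n12] lR.
  exists (Rect x.1 x.1 x.2 x.2); split; rewrite ?subRR //; first exact: Span_site.
  move: lR; rewrite /long /width /height /=; rlia.
have [/IH1[R' [a b c]]|l1] := leqP m (long R1).
  exists R'; split => //; first exact: Span_inc a.
  exact: subR_trans (subR_joinl _ _).
have [/IH2[R' [a b c]]|l2] := leqP m (long R2).
  exists R'; split => //; first exact: Span_inc a.
  exact: subR_trans (subR_joinr _ _).
exists (join R1 R2); split; rewrite ?subRR //.
  exact: Span_join h12 s1 s2 n12.
have := Span_valid s1; have := Span_valid s2.
move: n12 lR l1 l2; rewrite /valid /near /long /width /height /join /=; rlia.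
Qed.

(* [P i] means that column (or row) [i] meets the inner rectangle. *)
Definition cov c (P : int -> bool) (l r : int) w :=
  [/\ forall i, l <= i -> i + 1 <= r -> ~~ P i -> ~~ P (i + 1) ->
        exists2 z, w z & (c z == i) || (c z == i + 1),
      ~~ P l -> exists2 z, w z & c z == l &
      ~~ P r -> exists2 z, w z & c z == r].

Definition itv (l r i : int) := (l <= i <= r).

Lemma cov_inc c P l r w w' : (forall z, w z -> w' z) -> cov c P l r w -> cov c P l r w'.
Proof.
move=> ww' [h1 h2 h3]; split.
- by move=> i a b d e; have [z wz hz] := h1 i a b d e; exists z => //; exact: ww'.
- by move=> /h2[z wz hz]; exists z => //; exact: ww'.
- by move=> /h3[z wz hz]; exists z => //; exact: ww'.
Qed.

(** The end clauses of [cov] exist for this step: across a gap of at most one line, an adjacent pair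
    inside neither segment contains an end line of one of them. *)
Lemma cov_join c P l1 r1 l2 r2 w : l1 <= r1 -> l2 <= r2 -> l2 <= r1 + 2 -> l1 <= r2 + 2 ->
  cov c P l1 r1 w -> cov c xpred0 l2 r2 w ->
  cov c P (Num.min l1 l2) (Num.max r1 r2) w.
Proof.
move=> lr1 lr2 n1 n2 [h1 h2 h3] [k1 k2 k3].
have {}k2 := k2 isT; have {}k3 := k3 isT; split.
- move=> i li ir Pi Pi1.
  have [/andP[a b]|d1] := boolP ((l1 <= i) && (i + 1 <= r1)); first exact: h1.
  have [/andP[a b]|d2] := boolP ((l2 <= i) && (i + 1 <= r2)); first exact: k1.
  have [a|d3] := eqVneq i r1.
    by rewrite a in Pi *; have [z wz hz] := h3 Pi; exists z => //; rewrite hz.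
  have [a|d4] := eqVneq (i + 1) l1.
    by rewrite a in Pi1 *; have [z wz hz] := h2 Pi1; exists z => //; rewrite hz orbT.
  have [a|d5] := eqVneq i r2.
    by rewrite a; have [z wz hz] := k3; exists z => //; rewrite hz.
  have [a|d6] := eqVneq (i + 1) l2.
    by rewrite a; have [z wz hz] := k2; exists z => //; rewrite hz orbT.
  exfalso; rlia.
- move=> Pl; have [a|a] := leP l1 l2; last exact: k2.
  by move: Pl; rewrite (_ : Num.min l1 l2 = l1); [exact: h2|rlia].
- move=> Pr; have [a|a] := leP r1 r2; first exact: k3.
  by move: Pr; rewrite (_ : Num.max r1 r2 = r1); [exact: h3|rlia].
Qed.

Lemma Span_cov w R : Span w R ->
  cov fst xpred0 (lft R) (rgt R) w /\ cov snd xpred0 (bot R) (top R) w.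
Proof.
elim=> {w R} [w x wx|w w1 w2 R1 R2 h1 h2 h12 s1 [a1 b1] s2 [a2 b2] n12].
  split; split => /=; try (by move=> _; exists x => //=); rlia.
have := Span_valid s1; have := Span_valid s2; move: n12.
rewrite /valid /near /join /= => /and4P[c1 c2 c3 c4] /andP[v1 v2] /andP[v3 v4].
by split; apply: cov_join => //; (exact: (cov_inc h1)) || exact: (cov_inc h2).
Qed.

Lemma joinC R1 R2 : join R1 R2 = join R2 R1.
Proof. by rewrite /join; congr (_, _, (_, _)); rewrite 1?minC // maxC. Qed.

(** The derivation is descended while one part exceeds the threshold. A part left behind is spanned
    by its own sites, so it satisfies [cov] with no line exempted, and [cov_join] carries the frame
    condition back up. A single site has [phi] equal to 2, hence [2 <= th]. *)
Lemma Span_split w R (th : nat) : Span w R -> (2 <= th < phi R)%N ->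
  exists S1 S2 w1 w2,
  [/\ [/\ forall z, w1 z -> w z, forall z, w2 z -> w z & forall z, w1 z -> ~~ w2 z],
      [/\ Span w1 S1, Span w2 S2 & near S1 S2],
      [/\ (phi S1 <= th)%N, (phi S2 <= th)%N & (th < phi (join S1 S2))%N],
      subR (join S1 S2) R &
      cov fst (itv (lft (join S1 S2)) (rgt (join S1 S2))) (lft R) (rgt R) w /\
      cov snd (itv (bot (join S1 S2)) (top (join S1 S2))) (bot R) (top R) w].
Proof.
elim=> {w R} [w x wx|w w1 w2 R1 R2 h1 h2 h12 s1 IH1 s2 IH2 n12] /andP[th2 lR].
  by move: lR; rewrite /phi /width /height /=; rlia.
have v1 := Span_valid s1; have v2 := Span_valid s2.
have cv1 := Span_cov s1; have cv2 := Span_cov s2.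
have lift w1' w2' R1' R2' (h1' : forall z, w1' z -> w z) (h2' : forall z, w2' z -> w z) :
    valid R1' -> near R1' R2' -> valid R2' ->
    cov fst xpred0 (lft R2') (rgt R2') w2' /\ cov snd xpred0 (bot R2') (top R2') w2' ->
    (exists S1 S2 (wa wb : Site -> bool),
  [/\ [/\ forall z, wa z -> w1' z, forall z, wb z -> w1' z & forall z, wa z -> ~~ wb z],
      [/\ Span wa S1, Span wb S2 & near S1 S2],
      [/\ (phi S1 <= th)%N, (phi S2 <= th)%N & (th < phi (join S1 S2))%N],
      subR (join S1 S2) R1' &
      cov fst (itv (lft (join S1 S2)) (rgt (join S1 S2))) (lft R1') (rgt R1') w1' /\
      cov snd (itv (bot (join S1 S2)) (top (join S1 S2))) (bot R1') (top R1') w1']) ->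
    exists S1 S2 (wa wb : Site -> bool),
  [/\ [/\ forall z, wa z -> w z, forall z, wb z -> w z & forall z, wa z -> ~~ wb z],
      [/\ Span wa S1, Span wb S2 & near S1 S2],
      [/\ (phi S1 <= th)%N, (phi S2 <= th)%N & (th < phi (join S1 S2))%N],
      subR (join S1 S2) (join R1' R2') &
      cov fst (itv (lft (join S1 S2)) (rgt (join S1 S2))) (lft (join R1' R2')) (rgt (join R1' R2')) w /\
      cov snd (itv (bot (join S1 S2)) (top (join S1 S2))) (bot (join R1' R2')) (top (join R1' R2')) w].
  move=> v1' /and4P[c1 c2 c3 c4] v2' [cx cy] [S1 [S2 [wa [wb [[a1 a2 a3] b d e [f g]]]]]].
  exists S1, S2, wa, wb; split => //.
  - by split=> // z; [move/a1/h1'|move/a2/h1'].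
  - exact: subR_trans e (subR_joinl _ _).
  - move: v1' v2' => /andP[? ?] /andP[? ?].
    by split; apply: cov_join => //; (exact: (cov_inc h1')) || exact: (cov_inc h2').
have [l1|l1] := ltnP th (phi R1).
  by apply: (lift w1 w2 R1 R2 h1 h2 v1 n12 v2 cv2); apply: IH1; rewrite th2.
have [l2|l2] := ltnP th (phi R2).
  rewrite joinC; rewrite nearC in n12.
  by apply: (lift w2 w1 R2 R1 h2 h1 v2 n12 v1 cv1); apply: IH2; rewrite th2.
exists R1, R2, w1, w2; split; rewrite ?subRR //.
have := v1; have := v2; rewrite /valid /join => ? ?.
by split; split => [i|/negP|/negP]; rewrite /itv => a; try (by case: a; rlia); move=> b; rlia.
Qed.

End spanning.

(** * Probability of covering a frame *)

Section coverings.
Implicit Types (w : Site -> bool) (R S : rect) (z : Site).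

Lemma mergexx (T : eqType) (D : pred T) (w : T -> bool) : merge D w w = w.
Proof. by apply/funext => z; rewrite /merge; case: ifP. Qed.

Definition cols (i b t : int) : seq Site := [seq (i, y) | y <- zseq b t].
Definition rows (j l r : int) : seq Site := [seq (x, j) | x <- zseq l r].

(** Columns have the full height of [R] and rows its full width, so the corners of the frame are
    read twice. *)
Definition covE S R w :=
  [&& sorted orb [seq has w (cols i (bot R) (top R)) | i <- zseq (lft R) (lft S - 1)],
      sorted orb [seq has w (cols i (bot R) (top R)) | i <- zseq (rgt S + 1) (rgt R)],
      sorted orb [seq has w (rows j (lft R) (rgt R)) | j <- zseq (bot R) (bot S - 1)] &
      sorted orb [seq has w (rows j (lft R) (rgt R)) | j <- zseq (top S + 1) (top R)]].

Lemma mem_cols z i b t : (z \in cols i b t) = (z.1 == i) && (b <= z.2 <= t).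
Proof.
case: z => x y /=; apply/mapP/idP => [[y' + [-> ->]]|/andP[/eqP -> h]].
  by rewrite mem_zseq eqxx.
by exists y => //; rewrite mem_zseq.
Qed.

Lemma mem_rows z j l r : (z \in rows j l r) = (z.2 == j) && (l <= z.1 <= r).
Proof.
case: z => x y /=; apply/mapP/idP => [[y' + [-> ->]]|/andP[/eqP -> h]].
  by rewrite mem_zseq eqxx.
by exists x => //; rewrite mem_zseq.
Qed.

Lemma zseq_cons l r : l <= r -> zseq l r = l :: zseq (l + 1) r.
Proof.
move=> lr; rewrite /zseq.
have -> : absz (Num.max 0 (r - l + 1)) = (absz (Num.max 0 (r - (l + 1) + 1))).+1 by lia.
rewrite /= addr0; congr (_ :: _); rewrite (iotaDl 1 0) -map_comp.
by apply: eq_map => i /=; lia.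
Qed.

Lemma zseq_nil l r : r < l -> zseq l r = [::].
Proof. by move=> lr; apply/nilP; rewrite /nilp size_zseq; lia. Qed.

Lemma sorted_zseq (f : int -> bool) l r :
  (forall i, l <= i -> i + 1 <= r -> f i || f (i + 1)) -> sorted orb [seq f i | i <- zseq l r].
Proof.
have [n] := ubnP (absz (Num.max 0 (r - l + 1))); elim: n l => // n IH l /ltnSE Ln H.
have [lr|lr] := leP l r; last by rewrite zseq_nil.
rewrite zseq_cons //=.
have {IH} : sorted orb [seq f i | i <- zseq (l + 1) r].
  apply: IH => [|i a b]; first by lia.
  by apply: H => //; lia.
have [lr'|lr'] := leP (l + 1) r; last by rewrite zseq_nil.
by rewrite zseq_cons //= => ->; rewrite H.
Qed.

Definition strips (l sl sr r : int) := zseq l (sl - 1) ++ zseq (sr + 1) r.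

Lemma mem_strips l sl sr r i : l <= sl -> sr <= r -> sl <= sr ->
  (i \in strips l sl sr r) = (l <= i <= r) && ~~ itv sl sr i.
Proof. rewrite mem_cat !mem_zseq /itv; lia. Qed.

Lemma uniq_strips l sl sr r : sl <= sr -> uniq (strips l sl sr r).
Proof.
move=> h; rewrite cat_uniq !uniq_zseq andbT; apply/hasPn => i; rewrite !mem_zseq /= ?mem_zseq; lia.
Qed.

Lemma size_strips l sl sr r : l <= sl -> sr <= r -> sl <= sr ->
  (size (zseq l (sl - 1)) + size (zseq (sr + 1) r) = absz (r - l + 1)%R - absz (sr - sl + 1)%R)%N.
Proof. rewrite !size_zseq; lia. Qed.

Lemma cov_covE S R w : valid S -> subR S R ->
  cov fst (itv (lft S) (rgt S)) (lft R) (rgt R) (fun z => w z && inR R z) ->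
  cov snd (itv (bot S) (top S)) (bot R) (top R) (fun z => w z && inR R z) -> covE S R w.
Proof.
move=> vS SR [c1 _ _] [c2 _ _].
have hc i : lft R <= i -> i + 1 <= rgt R -> ~~ itv (lft S) (rgt S) i -> ~~ itv (lft S) (rgt S) (i + 1) ->
    has w (cols i (bot R) (top R)) || has w (cols (i + 1) (bot R) (top R)).
  move=> a b d e; have [z /andP[wz Rz] hz] := c1 i a b d e.
  move: hz Rz; rewrite /inR => /orP[hz|hz] /andP[_ h2]; apply/orP; [left|right];
    by apply/hasP; exists z => //; rewrite mem_cols hz.
have hr j : bot R <= j -> j + 1 <= top R -> ~~ itv (bot S) (top S) j -> ~~ itv (bot S) (top S) (j + 1) ->
    has w (rows j (lft R) (rgt R)) || has w (rows (j + 1) (lft R) (rgt R)).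
  move=> a b d e; have [z /andP[wz Rz] hz] := c2 j a b d e.
  move: hz Rz; rewrite /inR => /orP[hz|hz] /andP[h1 h2]; apply/orP; [left|right];
    by apply/hasP; exists z => //; rewrite mem_rows hz.
move: vS SR; rewrite /valid /subR => vS SR.
by apply/and4P; split; apply: sorted_zseq => i a b; (apply: hc || apply: hr); rewrite /itv; rlia.
Qed.

Lemma dep_sorted_has (I : Type) (f : I -> seq Site) (l : seq I) (D : pred Site) :
  (forall i z, List.In i l -> z \in f i -> D z) ->
  dep D (fun w => sorted orb [seq has w (f i) | i <- l]).
Proof.
move=> fD w w' ww'; congr (sorted _ _).
elim: l fD => //= i l IH fD; congr (_ :: _).
  by apply: eq_in_has => z /fD h; apply: ww'; apply: h; left.
by apply: IH => j z jl; apply: fD; right.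
Qed.

Lemma In_mem (I : eqType) (x : I) l : List.In x l -> x \in l.
Proof. by elim: l => //= y l IH [->|/IH]; rewrite inE ?eqxx // => ->; rewrite orbT. Qed.

Lemma dep_covE S R : dep (fun z => ~~ inR S z) (covE S R).
Proof.
move=> w w' ww'; rewrite /covE.
congr [&& _, _, _ & _]; refine (dep_sorted_has _ ww') => i z /In_mem;
  rewrite mem_zseq ?mem_cols ?mem_rows /inR; rlia.
Qed.

Section bounds.
Variables (K : realType) (p : K).
Hypothesis p01 : 0 <= p <= 1.

Lemma sorted_orb_cat (l1 l2 : seq bool) :
  sorted orb (l1 ++ true :: l2) = sorted orb l1 && sorted orb l2.
Proof.
case: l1 => [|x l1] /=; first by case: l2.
rewrite cat_path /= orbT /=; congr (_ && _); by case: l2.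
Qed.

Lemma Ex_prod_sites (s C : seq Site) (k : K) w : uniq C -> {subset C <= s} ->
  Ex p s (fun w => \prod_(z <- C) (if w z then k else 1)) w = (1 + p * (k - 1)) ^+ size C.
Proof.
elim: C => [|z C IH] /=.
  by move=> _ _; under eq_Ex do rewrite big_nil; rewrite Ex_cst expr0.
move=> /andP[zC uC] Cs; under eq_Ex do rewrite big_cons.
rewrite (@Ex_indep _ _ _ (pred1 z) (mem C)); last 3 first.
- exact: (dep_comp (fun b : bool => if b then k else 1) (@dep_site _ z)).
- move=> w1 w2 ww; rewrite !big_seq; apply: eq_bigr => y yC; by rewrite ww.
- by move=> y /= /eqP ->.
rewrite IH // => [|y yC]; last by apply: Cs; rewrite inE yC orbT.
rewrite exprS; congr (_ * _).
rewrite (@eq_Ex _ _ _ _ _ (fun w => 1 + (k - 1) * (w z)%:R)); last first.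
  by move=> w'; case: (w' z); rewrite ?mulr1 ?mulr0 ?addr0 // addrC subrK.
rewrite ExD ExZ Ex_cst Ex_site; last by apply: Cs; rewrite inE eqxx.
by rewrite [p * _]mulrC.
Qed.

(** The strips on the two sides form one run, separated by a marked line without sites. *)
Definition blockL (I : Type) (m : I -> bool) (f : I -> seq Site) (l1 l2 : seq I) : seq (bool * seq Site) :=
  [seq (m i, f i) | i <- l1] ++ (true, [::]) :: [seq (m i, f i) | i <- l2].

Lemma sites_blockL (I : Type) (m : I -> bool) (f : I -> seq Site) (l1 l2 : seq I) :
  sites (blockL m f l1 l2) = flatten [seq f i | i <- l1 ++ l2].
Proof.
rewrite /sites /blockL.
elim: l1 => [|i l1 IH] /=; last by rewrite IH.
by elim: l2 => //= i l2 ->.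
Qed.

Lemma occ_blockL (I : Type) (m : I -> bool) (f : I -> seq Site) (l1 l2 : seq I) w :
  sorted orb [seq occ w x | x <- blockL m f l1 l2] =
  sorted orb [seq m i || has w (f i) | i <- l1] && sorted orb [seq m i || has w (f i) | i <- l2].
Proof.
rewrite -sorted_orb_cat /blockL; congr (sorted _ _).
elim: l1 => [|i l1 IH] /=; last by rewrite IH.
by congr (_ :: _); elim: l2 => //= i l2 ->.
Qed.

(* [b] plays the role of [exp (- gamma)] and [B] that of [exp M]. *)
Lemma Ex_block_le (I : eqType) (m : I -> bool) (f : I -> seq Site) (l1 l2 : seq I) (s : seq Site)
    (b B : K) (h : nat) w : let u := 1 - (1 - p) ^+ h in
  0 < b <= 1 -> b^-1 <= B -> u * b + u * (1 - u) <= b ^+ 2 ->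
  (forall i, i \in l1 ++ l2 -> size (f i) = h) -> uniq (flatten [seq f i | i <- l1 ++ l2]) ->
  {subset flatten [seq f i | i <- l1 ++ l2] <= s} ->
  Ex p s (fun w => (sorted orb [seq occ w x | x <- blockL m f l1 l2])%:R) w <=
  B ^+ 2 * b ^+ (size l1 + size l2) * \prod_(i <- l1 ++ l2) (if m i then B ^+ 2 else 1).
Proof.
move=> u b01 bB ub fh uf sf; have [b0 b1] := andP b01.
have bi0 : 0 < b^-1 by rewrite invr_gt0.
have E := sites_blockL m f l1 l2.
apply: le_trans (Ex_sorted_le p01 (h := h) (b := b) w _ _ _ _ _) _ => //; rewrite ?E //.
  move=> x; rewrite /blockL mem_cat inE => /or3P[/mapP[i il ->]|/eqP ->|/mapP[i il ->]] //= _;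
  by apply: fh; rewrite mem_cat il ?orbT.
rewrite /blockL big_cat big_cons /= !big_map big_cat /=.
have P (l : seq I) : \prod_(i <- l) (if m i then b^-1 else b) <=
    b ^+ size l * \prod_(i <- l) (if m i then B ^+ 2 else 1) :> K.
  elim: l => [|i l IH]; first by rewrite !big_nil mulr1.
  rewrite !big_cons /= exprS.
  have Q0 : 0 <= \prod_(i <- l) (if m i then b^-1 else b) :> K.
    by apply: prodr_ge0 => j _; case: ifP => _; exact: ltW.
  have -> : b * b ^+ size l * ((if m i then B ^+ 2 else 1) * \prod_(j <- l) (if m j then B ^+ 2 else 1)) =
     (b * (if m i then B ^+ 2 else 1)) * (b ^+ size l * \prod_(j <- l) (if m j then B ^+ 2 else 1)) by ring.
  apply: ler_pM => //; first by case: ifP => _; exact: ltW.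
  case: ifP => _; last by rewrite mulr1.
  apply: (@le_trans _ _ (b * b^-1 ^+ 2)).
    by rewrite expr2 mulrA mulfV ?mul1r // gt_eqF.
  by apply: ler_wpM2l; [exact: ltW|rewrite lerXn2r // nnegrE ltW // (lt_le_trans bi0)].
have Q0 (l : seq I) : 0 <= \prod_(i <- l) (if m i then b^-1 else b) :> K.
  by apply: prodr_ge0 => j _; case: ifP => _; exact: ltW.
have := ler_pM (Q0 l1) (Q0 l2) (P l1) (P l2).
set x1 := \prod_(i <- l1) _; set x2 := \prod_(i <- l2) _; set y1 := \prod_(i <- l1) _; set y2 := \prod_(i <- l2) _.
move=> H; have x0 : 0 <= x1 * x2 by exact: mulr_ge0 (Q0 l1) (Q0 l2).
rewrite exprD.
have -> : b^-1 * (x1 * (b^-1 * x2)) = b^-1 ^+ 2 * (x1 * x2) by ring.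
have -> : B ^+ 2 * (b ^+ size l1 * b ^+ size l2) * (y1 * y2) =
  B ^+ 2 * (b ^+ size l1 * y1 * (b ^+ size l2 * y2)) by ring.
apply: ler_pM => //; first by rewrite exprn_ge0 // ltW.
by rewrite lerXn2r // nnegrE ltW // (lt_le_trans bi0).
Qed.

Lemma prod_marks (I J : Type) (c : I -> J -> bool) (xs : seq I) (ys : seq J) (k : K) : 1 <= k ->
  \prod_(i <- xs) (if has (c i) ys then k else 1) <=
  \prod_(i <- xs) \prod_(j <- ys) (if c i j then k else 1).
Proof.
move=> k1; apply: ler_prod => i _; apply/andP; split.
  by case: ifP => _ //; rewrite (le_trans ler01).
elim: ys => [|j ys IH] /=; first by rewrite big_nil.
rewrite big_cons; case: (c i j) => /=; last by rewrite mul1r.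
rewrite -[leLHS]mulr1; apply: ler_pM => //; first by rewrite (le_trans ler01).
elim: (ys) => [|j' l IHl]; first by rewrite big_nil.
by rewrite big_cons; case: ifP => _; rewrite ?mul1r // mulr_ege1.
Qed.

(** Once the corners are fixed, the columns depend only on sites at the height of [S] and the rows
    only on sites within its width, so they are independent. An occupied corner site marks one
    column and one row and costs at most [B ^+ 2 * B ^+ 2]; averaging over all corner sites gives
    the last factor. *)
Lemma Pr_covE S R (s : seq Site) (bx bH B : K) :
  valid S -> subR S R -> {subset rsites R <= s} ->
  let ux := 1 - (1 - p) ^+ height S in let uy := 1 - (1 - p) ^+ width S in
  0 < bx <= 1 -> bx^-1 <= B -> ux * bx + ux * (1 - ux) <= bx ^+ 2 ->
  0 < bH <= 1 -> bH^-1 <= B -> uy * bH + uy * (1 - uy) <= bH ^+ 2 ->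
  Pr p s (covE S R) <= B ^+ 4 * bx ^+ (width R - width S) * bH ^+ (height R - height S) *
    (1 + p * (B ^+ 4 - 1)) ^+ ((width R - width S) * (height R - height S)).
Proof.
move=> vS SR Rs ux uy bx01 bxB hx by01 byB hy.
pose x1 := zseq (lft R) (lft S - 1); pose x2 := zseq (rgt S + 1) (rgt R); pose xs := x1 ++ x2.
pose y1 := zseq (bot R) (bot S - 1); pose y2 := zseq (top S + 1) (top R); pose ys := y1 ++ y2.
move: (vS) (SR); rewrite /valid /subR => /andP[vx vy] /and4P[le1 le2 le3 le4].
have mx i : i \in xs = (lft R <= i <= rgt R) && ~~ itv (lft S) (rgt S) i by exact: mem_strips.
have my i : i \in ys = (bot R <= i <= top R) && ~~ itv (bot S) (top S) i by exact: mem_strips.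
have uxs : uniq xs by exact: uniq_strips.
have uys : uniq ys by exact: uniq_strips.
have sx : (size x1 + size x2 = width R - width S)%N by exact: size_strips.
have sy : (size y1 + size y2 = height R - height S)%N by exact: size_strips.
have iv (l sl sr r i : int) : l <= sl -> sr <= r -> itv sl sr i -> l <= i <= r.
  by rewrite /itv => h1 h2 /andP[h3 h4]; rewrite (le_trans h1 h3) (le_trans h4 h2).
have sz (a b : int) : a <= b -> size (zseq a b) = absz (b - a + 1).
  by clear; rewrite size_zseq; lia.
pose D z := (z.1 \in xs) && (z.2 \in ys).
pose fc i := cols i (bot S) (top S); pose fr j := rows j (lft S) (rgt S).
pose mc w i := has w [seq (i, y) | y <- ys]; pose mr w j := has w [seq (x, j) | x <- xs].
pose Lc w0 := blockL (mc w0) fc x1 x2; pose Lr w0 := blockL (mr w0) fr y1 y2.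
have B0 : 1 <= B.
  have [b0 b1] := andP bx01; by apply: le_trans bxB; rewrite invf_ge1.
have ec w0 w1 i : i \in xs -> mc w0 i || has w1 (fc i) = has (merge D w0 w1) (cols i (bot R) (top R)).
  move=> ix; apply/orP/hasP => [[/hasP[z /mapP[y yy ->] wz]|/hasP[z]]|[z]].
  - exists (i, y); rewrite ?mem_cols /= ?eqxx /=; first by move: yy; rewrite my => /andP[].
    by rewrite /merge /D /= ix yy.
  - rewrite mem_cols => /andP[/eqP zi zz] wz; exists z.
      by rewrite mem_cols zi eqxx /=; exact: (iv _ _ _ _ _ le3 le4 zz).
    by rewrite /merge /D my /itv zz andbF andbF.
  - rewrite mem_cols /merge /D => /andP[/eqP zi zz]; rewrite zi ix /=.
    have [zy wz|] := boolP (z.2 \in ys).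
      left; apply/hasP; exists z => //; apply/mapP; exists z.2 => //.
      by rewrite -zi; case: (z).
    rewrite my zz /= negbK => hz wz; right; apply/hasP; exists z => //.
    by rewrite mem_cols zi eqxx.
have er w0 w1 j : j \in ys -> mr w0 j || has w1 (fr j) = has (merge D w0 w1) (rows j (lft R) (rgt R)).
  move=> ix; apply/orP/hasP => [[/hasP[z /mapP[y yy ->] wz]|/hasP[z]]|[z]].
  - exists (y, j); rewrite ?mem_rows /= ?eqxx /=; first by move: yy; rewrite mx => /andP[].
    by rewrite /merge /D /= ix yy.
  - rewrite mem_rows => /andP[/eqP zi zz] wz; exists z.
      by rewrite mem_rows zi eqxx /=; exact: (iv _ _ _ _ _ le1 le2 zz).
    by rewrite /merge /D mx /itv zz andbF.
  - rewrite mem_rows /merge /D => /andP[/eqP zi zz]; rewrite zi ix andbT.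
    have [zy wz|] := boolP (z.1 \in xs).
      left; apply/hasP; exists z => //; apply/mapP; exists z.1 => //.
      by rewrite -zi; case: (z).
    rewrite mx zz /= negbK => hz wz; right; apply/hasP; exists z => //.
    by rewrite mem_rows zi eqxx.
have fuse w0 w1 : covE S R (merge D w0 w1) =
    sorted orb [seq occ w1 x | x <- Lc w0] && sorted orb [seq occ w1 x | x <- Lr w0].
  rewrite /Lc /Lr !occ_blockL /covE -!andbA.
  congr [&& _, _, _ & _]; congr (sorted _ _); apply/eq_in_map => i ix;
    by rewrite ?ec ?er // mem_cat ix ?orbT.
pose w_ := (fun=> false) : Site -> bool.
have -> : Pr p s (covE S R) = Ex p s (fun w => (covE S R w)%:R) (merge D w_ w_) by rewrite mergexx.
(* From here on [w0] supplies the corners and [w1] all other sites. *)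
rewrite Ex_fubini.
pose Wc w0 := \prod_(i <- xs) (if mc w0 i then B ^+ 2 else 1) : K.
pose Wr w0 := \prod_(i <- ys) (if mr w0 i then B ^+ 2 else 1) : K.
pose C := [seq (x, y) | x <- xs, y <- ys].
have [bx0 _] := andP bx01; have [by0 _] := andP by01.
have B2 : 1 <= B ^+ 2 by rewrite exprn_ege1.
have memfc z : z \in flatten [seq fc i | i <- xs] -> (z.1 \in xs) && itv (bot S) (top S) z.2.
  by move=> /flattenP[l /mapP[i ix ->]]; rewrite mem_cols => /andP[/eqP -> hz]; rewrite ix.
have memfr z : z \in flatten [seq fr i | i <- ys] -> (z.2 \in ys) && itv (lft S) (rgt S) z.1.
  by move=> /flattenP[l /mapP[i ix ->]]; rewrite mem_rows => /andP[/eqP -> hz]; rewrite ix.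
have inner w0 : Ex p s (fun w1 => (covE S R (merge D w0 w1))%:R) w_ <=
    (B ^+ 2 * bx ^+ (width R - width S) * Wc w0) * (B ^+ 2 * bH ^+ (height R - height S) * Wr w0).
  rewrite (@eq_Ex _ _ _ _ _ (fun w1 => (sorted orb [seq occ w1 x | x <- Lc w0])%:R *
       (sorted orb [seq occ w1 x | x <- Lr w0])%:R)); last first.
    by move=> w1; rewrite fuse -natrM mulnb.
  rewrite (@Ex_indep _ _ _ (mem (sites (Lc w0))) (mem (sites (Lr w0)))); last 3 first.
  - exact: (dep_comp (fun a => (sorted orb a)%:R : K) (@dep_occ _ (Lc w0))).
  - exact: (dep_comp (fun a => (sorted orb a)%:R : K) (@dep_occ _ (Lr w0))).
  - rewrite !sites_blockL => z /= /memfc; rewrite mx => /andP[/andP[_ h] _].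
    by apply: contra h => /memfr /andP[].
  apply: ler_pM; try (by apply: Ex_ge0 => // w1; rewrite ler0n).
  - rewrite -sx; apply: (@Ex_block_le _ (mc w0) fc x1 x2 s bx B (height S) w_) => //.
    + by move=> i _; rewrite size_map sz.
    + rewrite -/xs; have := allpairs_uniq (f := pair) uxs (uniq_zseq (bot S) (top S)).
      by apply; move=> [? ?] [? ?] _ _ [-> ->].
    + move=> z /memfc; rewrite mx => /andP[/andP[h _] /(iv _ _ _ _ _ le3 le4) h'].
      by apply: Rs; rewrite mem_rsites /inR h h'.
  - rewrite -sy; apply: (@Ex_block_le _ (mr w0) fr y1 y2 s bH B (width S) w_) => //.
    + by move=> i _; rewrite size_map sz.
    + rewrite -/ys; have := allpairs_uniq (f := fun y x => (x, y)) uys (uniq_zseq (lft S) (rgt S)).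
      by apply; move=> [? ?] [? ?] _ _ [-> ->].
    + move=> z /memfr; rewrite my => /andP[/andP[h _] /(iv _ _ _ _ _ le1 le2) h'].
      by apply: Rs; rewrite mem_rsites /inR h h'.
apply: le_trans (@ler_Ex _ _ _ p01 s _ _ w_ inner) _.
pose k := B ^+ 4 * bx ^+ (width R - width S) * bH ^+ (height R - height S).
apply: (@le_trans _ _ (Ex p s (fun w0 => k * \prod_(z <- C) (if w0 z then B ^+ 4 else 1)) w_)).
  apply: ler_Ex => // w0.
  have -> : (B ^+ 2 * bx ^+ (width R - width S) * Wc w0) * (B ^+ 2 * bH ^+ (height R - height S) * Wr w0) =
    k * (Wc w0 * Wr w0) by rewrite /k; ring.
  apply: ler_wpM2l; first by rewrite /k; do 2?apply: mulr_ge0; apply: exprn_ge0; rewrite ?(ltW bx0) ?(ltW by0) // (le_trans ler01).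
  have hc : Wc w0 <= \prod_(i <- xs) \prod_(j <- ys) (if w0 (i, j) then B ^+ 2 else 1).
    rewrite /Wc /mc; apply: le_trans (prod_marks (fun i j => w0 (i, j)) xs ys B2).
    by under eq_bigr do rewrite has_map.
  have hr : Wr w0 <= \prod_(i <- xs) \prod_(j <- ys) (if w0 (i, j) then B ^+ 2 else 1).
    rewrite exchange_big /= /Wr /mr; apply: le_trans (prod_marks (fun j i => w0 (i, j)) ys xs B2).
    by under eq_bigr do rewrite has_map.
  have W0 (I : Type) (l : seq I) (m : I -> bool) : 0 <= \prod_(i <- l) (if m i then B ^+ 2 else 1) :> K.
    by apply: prodr_ge0 => i _; case: ifP => // _; rewrite (le_trans ler01).
  apply: le_trans (ler_pM (W0 _ _ _) (W0 _ _ _) hc hr) _.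
  rewrite /C big_allpairs_dep /= -big_split /=.
  rewrite le_eqVlt; apply/orP; left; apply/eqP; apply: eq_bigr => i _.
  rewrite -big_split /=; apply: eq_bigr => j _.
  by case: ifP => _; rewrite ?mulr1 // -exprD.
rewrite ExZ Ex_prod_sites.
- by rewrite /C size_allpairs !size_cat sx sy.
- by apply: allpairs_uniq => // [[? ?] [? ?]] _ _ [-> ->].
- move=> z /allpairsP[[x y] /= [hx' hy' ->]]; apply: Rs; rewrite mem_rsites /inR /=.
  by move: hx' hy'; rewrite mx my => /andP[-> _] /andP[-> _].
Qed.

End bounds.

End coverings.

(** * Recursion over internally spanned rectangles *)

Section spanning_probability.
Implicit Types (w : Site -> bool) (R S : rect) (z : Site).

Lemma subR_dims R S : valid S -> subR S R -> (width S <= width R)%N /\ (height S <= height R)%N.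
Proof. by rewrite /valid /subR /width /height => ? ?; split; rlia. Qed.

Lemma valid_join R S : valid R -> valid S -> valid (join R S).
Proof. by rewrite /valid /join; rlia. Qed.

Lemma width_join R S : valid R -> valid S -> near R S ->
  (width (join R S) <= width R + width S + 1)%N.
Proof. by rewrite /valid /near /width /join; rlia. Qed.

Lemma height_join R S : valid R -> valid S -> near R S ->
  (height (join R S) <= height R + height S + 1)%N.
Proof. by rewrite /valid /near /height /join; rlia. Qed.

(** * Convex weights and the path cost *)

Section potential.
Variables (K : realType) (gam : nat -> K) (M : K).
Hypothesis gam_ge0 : forall k, 0 <= gam k.
Hypothesis gam_le : forall k, gam k <= M.
Hypothesis gam_decr : forall k, gam k.+1 <= gam k.
Hypothesis gam_cvx : forall k, 2 * gam k.+1 <= gam k + gam k.+2.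

(** A column added at height [k] costs [gam k], and the row then added at width [k.+1] costs
    [gam k.+1]. *)
Definition diag_cost (n : nat) : K := \sum_(k < n) (gam k + gam k.+1).

(* The cost of the lattice path from the origin that follows the diagonal up to
   the shorter side and then goes straight. *)
Definition cost (a b : nat) : K :=
  diag_cost (minn a b) + (maxn a b - minn a b)%:R * gam (minn a b).

Lemma costC a b : cost a b = cost b a.
Proof. by rewrite /cost minnC maxnC. Qed.

Lemma gam_mono m n : (m <= n)%N -> gam n <= gam m.
Proof.
by move=> /subnK <-; elim: (n - m)%N => // k IH; rewrite addSn (le_trans (gam_decr _)).
Qed.

Lemma gam_diff_decr m n : (m <= n)%N -> gam n - gam n.+1 <= gam m - gam m.+1.
Proof.
move=> /subnK <-; elim: (n - m)%N => // k IH; rewrite addSn (le_trans _ IH) //.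
have := gam_cvx (k + m); lra.
Qed.

(** The first of [n] successive decrements is the largest, so [n] times it is at least the total
    decrease. *)
Lemma gam_cvxn a n : n%:R * gam a.+1 <= n%:R * gam a - gam a + gam (a + n).
Proof.
elim: n => [|n IH]; first by rewrite addn0; lra.
rewrite -natr1 !mulrDl !mul1r addnS.
have := gam_diff_decr (leq_addr n a); lra.
Qed.

(** A step of the longer side prolongs the straight part, with equality. A step of the shorter side
    moves the corner of the path, and convexity bounds the change by the price of the new column. *)
Lemma cost_stepl a b : cost a.+1 b <= cost a b + gam b.
Proof.
case: (boolP (a < b)%N) => ab; last first.
  rewrite /cost (_ : minn a.+1 b = b); last lia.
  rewrite (_ : minn a b = b); last lia.
  rewrite (_ : (maxn a.+1 b - b = (maxn a b - b).+1)%N); last lia.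
  rewrite -natr1; lra.
rewrite /cost (_ : minn a.+1 b = a.+1); last lia.
rewrite (_ : minn a b = a); last lia.
rewrite (_ : maxn a.+1 b = b); last lia.
rewrite (_ : maxn a b = b); last lia.
rewrite /diag_cost big_ord_recr /=.
have -> : (b - a = (b - a.+1).+1)%N by lia.
have := gam_cvxn a (b - a.+1).+1; rewrite (_ : (a + (b - a.+1).+1 = b)%N); last lia.
rewrite -natr1; lra.
Qed.

Lemma cost_stepr a b : cost a b.+1 <= cost a b + gam a.
Proof. by rewrite costC (costC a); exact: cost_stepl. Qed.

(** The new rows are charged at the old width, which is dearer because [gam] decreases. This is the
    form that matches a frame with its corners left out. *)
Lemma cost_grow a b s t : cost (a + s) (b + t) <= cost a b + s%:R * gam b + t%:R * gam a.
Proof.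
have H1 : cost (a + s) b <= cost a b + s%:R * gam b.
  elim: s => [|s IH]; first by rewrite addn0; lra.
  have := cost_stepl (a + s) b; rewrite addnS -natr1; lra.
suff : cost (a + s) (b + t) <= cost (a + s) b + t%:R * gam a by lra.
elim: t {H1} => [|t IH]; first by rewrite addn0; lra.
have := cost_stepr (a + s) (b + t); have := gam_mono (leq_addr s a); rewrite addnS -natr1; lra.
Qed.

Lemma cost_clipl a x y k : (k <= y)%N -> cost (minn x.+1 a) y <= cost (minn x a) y + gam k.
Proof.
move=> ky; case: (boolP (x < a)%N) => xa.
  have -> : minn x.+1 a = (minn x a).+1 by lia.
  have := cost_stepl (minn x a) y; have := gam_mono ky; lra.
rewrite (_ : minn x.+1 a = minn x a); last lia.
have := gam_ge0 k; lra.
Qed.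

Lemma cost_clipr b x y k : (k <= x)%N -> cost x (minn y.+1 b) <= cost x (minn y b) + gam k.
Proof. by rewrite costC (costC x); exact: cost_clipl. Qed.

(* The path of the second rectangle, started at the corner of the first one and
   clipped to the big one, is cheaper because [gam] decreases. *)
Lemma cost_clip_sub a b a1 b1 a2 b2 : (a1 <= a <= a1 + a2)%N -> (b1 <= b <= b1 + b2)%N ->
  (a2 <= a)%N -> (b2 <= b)%N -> cost a b <= cost a1 b1 + cost a2 b2.
Proof.
wlog h : a b a1 b1 a2 b2 / (b2 <= a2)%N.
  move=> H h1 h2 h3 h4; have [?|/ltnW ?] := leqP b2 a2; first exact: H.
  by rewrite costC (costC a1) (costC a2); apply: H.
move=> h1 h2 h3 h4.
have D k : (k <= b2)%N -> cost (minn (a1 + k) a) (minn (b1 + k) b) <= cost a1 b1 + diag_cost k.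
  elim: k => [_|k IH kb].
    rewrite /diag_cost big_ord0 !addn0 (_ : minn a1 a = a1) 1?(_ : minn b1 b = b1); [lra|lia|lia].
  have {}IH := IH (ltnW kb); rewrite /diag_cost big_ord_recr /= -/(diag_cost k) !addnS.
  have c1 : (k <= minn (b1 + k) b)%N by lia.
  have c2 : (k.+1 <= minn (a1 + k).+1 a)%N by lia.
  have := cost_clipl a (a1 + k) c1; have := cost_clipr b (b1 + k) c2; lra.
have E k : cost (minn (a1 + b2 + k) a) (minn (b1 + b2) b) <= cost a1 b1 + diag_cost b2 + k%:R * gam b2.
  elim: k => [|k IH]; first by rewrite addn0; have := D b2 (leqnn _); lra.
  have c1 : (b2 <= minn (b1 + b2) b)%N by lia.
  have := cost_clipl a (a1 + b2 + k) c1; rewrite -natr1 addnS; lra.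
have := E (a2 - b2)%N; rewrite (_ : minn _ a = a); last lia.
rewrite (_ : minn (b1 + b2) b = b); last lia.
rewrite [in X in _ -> _ <= _ + X]/cost (_ : minn a2 b2 = b2); last lia.
rewrite (_ : maxn a2 b2 = a2); last lia.
lra.
Qed.

(** The gap between two near rectangles adds at most one column and one row, each of price at most
    [M]. *)
Lemma cost_sub a b a1 b1 a2 b2 : (a1 <= a <= a1 + a2 + 1)%N -> (b1 <= b <= b1 + b2 + 1)%N ->
  (a2 <= a)%N -> (b2 <= b)%N -> cost a b <= cost a1 b1 + cost a2 b2 + 2 * M.
Proof.
move=> h1 h2 h3 h4.
pose a' := minn a (a1 + a2); pose b' := minn b (b1 + b2).
have H : cost a' b' <= cost a1 b1 + cost a2 b2 by apply: cost_clip_sub; rewrite /a' /b'; lia.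
have := cost_grow a' b' (a - a') (b - b').
rewrite (_ : a' + (a - a') = a)%N; last by rewrite /a'; lia.
rewrite (_ : b' + (b - b') = b)%N; last by rewrite /b'; lia.
have K1 : (a - a')%:R * gam b' <= M.
  have : (a - a' <= 1)%N by rewrite /a'; lia.
  by case: (a - a')%N => [|[|//]] _; have := gam_le b'; have := gam_ge0 b'; rewrite ?mul0r ?mul1r; lra.
have K2 : (b - b')%:R * gam a' <= M.
  have : (b - b' <= 1)%N by rewrite /b'; lia.
  by case: (b - b')%N => [|[|//]] _; have := gam_le a'; have := gam_ge0 a'; rewrite ?mul0r ?mul1r; lra.
lra.
Qed.

Lemma cost_le a b : cost a b <= (a + b)%:R * M.
Proof.
have M0 : 0 <= M by rewrite (le_trans (gam_ge0 0)).
have D n : diag_cost n <= (2 * n)%:R * M.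
  elim: n => [|n IH]; first by rewrite /diag_cost big_ord0 muln0 mul0r.
  rewrite /diag_cost big_ord_recr /= -/(diag_cost n).
  have := gam_le n; have := gam_le n.+1.
  have -> : (2 * n.+1)%:R = (2 * n)%:R + 2 :> K by rewrite -natrD; congr _%:R; lia.
  lra.
have -> : (a + b = 2 * minn a b + (maxn a b - minn a b))%N by lia.
rewrite natrD mulrDl; apply: lerD; first exact: D.
by apply: ler_wpM2l => //; rewrite ler0n.
Qed.

Lemma cost_ge0 a b : 0 <= cost a b.
Proof.
apply: addr_ge0; last by rewrite mulr_ge0.
by apply: sumr_ge0 => i _; exact: addr_ge0.
Qed.

End potential.

Definition subrects R : seq rect :=
  [seq (h, v) | h <- [seq (l, r) | l <- zseq (lft R) (rgt R), r <- zseq (lft R) (rgt R)],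
                v <- [seq (b, t) | b <- zseq (bot R) (top R), t <- zseq (bot R) (top R)]].

Lemma size_subrects R : valid R -> size (subrects R) = (width R ^ 2 * height R ^ 2)%N.
Proof.
move=> vR; rewrite !size_allpairs !size_zseq /width /height.
move: vR; rewrite /valid => /andP[v1 v2].
have -> : absz (Num.max 0 (rgt R - lft R + 1)) = absz (rgt R - lft R + 1) by lia.
have -> : absz (Num.max 0 (top R - bot R + 1)) = absz (top R - bot R + 1) by lia.
by rewrite -!mulnn.
Qed.

Lemma mem_subrects R S : valid S -> subR S R -> S \in subrects R.
Proof.
move=> vS SR; apply/allpairsP; exists (S.1, S.2); split => /=; last by case: (S).
  apply/allpairsP; exists S.1; rewrite !mem_zseq; split; last by case: (S.1).
    by move: vS SR; rewrite /valid /subR; rlia.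
  by move: vS SR; rewrite /valid /subR; rlia.
apply/allpairsP; exists S.2; rewrite !mem_zseq; split; last by case: (S.2).
  by move: vS SR; rewrite /valid /subR; rlia.
by move: vS SR; rewrite /valid /subR; rlia.
Qed.

(** * The union bound over pairs of subrectangles *)

Section recursion.
Variables (K : realType) (p : K) (gam : nat -> K) (M rho : K).
Hypothesis p_gt0 : 0 < p.
Hypothesis p_le : p <= 2^-1.
Hypothesis gam_ge0 : forall k, 0 <= gam k.
Hypothesis gam_le : forall k, gam k <= M.
Hypothesis gam_decr : forall k, gam k.+1 <= gam k.
Hypothesis gam_cvx : forall k, 2 * gam k.+1 <= gam k + gam k.+2.
Hypothesis gam_occ : forall k, let u := 1 - (1 - p) ^+ k in let b := expR (- gam k) in
  u * b + u * (1 - u) <= b ^+ 2.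
Hypothesis rho01 : 0 <= rho <= 1.

Let p01 : 0 <= p <= 1.
Proof. by have := p_le; have := p_gt0 => h1 h2; apply/andP; split; lra. Qed.
Let M_ge0 : 0 <= M. Proof. by rewrite (le_trans (gam_ge0 0)). Qed.

Variables (s : seq Site) (N T phi0 : nat) (Q : K).
(** Each corner site adds at most [p * expR (4 * M)] to the exponent. In a frame with at most [T]
    rows this is absorbed by giving up the fraction [1 - rho] of the column cost. *)
Hypothesis err : p * expR (4 * M) * T%:R <= (1 - rho) * gam N.
Hypothesis T_gt0 : (0 < T)%N.
Hypothesis phi0T : (T + 2 <= phi0)%N.
(** [N ^ 8] bounds the number of pairs of subrectangles. Of the exponent [6 * M], the frame takes
    [4 * M] and the subadditivity of the cost [2 * M]. *)
Hypothesis Q_ge : expR (6 * M) * (N ^ 8)%:R <= Q.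
Hypothesis Q_ge1 : 1 <= Q.

Definition PrSpan R := Pr p s (fun w => `[< Span w R >]).

Hypothesis base : forall R, valid R -> {subset rsites R <= s} -> (phi R <= phi0)%N ->
  PrSpan R <= Q * expR (- rho * cost gam (width R) (height R)).

Lemma inc_Span R : inc (fun w => `[< Span w R >]).
Proof. by move=> w w' ww' /asboolP h; apply/asboolP; exact: Span_inc h. Qed.

Lemma gam_b01 k : 0 < expR (- gam k) <= 1.
Proof. by rewrite expR_gt0 /= -[leRHS]expR0 ler_expR oppr_le0. Qed.

Lemma gam_bM k : (expR (- gam k))^-1 <= expR M.
Proof. by rewrite expRN invrK ler_expR. Qed.

Lemma Pr_covE_le S R : valid S -> subR S R -> {subset rsites R <= s} ->
  (width R <= N)%N -> (height R <= N)%N -> (phi R <= phi S + T)%N ->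
  Pr p s (covE S R) <= expR (4 * M - rho * ((width R - width S)%:R * gam (height S) +
     (height R - height S)%:R * gam (width S))).
Proof.
move=> vS SR Rs wN hN pT.
have := Pr_covE p01 vS SR Rs (gam_b01 _) (gam_bM _) (gam_occ (height S)) (gam_b01 _) (gam_bM _) (gam_occ (width S)).
have [wS hS] := subR_dims vS SR.
move: pT; rewrite /phi.
set b := height S in hS *; set a := width S in wS *; set x := (width R - a)%N; set t := (height R - b)%N => pT.
have tT : (t <= T)%N.
  have aux A a' B b' T' : (a' <= A -> A + B <= a' + b' + T' -> B - b' <= T')%N by clear; lia.
  exact: aux wS pT.
have bN : (b <= N)%N by exact: leq_trans hN.
move=> /le_trans; apply.
have eM : expR M ^+ 4 = expR (4 * M) by rewrite -expRM_natl.
rewrite eM -!expRM_natr.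
have err' := err; set B := expR (4 * M) in err' *.
have B1 : 1 <= B by rewrite /B -[leLHS]expR0 ler_expR mulr_ge0.
have h1 : 1 + p * (B - 1) <= expR (p * B).
  by apply: (le_trans _ (expR_ge1Dx _)); rewrite lerD2l ler_wpM2l ?(ltW p_gt0) // gerBl.
have h0 : 0 <= 1 + p * (B - 1) by rewrite addr_ge0 // mulr_ge0 ?subr_ge0 // ltW.
have h2 : (1 + p * (B - 1)) ^+ (x * t) <= expR (p * B * (x * t)%:R).
  by rewrite expRM_natr lerXn2r // nnegrE expR_ge0.
apply: le_trans (ler_wpM2l _ h2) _; first by rewrite !mulr_ge0 ?expR_ge0.
rewrite {2}/B -!expRD ler_expR.
suff : p * B * (x * t)%:R <= (1 - rho) * (x%:R * gam b + t%:R * gam a).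
  by rewrite -/B; lra.
have g1 : gam N <= gam b by exact: gam_mono.
have g2 : 0 <= t%:R * gam a by rewrite mulr_ge0.
have [r0 r1] := andP rho01.
apply: (@le_trans _ _ ((1 - rho) * (x%:R * gam N))); last first.
  apply: ler_wpM2l; first lra.
  have := @ler_wpM2l _ x%:R (ler0n _ _) _ _ g1; lra.
rewrite natrM.
apply: (@le_trans _ _ (p * B * T%:R * x%:R)).
  rewrite [x%:R * _]mulrC mulrA ler_wpM2r // ler_wpM2l ?ler_nat // mulr_ge0 //; last exact: expR_ge0.
  exact: ltW.
have := @ler_wpM2r _ x%:R (ler0n _ _) _ _ err'; lra.
Qed.

Lemma dep_Span_box S1 S2 : dep (inR (join S1 S2))
  (fun w => `[< box (fun w => `[< Span w S1 >]) (fun w => `[< Span w S2 >]) w >]).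
Proof.
suff H w w' : (forall z, inR (join S1 S2) z -> w z = w' z) ->
   box (fun w => `[< Span w S1 >]) (fun w => `[< Span w S2 >]) w ->
   box (fun w => `[< Span w S1 >]) (fun w => `[< Span w S2 >]) w'.
  move=> w w' ww'; apply: asbool_equiv_eq; split; apply: H => // z h; exact/esym/ww'.
move=> ww' [w1 [w2 [h1 h2 h12 /asboolP s1 /asboolP s2]]].
exists (fun z => w1 z && inR S1 z), (fun z => w2 z && inR S2 z); split.
- by move=> z /andP[/h1 wz Rz]; rewrite -ww' //; exact: subR_inR (subR_joinl _ _) Rz.
- by move=> z /andP[/h2 wz Rz]; rewrite -ww' //; exact: subR_inR (subR_joinr _ _) Rz.
- by move=> z /andP[/h12/negbTE -> _].
- exact/asboolP/Span_restrict.
- exact/asboolP/Span_restrict.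
Qed.

(** Each level lowers [phi] by [T]. Two parts and one union bound turn an exponent e of [Q] into 2 e
    + 1, whence [2 ^ d.+1 - 1]. *)
Lemma PrSpan_le d R : valid R -> {subset rsites R <= s} ->
  (width R <= N)%N -> (height R <= N)%N -> (phi R <= phi0 + d * T)%N ->
  PrSpan R <= Q ^+ (2 ^ d.+1 - 1) * expR (- rho * cost gam (width R) (height R)).
Proof.
elim: d R => [|d IH] R vR Rs wN hN hphi.
  by rewrite expn1 expr1; apply: base => //; move: hphi; rewrite mul0n addn0.
have [small|big] := leqP (phi R) phi0.
  apply: le_trans (base vR Rs small) _; apply: ler_wpM2r; first exact: expR_ge0.
  rewrite -[leLHS]expr1 ler_weXn2l //.
  by rewrite subn_gt0 -{1}(expn0 2) ltn_exp2l.
(* The join exceeds [th], so the frame around it has fewer than [T] lines; [th] is at least 2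
   because [phi R] exceeds [phi0]. *)
pose th := (phi R - T)%N.
pose r := [seq X12 <- [seq (S1, S2) | S1 <- subrects R, S2 <- subrects R] |
  [&& valid X12.1, valid X12.2, near X12.1 X12.2, (phi X12.1 <= th)%N, (phi X12.2 <= th)%N,
      (th < phi (join X12.1 X12.2))%N & subR (join X12.1 X12.2) R]].
pose ev (X12 : rect * rect) w :=
  `[< box (fun w => `[< Span w X12.1 >]) (fun w => `[< Span w X12.2 >]) w >] &&
   covE (join X12.1 X12.2) R w.
set V := expR (- rho * cost gam (width R) (height R)).
apply: (@le_trans _ _ (\sum_(X12 <- r) Pr p s (ev X12))).
  apply: Pr_union => // w /asboolP sR.
  have [|S1 [S2 [w1 [w2 [[h1 h2 h12] [s1 s2 n12] [l1 l2 l12] sub [c1 c2]]]]]] :=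
      Span_split (th := th) (Span_restrict sR).
    rewrite /th; move: (phi R) (phi0T) T_gt0 big; clear; lia.
  have v1 := Span_valid s1; have v2 := Span_valid s2.
  exists (S1, S2).
    rewrite mem_filter /= v1 v2 n12 l1 l2 l12 sub /=; apply/allpairsP; exists (S1, S2); split => //.
      by apply: mem_subrects => //; exact: subR_trans (subR_joinl _ _) sub.
    by apply: mem_subrects => //; exact: subR_trans (subR_joinr _ _) sub.
  rewrite /ev /=; apply/andP; split.
    apply/asboolP; exists w1, w2; split => //; try exact/asboolP.
      by move=> z /h1 /andP[].
    by move=> z /h2 /andP[].
  by apply: cov_covE => //; exact: valid_join.
have term X12 : X12 \in r -> Pr p s (ev X12) <= expR (6 * M) * Q ^+ (2 ^ d.+2 - 2) * V.
  rewrite mem_filter => /andP[/and5P[v1 v2 n12 l1 /and3P[l2 l12 sub]] _].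
  case: X12 v1 v2 n12 l1 l2 l12 sub => S1 S2 /= v1 v2 n12 l1 l2 l12 sub.
  have vj := valid_join v1 v2.
  have s1 := subR_trans (subR_joinl S1 S2) sub.
  have s2 := subR_trans (subR_joinr S1 S2) sub.
  have subs S : subR S R -> {subset rsites S <= s}.
    by move=> SR z; rewrite mem_rsites => /(subR_inR SR) h; apply: Rs; rewrite mem_rsites.
  have [w1 h1] := subR_dims v1 s1; have [w2 h2] := subR_dims v2 s2; have [wj hj] := subR_dims vj sub.
  have [w1j h1j] := subR_dims v1 (subR_joinl S1 S2); have [w2j h2j] := subR_dims v2 (subR_joinr S1 S2).
  have thd x : (x <= th)%N -> (x <= phi0 + d * T)%N.
    by rewrite /th; move: (phi R) hphi; clear; lia.
  have thT x : (th < x)%N -> (phi R <= x + T)%N.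
    by rewrite /th; move: (phi R); clear; lia.
  have b1 : PrSpan S1 <= Q ^+ (2 ^ d.+1 - 1) * expR (- rho * cost gam (width S1) (height S1)).
    by apply: IH => //; [exact: subs|exact: leq_trans wN|exact: leq_trans hN|exact: thd].
  have b2 : PrSpan S2 <= Q ^+ (2 ^ d.+1 - 1) * expR (- rho * cost gam (width S2) (height S2)).
    by apply: IH => //; [exact: subs|exact: leq_trans wN|exact: leq_trans hN|exact: thd].
  have b3 : Pr p s (covE (join S1 S2) R) <=
     expR (4 * M - rho * ((width R - width (join S1 S2))%:R * gam (height (join S1 S2)) +
     (height R - height (join S1 S2))%:R * gam (width (join S1 S2)))).
    by apply: Pr_covE_le => //; exact: thT.
  (* The two parts are spanned inside the join and the frame lies outside it. *)
  rewrite /ev /= (@Pr_indep _ _ _ (inR (join S1 S2)) (fun z => ~~ inR (join S1 S2) z)); last 3 first.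
  - exact: dep_Span_box.
  - exact: dep_covE.
  - by move=> z ->.
  have BK := van_den_Berg_Kesten p01 s (fun=> false) p_le (inc_Span (R := S1)) (inc_Span (R := S2)).
  have {}BK : Pr p s (fun w => `[< box (fun w => `[< Span w S1 >]) (fun w => `[< Span w S2 >]) w >]) <=
    PrSpan S1 * PrSpan S2 by exact: BK.
  have P0 A : 0 <= Pr p s A by exact: Pr_ge0.
  have BK2 := le_trans BK (ler_pM (P0 _) (P0 _) b1 b2).
  apply: (le_trans (ler_pM (P0 _) (P0 _) BK2 b3)).
  have -> : (2 ^ d.+2 - 2 = (2 ^ d.+1 - 1) + (2 ^ d.+1 - 1))%N by rewrite expnS; move: (2 ^ d.+1)%N (expn_gt0 2 d.+1); clear; lia.
  rewrite exprD; set q := Q ^+ _.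
  have -> : q * expR (- rho * cost gam (width S1) (height S1)) *
     (q * expR (- rho * cost gam (width S2) (height S2))) *
     expR (4 * M - rho * ((width R - width (join S1 S2))%:R * gam (height (join S1 S2)) +
     (height R - height (join S1 S2))%:R * gam (width (join S1 S2)))) =
     q * q * expR (- rho * cost gam (width S1) (height S1) - rho * cost gam (width S2) (height S2) +
      (4 * M - rho * ((width R - width (join S1 S2))%:R * gam (height (join S1 S2)) +
     (height R - height (join S1 S2))%:R * gam (width (join S1 S2))))).
    by rewrite !expRD !mulNr; ring.
  have -> : expR (6 * M) * (q * q) * V = q * q * expR (6 * M - rho * cost gam (width R) (height R)).
    by rewrite expRD /V !mulNr; ring.
  have Q0 : 0 <= Q by rewrite (le_trans ler01).
  apply: ler_wpM2l; first by rewrite mulr_ge0 // exprn_ge0.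
  rewrite ler_expR.
  have C1 : cost gam (width (join S1 S2)) (height (join S1 S2)) <=
     cost gam (width S1) (height S1) + cost gam (width S2) (height S2) + 2 * M.
    apply: cost_sub => //.
      by rewrite w1j width_join.
    by rewrite h1j height_join.
  have := cost_grow gam_decr gam_cvx (width (join S1 S2)) (height (join S1 S2))
    (width R - width (join S1 S2)) (height R - height (join S1 S2)).
  rewrite !subnKC // => C2.
  have [r0 r1] := andP rho01.
  have C3 := le_trans C2 (lerD (lerD C1 (lexx _)) (lexx _)).
  have := ler_wpM2l r0 C3.
  have : rho * M <= M by rewrite ler_piMl.
  lra.
apply: (@le_trans _ _ ((size r)%:R * (expR (6 * M) * Q ^+ (2 ^ d.+2 - 2) * V))).
  rewrite -sum1_size natr_sum mulr_suml big_seq [leRHS]big_seq.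
  by apply: ler_sum => X12 /term; rewrite mul1r.
have Q0 : 0 <= Q by rewrite (le_trans ler01).
have sr : (size r <= N ^ 8)%N.
  apply: (@leq_trans (size (subrects R) * size (subrects R))).
    rewrite size_filter; apply: leq_trans (count_size _ _) _; by rewrite size_allpairs.
  rewrite size_subrects // -[8%N]/(4 + 4)%N expnD leq_mul // -[4%N]/(2 + 2)%N expnD leq_mul // leq_exp2r //.
have -> : (2 ^ d.+2 - 1 = (2 ^ d.+2 - 2).+1)%N by rewrite !expnS; move: (2 ^ d)%N (expn_gt0 2 d); clear; lia.
rewrite exprS !mulrA; apply: ler_wpM2r; first exact: expR_ge0.
apply: ler_wpM2r; first exact: exprn_ge0.
apply: le_trans _ Q_ge; rewrite mulrC; apply: ler_wpM2l; first exact: expR_ge0.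
by rewrite ler_nat.
Qed.

End recursion.

End spanning_probability.

(** * The dilogarithm *)

Section dilog.
Variable R : realType.
Implicit Types (x y s t w a b c e : R) (n N : nat).

Lemma ler_archi a b c n0 : (forall n, (n0 <= n)%N -> a <= b + c / n.+1%:R) -> a <= b.
Proof.
move=> H; apply/ler_addgt0Pr => e e0.
have [c0|c0] := leP c 0.
  apply: (le_trans (H n0 (leqnn _))); rewrite lerD2l.
  by apply: le_trans (ltW e0); rewrite mulr_le0_ge0 // invr_ge0 ler0n.
pose n := maxn n0 (Num.truncn (c / e)).
apply: (le_trans (H n (leq_maxl _ _))); rewrite lerD2l ler_pdivrMr ?ltr0Sn //.
rewrite mulrC -ler_pdivrMr //; apply: (le_trans (ltW (truncnS_gt _))).
by rewrite ler_nat ltnS leq_maxr.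
Qed.

(* Subdividing [a, b] into [n] equal parts divides the total error by [n]. *)
Lemma refine_nondecreasing (F e : R -> R) a b : a <= b ->
  (forall x y, a <= x -> x <= y -> y <= b -> F x - F y <= (y - x) * (e y - e x)) -> F a <= F b.
Proof.
move=> ab H; apply: (@ler_archi _ _ ((b - a) * (e b - e a)) 0) => n _.
pose d := (b - a) / n.+1%:R.
have n0 : 0 < n.+1%:R :> R by rewrite ltr0Sn.
have d0 : 0 <= d by rewrite divr_ge0 ?subr_ge0 // ler0n.
have dn : n.+1%:R * d = b - a by rewrite mulrC divfK // gt_eqF.
have K i : (i <= n.+1)%N -> F a - F (a + i%:R * d) <= d * (e (a + i%:R * d) - e a).
  elim: i => [_|i IH iN]; first by rewrite mul0r addr0 !subrr mulr0.
  have {}IH := IH (ltnW iN).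
  have ib : i.+1%:R * d <= b - a by rewrite -dn ler_wpM2r // ler_nat.
  have i0 : 0 <= i%:R * d by rewrite mulr_ge0.
  have E : i.+1%:R * d = i%:R * d + d by rewrite -natr1; ring.
  rewrite E in ib *; move: (i%:R * d) IH ib i0 => t IH ib i0.
  have H' := H (a + t) (a + (t + d)) ltac:(lra) ltac:(lra) ltac:(lra).
  have E2 : a + (t + d) - (a + t) = d by ring.
  rewrite E2 in H'; lra.
have := K n.+1 (leqnn _); rewrite dn (_ : a + (b - a) = b); last ring.
by rewrite /d => h; rewrite -lerBlDl (le_trans h) // mulrAC.
Qed.

Lemma exp_diff x y n : 0 <= x -> x <= y ->
  n.+1%:R * x ^+ n * (y - x) <= y ^+ n.+1 - x ^+ n.+1 <= n.+1%:R * y ^+ n * (y - x).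
Proof.
move=> x0 xy; elim: n => [|n /andP[IH1 IH2]]; first by rewrite !expr0 !expr1 !mulr1 !mul1r lexx.
have y0 : 0 <= y by lra.
have xn : x ^+ n.+1 <= y ^+ n.+1 by rewrite lerXn2r.
have E : y ^+ n.+2 - x ^+ n.+2 = y * (y ^+ n.+1 - x ^+ n.+1) + x ^+ n.+1 * (y - x).
  by rewrite !(exprS _ n.+1); ring.
have E' : y ^+ n.+2 - x ^+ n.+2 = x * (y ^+ n.+1 - x ^+ n.+1) + y ^+ n.+1 * (y - x).
  by rewrite !(exprS _ n.+1); ring.
have yx : 0 <= y - x by lra.
have xn' := ler_wpM2r yx xn.
have K1 := ler_wpM2l x0 IH1; have K2 := ler_wpM2l y0 IH2.
apply/andP; split; [rewrite E'|rewrite E]; rewrite -[n.+2%:R]natr1; move: K1 K2 xn'; rewrite !exprS;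
  move: (n.+1%:R) (x ^+ n) (y ^+ n) => m X Y; lra.
Qed.

Definition ln_partial N x : R := \sum_(i < N) x ^+ i.+1 / i.+1%:R.

Lemma geom_sum N x : x != 1 -> \sum_(i < N) x ^+ i = (1 - x ^+ N) / (1 - x).
Proof.
move=> x1; have d : 1 - x != 0 by rewrite subr_eq0 eq_sym.
apply: (mulIf d); rewrite divfK //; elim: N => [|N IH]; first by rewrite big_ord0; ring.
by rewrite big_ord_recr /= mulrDl IH exprS; ring.
Qed.

Lemma ln_partial_diff N x y : 0 <= x -> x <= y -> y < 1 ->
  (y - x) * ((1 - x ^+ N) / (1 - x)) <= ln_partial N y - ln_partial N x <=
  (y - x) * ((1 - y ^+ N) / (1 - y)).
Proof.
move=> x0 xy y1; rewrite -!geom_sum ?lt_eqF //; last lra.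
rewrite !mulr_sumr /ln_partial -sumrB; apply/andP; split; apply: ler_sum => i _.
  rewrite -mulrBl ler_pdivlMr ?ltr0Sn //; have /andP[h _] := exp_diff i x0 xy.
  by rewrite (_ : _ * _ * _ = i.+1%:R * x ^+ i * (y - x)) //; ring.
rewrite -mulrBl ler_pdivrMr ?ltr0Sn //; have /andP[_ h] := exp_diff i x0 xy.
by rewrite (_ : _ * y ^+ i * _ = i.+1%:R * y ^+ i * (y - x)) //; ring.
Qed.

Lemma ln_ge1 t : 0 < t -> 1 - t^-1 <= ln t <= t - 1.
Proof.
move=> t0; have H s : 0 < s -> ln s <= s - 1.
  by move=> s0; rewrite -{1}(subrKC 1 s); apply: le_ln1Dx; lra.
rewrite H // andbT; have := H t^-1; rewrite invr_gt0 => /(_ t0); rewrite lnV ?posrE //; lra.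
Qed.

Lemma ln1B_diff x y : 0 <= x -> x <= y -> y < 1 ->
  (y - x) / (1 - x) <= ln (1 - x) - ln (1 - y) <= (y - x) / (1 - y).
Proof.
move=> x0 xy y1; have hx : 0 < 1 - x by lra.
have hy : 0 < 1 - y by lra.
rewrite -ln_div ?posrE //.
have := @ln_ge1 ((1 - x) / (1 - y)) (divr_gt0 hx hy); rewrite invf_div.
have -> : 1 - (1 - y) / (1 - x) = (y - x) / (1 - x) by field; lra.
by have -> : (1 - x) / (1 - y) - 1 = (y - x) / (1 - y) by field; lra.
Qed.

Lemma ln_partial_le N x : 0 <= x -> x < 1 -> ln_partial N x <= - ln (1 - x).
Proof.
move=> x0 x1.
suff : - ln (1 - 0) - ln_partial N 0 <= - ln (1 - x) - ln_partial N x.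
  have -> : ln_partial N 0 = 0 by apply: big1 => i _; rewrite exprS !mul0r.
  rewrite !subr0 ln1; lra.
apply: (@refine_nondecreasing (fun t => - ln (1 - t) - ln_partial N t) (fun t => (1 - t)^-1)) => // a b a0 ab bx.
have /andP[h1 _] := ln1B_diff a0 ab (le_lt_trans bx x1).
have /andP[_ h2] := ln_partial_diff N a0 ab (le_lt_trans bx x1).
have : (b - a) * ((1 - b ^+ N) / (1 - b)) <= (b - a) * (1 - b)^-1.
  apply: ler_wpM2l; first lra.
  rewrite -[leRHS]mul1r; apply: ler_wpM2r; first by rewrite invr_ge0; lra.
  have : 0 <= b ^+ N by apply: exprn_ge0; lra.
  lra.
rewrite mulrBr; lra.
Qed.

Lemma ln_partial_ge N x : 0 <= x -> x < 1 -> - ln (1 - x) <= ln_partial N x + x ^+ N / (1 - x).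
Proof.
move=> x0 x1; pose c := x ^+ N / (1 - x).
have c0 : 0 <= c by rewrite divr_ge0 ?exprn_ge0 //; lra.
suff : c * 0 + ln (1 - 0) + ln_partial N 0 <= c * x + ln (1 - x) + ln_partial N x.
  have -> : ln_partial N 0 = 0 by apply: big1 => i _; rewrite exprS !mul0r.
  have : c * x <= c by rewrite ler_piMr // ltW.
  rewrite !subr0 ln1 -/c; lra.
(* The geometric tail missing from the partial sum is at most [c] on the whole interval, which the
   linear term compensates. *)
apply: (@refine_nondecreasing (fun t => c * t + ln (1 - t) + ln_partial N t) (fun t => (1 - t)^-1)) => // a b a0 ab bx.
have /andP[_ h1] := ln1B_diff a0 ab (le_lt_trans bx x1).
have /andP[h2 _] := ln_partial_diff N a0 ab (le_lt_trans bx x1).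
have ac : a ^+ N / (1 - a) <= c.
  apply: ler_pM; rewrite ?exprn_ge0 ?invr_ge0 //; try lra.
    by rewrite lerXn2r ?nnegrE //; lra.
  rewrite lef_pV2 ?posrE; lra.
have ba : 0 <= b - a by lra.
have := ler_wpM2l ba ac.
have : (b - a) * ((1 - a ^+ N) / (1 - a)) = (b - a) * (1 - a)^-1 - (b - a) * (a ^+ N / (1 - a)) by ring.
rewrite mulrBr; lra.
Qed.

Definition li2_partial N w : R := \sum_(i < N) expR (- (i.+1%:R * w)) / i.+1%:R ^+ 2.

(** The dilogarithm of [expR (- w)], for [w >= 0]; the terms are nonnegative, so the supremum is the
    sum of the series. *)
Definition li2 w : R := sup (range (fun N => li2_partial N w)).

(* [bose w] is the sum of the [expR (- n * w) / n], and [li2' = - bose]. *)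
Definition bose w : R := - ln (1 - expR (- w)).

Lemma li2_partial_mono N N' w : (N <= N')%N -> li2_partial N w <= li2_partial N' w.
Proof.
move=> /subnK <-; elim: (N' - N)%N => // k IH; rewrite addSn (le_trans IH) //.
by rewrite /li2_partial big_ord_recr /= lerDl divr_ge0 ?expR_ge0 // exprn_ge0.
Qed.

Lemma expR_diff x y : (y - x) * expR x <= expR y - expR x <= (y - x) * expR y.
Proof.
have H s t : (t - s) * expR s <= expR t - expR s.
  have -> : expR t = expR s * expR (t - s) by rewrite -expRD addrC subrK.
  have := ler_wpM2l (expR_ge0 s) (expR_ge1Dx (t - s)); lra.
have := H x y; have := H y x; lra.
Qed.

Lemma li2_partial_diff N w w' : w <= w' ->
  (w' - w) * ln_partial N (expR (- w')) <= li2_partial N w - li2_partial N w' <=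
  (w' - w) * ln_partial N (expR (- w)).
Proof.
move=> ww'; rewrite !mulr_sumr /li2_partial -sumrB.
have E (k : nat) t : expR (- t) ^+ k = expR (- (k%:R * t)) by rewrite -expRM_natl mulrN.
have K (i : 'I_N) (t : R) : (w' - w) * (expR (- t) ^+ i.+1 / i.+1%:R) =
    (i.+1%:R * w' - i.+1%:R * w) * expR (- (i.+1%:R * t)) / i.+1%:R ^+ 2.
  rewrite E; have : i.+1%:R != 0 :> R by rewrite pnatr_eq0.
  by move: (i.+1%:R) => m m0; field.
apply/andP; split; apply: ler_sum => i _; rewrite K -mulrBl; apply: ler_wpM2r;
  rewrite ?invr_ge0 ?exprn_ge0 //.
- have /andP[h _] := expR_diff (- (i.+1%:R * w')) (- (i.+1%:R * w)); lra.
- have /andP[_ h] := expR_diff (- (i.+1%:R * w')) (- (i.+1%:R * w)); lra.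
Qed.

(** Telescoping with [1 / (m + 1)^2 <= 1 / m - 1 / (m + 1)]. *)
Lemma li2_partial_le2 N w : 0 <= w -> li2_partial N w <= 2.
Proof.
move=> w0; suff : li2_partial N.+1 w <= 2 - N.+1%:R^-1.
  move=> h; apply: (le_trans (li2_partial_mono w (leqnSn N))); apply: (le_trans h).
  by rewrite gerBl invr_ge0.
have e1 k : expR (- (k.+1%:R * w)) <= 1 by rewrite -[leRHS]expR0 ler_expR oppr_le0 mulr_ge0.
elim: N => [|N IH].
  by rewrite /li2_partial big_ord1 /= expr1n divr1 invr1; apply: (le_trans (e1 0%N)); lra.
rewrite /li2_partial big_ord_recr /= -/(li2_partial N.+1 w).
have n0 : 0 < N.+1%:R :> R by [].
have := e1 N.+1; have -> : N.+2%:R = N.+1%:R + 1 :> R by rewrite natr1.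
move: (N.+1%:R) n0 IH => m m0 IH; set t := expR _ => t1.
apply: (le_trans (lerD IH (lexx _))).
have m1 : 0 < (m + 1)^-1 by rewrite invr_gt0; lra.
have h : t / (m + 1) ^+ 2 <= (m + 1)^-1 ^+ 2.
  by rewrite exprVn ler_piMl // invr_ge0 exprn_ge0 //; lra.
have h2 : m^-1 - (m + 1)^-1 = m^-1 * (m + 1)^-1 by field; lra.
have h3 : (m + 1)^-1 <= m^-1 by rewrite lef_pV2 ?posrE; lra.
have := ler_wpM2r (ltW m1) h3; rewrite -expr2; lra.
Qed.

Lemma li2_ub N w : 0 <= w -> li2_partial N w <= li2 w.
Proof.
move=> w0; apply: ub_le_sup; last by exists N.
by exists 2 => _ [n _ <-]; exact: li2_partial_le2.
Qed.

Lemma li2_le w a : (forall N, li2_partial N w <= a) -> li2 w <= a.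
Proof.
move=> H; apply: ge_sup; first by exists (li2_partial 0 w); exists 0%N.
by move=> _ [N _ <-].
Qed.

Lemma expN01 w : 0 < w -> 0 <= expR (- w) < 1.
Proof. by move=> w0; rewrite expR_ge0 -[ltRHS]expR0 ltr_expR oppr_lt0. Qed.

Lemma li2_diff_le w w' : 0 < w -> w <= w' -> li2 w - li2 w' <= (w' - w) * bose w.
Proof.
move=> w0 ww'; rewrite lerBlDl; apply: li2_le => N.
have /andP[_ h] := li2_partial_diff N ww'.
have w0' : 0 <= w' by lra.
have h2 := li2_ub N w0'; have /andP[x0 x1] := expN01 w0.
have ww : 0 <= w' - w by lra.
have := ler_wpM2l ww (ln_partial_le N x0 x1); rewrite -/(bose w); lra.
Qed.

(** The left end may be 0 because the tail of the logarithm is estimated at [w'] only, where it is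
    at most a constant over [n]. *)
Lemma li2_diff_ge w w' : 0 <= w -> w < w' -> (w' - w) * bose w' <= li2 w - li2 w'.
Proof.
move=> w0 ww'; have w0' : 0 < w' by lra.
suff : li2 w' <= li2 w - (w' - w) * bose w' by lra.
apply: li2_le => N; have /andP[x0 x1] := expN01 w0'.
set x := expR (- w') in x0 x1.
apply: (@ler_archi _ _ ((w' - w) * (w'^-1 / (1 - x))) N) => n Nn.
have /andP[h _] := li2_partial_diff n.+1 (ltW ww').
have h1 := li2_partial_mono w' (leqW Nn); have h2 := li2_ub n.+1 w0.
have ww : 0 <= w' - w by lra.
have h3 := ler_wpM2l ww (ln_partial_ge n.+1 x0 x1).
have h4 : x ^+ n.+1 / (1 - x) <= w'^-1 / (1 - x) / n.+1%:R.
  rewrite mulrAC; apply: ler_wpM2r; first by rewrite invr_ge0; lra.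
  rewrite /x -expRM_natl mulrN expRN -invfM lef_pV2 ?posrE ?expR_gt0 ?mulr_gt0 //.
  by apply: le_trans (expR_ge1Dx _); rewrite mulrC lerDr.
have h5 := ler_wpM2l ww h4; rewrite -[- ln _]/(bose w') in h3.
rewrite -[_ * _ / n.+1%:R]mulrA; move: h3 h5; move: (x ^+ n.+1 / (1 - x)) (w'^-1 / (1 - x) / n.+1%:R) => A B; lra.
Qed.

Lemma bose_ge0 w : 0 < w -> 0 <= bose w.
Proof. by move=> /expN01/andP[h1 h2]; rewrite /bose oppr_ge0 ln_le0 // gerBl. Qed.

Lemma bose_le w : 0 < w -> bose w <= w^-1.
Proof.
move=> w0; have /andP[x0 x1] := expN01 w0.
have := @ln_ge1 (1 - expR (- w)) ltac:(lra); rewrite /bose => /andP[h _].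
have hw : 1 - expR (- w) >= w / (1 + w).
  have h2 : expR (- w) <= (1 + w)^-1.
    by rewrite expRN lef_pV2 ?posrE ?expR_gt0 ?expR_ge1Dx //; lra.
  have -> : w / (1 + w) = 1 - (1 + w)^-1 by field; lra.
  lra.
have : (1 - expR (- w))^-1 <= (w / (1 + w))^-1.
  by rewrite lef_pV2 ?posrE //; [lra|apply: divr_gt0; lra].
rewrite invf_div (_ : (1 + w) / w = w^-1 + 1); last by field; lra.
lra.
Qed.

Lemma li2_decr w w' : 0 <= w -> w <= w' -> li2 w' <= li2 w.
Proof.
move=> w0; rewrite le_eqVlt => /predU1P[-> //|ww'].
have w0' : 0 < w' by lra.
have := li2_diff_ge w0 ww'; have : 0 <= (w' - w) * bose w'.
  by rewrite mulr_ge0 ?bose_ge0 //; lra.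
lra.
Qed.

Lemma li2_ge0 w : 0 <= w -> 0 <= li2 w.
Proof. by move=> w0; rewrite (le_trans _ (li2_ub 0 w0)) // /li2_partial big_ord0. Qed.

Lemma li2_le_inv w : 0 < w -> li2 w <= 2 / w.
Proof.
move=> w0; apply: li2_le => N; apply: (@le_trans _ _ (w^-1 * li2_partial N 0)).
  rewrite /li2_partial mulr_sumr; apply: ler_sum => i _; rewrite mulr0 oppr0 expR0 mulrA.
  rewrite ler_pM2r ?invr_gt0 ?exprn_gt0 // mulr1 expRN lef_pV2 ?posrE ?expR_gt0 //.
  apply: le_trans (expR_ge1Dx _); rewrite -natr1.
  have : 0 <= i%:R * w by rewrite mulr_ge0 // ltW.
  lra.
by rewrite mulrC ler_wpM2r ?invr_ge0 ?li2_partial_le2 // ltW.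
Qed.

(** A partial sum close to the supremum is Lipschitz, with constant at most its number of terms. *)
Lemma li2_cvg0 e : 0 < e -> exists2 w, 0 < w & li2 0 - e <= li2 w.
Proof.
move=> e0; have [N hN] : exists N, li2 0 - e / 2 <= li2_partial N 0.
  have hs : has_sup (range (fun N => li2_partial N 0)).
    split; first by exists (li2_partial 0 0); exists 0%N.
    by exists 2 => _ [n _ <-]; exact: li2_partial_le2.
  have [_ [N _ <-] h] := sup_adherent (eps := e / 2) ltac:(lra) hs.
  by exists N; exact: ltW.
pose w := e / (2 * (N%:R + 1)).
have N0 : 0 <= N%:R :> R by [].
have w0 : 0 < w by apply: divr_gt0; lra.
exists w => //; have h := li2_ub N (ltW w0).
have /andP[_ h2] := li2_partial_diff N (ltW w0).
have h3 : ln_partial N (expR (- 0)) <= N%:R.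
  rewrite oppr0 expR0 /ln_partial; apply: (@le_trans _ _ (\sum_(i < N) 1)).
    by apply: ler_sum => i _; rewrite expr1n mul1r invf_le1 ?ler1n.
  by rewrite sumr_const card_ord.
have h4 : w * ln_partial N (expR (- 0)) <= w * (N%:R + 1) by apply: ler_wpM2l; lra.
have h5 : w * (N%:R + 1) = e / 2 by rewrite /w; field; lra.
rewrite subr0 in h2; lra.
Qed.

End dilog.

(** * The exponent and its primitive *)

Section entropy.
Variable R : realType.
Implicit Types (x y s t z w a b c e : R).

(** Here [x] is the probability that a line is empty, and the value is the root b of
    [b^2 = (1 - x) * b + x * (1 - x)]. *)
Definition gap_root x : R := (1 - x + Num.sqrt ((1 - x) * (1 + 3 * x))) / 2.

Lemma gap_rootE x : 0 <= x <= 1 -> gap_root x ^+ 2 = (1 - x) * gap_root x + x * (1 - x).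
Proof.
move=> /andP[x0 x1]; have h : 0 <= (1 - x) * (1 + 3 * x) by apply: mulr_ge0; lra.
have := sqr_sqrtr h; rewrite /gap_root; set s := Num.sqrt _ => hs.
have -> : ((1 - x + s) / 2) ^+ 2 = ((1 - x) ^+ 2 + 2 * (1 - x) * s + s ^+ 2) / 4 by field.
by rewrite hs; field.
Qed.

Lemma gap_root_ge x : 0 <= x <= 1 -> 1 - x <= gap_root x.
Proof.
move=> /andP[x0 x1]; suff : 1 - x <= Num.sqrt ((1 - x) * (1 + 3 * x)) by rewrite /gap_root; lra.
have h0 : 0 <= 1 - x by lra.
rewrite -[X in X <= _]ger0_norm // -sqrtr_sqr; apply: ler_wsqrtr; rewrite expr2; apply: ler_wpM2l => //; lra.
Qed.

(** The second factor is positive for [s > 0], so comparing [s] with the root becomes a polynomial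
    inequality. *)
Lemma gap_root_factor x s : 0 <= x <= 1 ->
  s ^+ 2 - ((1 - x) * s + x * (1 - x)) = (s - gap_root x) * (s + gap_root x - (1 - x)).
Proof.
move=> /gap_rootE; move: (gap_root x) => f h.
have -> : (s - f) * (s + f - (1 - x)) = s ^+ 2 - (1 - x) * s - f ^+ 2 + (1 - x) * f by ring.
by rewrite h; ring.
Qed.

Lemma gap_root_le x s : 0 <= x <= 1 -> 0 < s ->
  (gap_root x <= s) = ((1 - x) * s + x * (1 - x) <= s ^+ 2).
Proof.
move=> x01 s0; rewrite -subr_ge0 -[RHS]subr_ge0 gap_root_factor // pmulr_lge0 //.
have := gap_root_ge x01; lra.
Qed.

Lemma le_gap_root x s : 0 <= x <= 1 -> 0 < s ->
  (s <= gap_root x) = (s ^+ 2 <= (1 - x) * s + x * (1 - x)).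
Proof.
move=> x01 s0; rewrite -subr_le0 -[RHS]subr_le0 gap_root_factor // pmulr_lle0 //.
have := gap_root_ge x01; lra.
Qed.

Lemma gap_root_gt0 x : 0 <= x < 1 -> 0 < gap_root x.
Proof. by move=> /andP[x0 x1]; have := @gap_root_ge x ltac:(lra); lra. Qed.

Lemma gap_root_lt1 x : 0 < x <= 1 -> gap_root x < 1.
Proof.
move=> /andP[x0 x1]; rewrite ltNge le_gap_root; [|lra|lra].
rewrite -ltNge; have : 0 < x * x by rewrite mulr_gt0.
lra.
Qed.

Lemma gap_root_decr x y : 0 <= x -> x < 1 -> x <= y -> y <= 1 -> gap_root y <= gap_root x.
Proof.
move=> x0 x1 xy y1; have hx : 0 <= x <= 1 by lra.
have f0 : 0 < gap_root x by apply: gap_root_gt0; lra.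
rewrite gap_root_le //; last lra.
have := gap_rootE hx; have := gap_root_ge hx; move: (gap_root x) f0 => s f0 h1 h2.
have : 0 <= (y - x) * (s + x + y - 1) by apply: mulr_ge0; lra.
rewrite h2; lra.
Qed.

Definition gfun z : R := - ln (gap_root (expR (- z))).

Lemma expN_itv z : 0 < z -> 0 < expR (- z) < 1.
Proof. by move=> z0; rewrite expR_gt0 /= -[ltRHS]expR0 ltr_expR oppr_lt0. Qed.

Lemma expR_gfun z : 0 < z -> expR (- gfun z) = gap_root (expR (- z)).
Proof.
move=> /expN_itv/andP[x0 x1]; rewrite /gfun opprK lnK // posrE gap_root_gt0 //; lra.
Qed.

Lemma gfun_gt0 z : 0 < z -> 0 < gfun z.
Proof.
move=> z0; have /andP[x0 x1] := expN_itv z0; rewrite /gfun oppr_gt0 ln_lt0 //.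
by rewrite gap_root_gt0 ?gap_root_lt1 //; lra.
Qed.

Lemma gfun_decr z z' : 0 < z -> z <= z' -> gfun z' <= gfun z.
Proof.
move=> z0 zz; have z0' : 0 < z' by lra.
have /andP[y0 y1] := expN_itv z0; have /andP[y0' y1'] := expN_itv z0'.
rewrite -lerN2 -ler_expR !expR_gfun //; apply: gap_root_decr; [exact: ltW|by []|by rewrite ler_expR lerN2|exact: ltW].
Qed.

Lemma gfun_le_bose z : 0 < z -> gfun z <= bose z.
Proof.
move=> z0; have /andP[x0 x1] := expN_itv z0; rewrite /gfun /bose lerN2 ler_ln ?posrE //; last 2 first.
- lra.
- by apply: gap_root_gt0; lra.
by apply: gap_root_ge; lra.
Qed.

Lemma gfun_large M : 0 <= M -> exists2 z0, 0 < z0 & forall z, 0 < z -> z <= z0 -> M <= gfun z.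
Proof.
move=> M0; pose s := expR (- M).
have s0 : 0 < s by exact: expR_gt0.
have s1 : s <= 1 by rewrite /s -[leRHS]expR0 ler_expR oppr_le0.
exists (s ^+ 2 / 2); first by rewrite divr_gt0 ?exprn_gt0.
move=> z z0 zz; rewrite -lerN2 -ler_expR expR_gfun // -/s.
have /andP[x0 x1] := expN_itv z0.
rewrite gap_root_le //; last lra.
have h := expR_ge1Dx (- z); set x := expR _ in x0 x1 h *.
have : (1 - x) * (s + x) <= z * 2 by apply: ler_pM; lra.
lra.
Qed.

(** The graph of g in the coordinate [w = g - z]. With x = exp (- z) and f = exp (- g), the equation
    of g reads [x^2 + x f + f^2 = x + f]. Divided by x^2 it becomes linear in 1 / x, and so gives z
    as a function of f / x = exp (- w). *)
Definition curve w : R := ln (1 + expR (- w) + expR (- w) ^+ 2) - ln (1 + expR (- w)).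

Lemma curve_gfun z : 0 < z -> curve (gfun z - z) = z.
Proof.
move=> z0; have /andP[x0 x1] := expN_itv z0.
have e : expR (- (gfun z - z)) = gap_root (expR (- z)) / expR (- z).
  by rewrite opprB expRD mulrC expR_gfun // -expRN opprK.
rewrite /curve e; set x := expR (- z) in x0 x1 *.
have f0 : 0 < gap_root x by apply: gap_root_gt0; lra.
have := @gap_rootE x ltac:(lra); set f := gap_root x in f0 *; move=> fE.
have h : 1 + f / x + (f / x) ^+ 2 = (1 + f / x) / x.
  have -> : 1 + f / x + (f / x) ^+ 2 = (x ^+ 2 + f * x + f ^+ 2) / x ^+ 2 by field; lra.
  by rewrite fE; field; lra.
have p1 : 0 < 1 + f / x by rewrite addr_gt0 // divr_gt0.
rewrite h ln_div ?posrE // /x expRK; lra.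
Qed.

(** Midpoint convexity of [curve] in exponential form, with [r] the geometric mean of [a] and [b].
    The difference of the two sides has the factor [a + b - 2 * r]. *)
Lemma cvx_poly a b r : 0 < a -> 0 < b -> 0 < r -> r ^+ 2 = a * b ->
  (1 + a) * (1 + b) * (1 + r + r ^+ 2) ^+ 2 <=
  (1 + r) ^+ 2 * (1 + a + a ^+ 2) * (1 + b + b ^+ 2).
Proof.
move=> a0 b0 r0 rE.
have sr : 2 * r <= a + b.
  rewrite -(@ler_pXn2r _ 2) ?nnegrE; [|by []|lra|lra].
  rewrite exprMn rE; have : 0 <= (a - b) ^+ 2 by apply: sqr_ge0.
  lra.
set u := a + b in sr *.
have e1 : (1 + a) * (1 + b) = 1 + u + r ^+ 2 by rewrite rE /u; ring.
have e2 : (1 + a + a ^+ 2) * (1 + b + b ^+ 2) = 1 + u + u ^+ 2 - r ^+ 2 + r ^+ 2 * u + (r ^+ 2) ^+ 2.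
  by rewrite rE /u; ring.
rewrite e1 -mulrA e2 -subr_ge0.
have -> : (1 + r) ^+ 2 * (1 + u + u ^+ 2 - r ^+ 2 + r ^+ 2 * u + (r ^+ 2) ^+ 2) -
   (1 + u + r ^+ 2) * (1 + r + r ^+ 2) ^+ 2 =
   (u - 2 * r) * ((1 + r) ^+ 2 * u + 2 * r + 3 * r ^+ 2 + 2 * r ^+ 3) by ring.
apply: mulr_ge0; first by rewrite subr_ge0.
have u0 : 0 <= u by rewrite /u addr_ge0 // ltW.
by rewrite !addr_ge0 ?mulr_ge0 ?exprn_ge0 //; lra.
Qed.

(** The change of coordinates from (z, g) to (g - z, z) is linear and preserves midpoints. Convexity
    of [curve] then places the midpoint of a chord above the graph of g. *)
Lemma gfun_midpoint z z' : 0 < z -> 0 < z' -> 2 * gfun ((z + z') / 2) <= gfun z + gfun z'.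
Proof.
move=> z0 z0'; set m := (z + z') / 2; have m0 : 0 < m by rewrite /m; lra.
have c1 := curve_gfun z0; have c2 := curve_gfun z0'.
pose a := expR (- (gfun z - z)); pose b := expR (- (gfun z' - z')).
have a0 : 0 < a by exact: expR_gt0.
have b0 : 0 < b by exact: expR_gt0.
pose v := (gfun z + gfun z') / 2; pose r := expR (- (v - m)); pose x := expR (- m).
have r0 : 0 < r by exact: expR_gt0.
have rE : r ^+ 2 = a * b.
  by rewrite /r /a /b -expRM_natl -expRD; congr expR; rewrite /v /m; field.
have eS w : expR (- curve w) = (1 + expR (- w)) / (1 + expR (- w) + expR (- w) ^+ 2).
  have e0 := expR_gt0 (- w); rewrite /curve; set y := expR (- w) in e0 *.
  have h : 0 < 1 + y + y ^+ 2 by rewrite !addr_gt0 ?exprn_gt0.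
  by rewrite opprB expRD expRN !lnK ?posrE //; lra.
have xE : x ^+ 2 = ((1 + a) / (1 + a + a ^+ 2)) * ((1 + b) / (1 + b + b ^+ 2)).
  by rewrite -!eS c1 c2 -expRD /x -expRM_natl; congr expR; rewrite /m; field.
have key : x * (1 + r + r ^+ 2) <= 1 + r.
  have x0 : 0 < x by exact: expR_gt0.
  have h : 0 < 1 + r + r ^+ 2 by rewrite !addr_gt0 ?exprn_gt0.
  rewrite -(@ler_pXn2r _ 2) ?nnegrE ?mulr_ge0 //; try lra.
  rewrite exprMn xE; have := cvx_poly a0 b0 r0 rE.
  have ha : 0 < 1 + a + a ^+ 2 by rewrite !addr_gt0 ?exprn_gt0.
  have hb : 0 < 1 + b + b ^+ 2 by rewrite !addr_gt0 ?exprn_gt0.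
  have -> : (1 + a) / (1 + a + a ^+ 2) * ((1 + b) / (1 + b + b ^+ 2)) * (1 + r + r ^+ 2) ^+ 2 =
    ((1 + a) * (1 + b) * (1 + r + r ^+ 2) ^+ 2) / ((1 + a + a ^+ 2) * (1 + b + b ^+ 2)) by field; lra.
  by move=> cv; rewrite ler_pdivrMr ?mulr_gt0 // [X in _ <= X]mulrA.
suff : gfun m <= v by rewrite /v; lra.
rewrite -lerN2 -ler_expR expR_gfun //.
have /andP[x0 x1] := expN_itv m0; rewrite -/x in x0 x1 *.
have -> : expR (- v) = r * x by rewrite /r /x -expRD; congr expR; ring.
rewrite le_gap_root ?mulr_gt0 //; last lra.
have := ler_wpM2l (ltW x0) key; lra.
Qed.

Lemma curve_decr w w' : w <= w' -> curve w' <= curve w.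
Proof.
move=> ww; have e0 := expR_gt0 (- w'); have e1 := expR_gt0 (- w).
have le : expR (- w') <= expR (- w) by rewrite ler_expR lerN2.
rewrite /curve; set r := expR (- w) in e1 le *; set r' := expR (- w') in e0 le *.
have h1 : 0 < 1 + r + r ^+ 2 by rewrite !addr_gt0 ?exprn_gt0.
have h2 : 0 < 1 + r' + r' ^+ 2 by rewrite !addr_gt0 ?exprn_gt0.
rewrite -!ln_div ?posrE; [|lra..].
rewrite ler_ln ?posrE ?divr_gt0 //; [|lra..].
rewrite ler_pdivrMr; last lra.
rewrite mulrAC ler_pdivlMr; last lra.
have : 0 <= (r - r') * (r + r' + r * r') by apply: mulr_ge0; [lra|rewrite !addr_ge0 ?mulr_ge0 // ltW].
lra.
Qed.

(** The equation [x^2 + x f + f^2 = x + f] is symmetric, so the graph of g is its own mirror image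
    in the diagonal; exchanging z and g changes the sign of [w]. *)
Lemma curveN w : curve (- w) = curve w + w.
Proof.
rewrite /curve opprK expRN; set r := expR w; have r0 : 0 < r by exact: expR_gt0.
have h1 : 0 < 1 + r + r ^+ 2 by rewrite !addr_gt0 ?exprn_gt0.
have h2 : 0 < 1 + r by lra.
have -> : 1 + r^-1 + r^-1 ^+ 2 = (1 + r + r ^+ 2) / r ^+ 2 by field; lra.
have -> : 1 + r^-1 = (1 + r) / r by field; lra.
rewrite !ln_div ?posrE ?exprn_gt0 // lnXn // -[X in _ = _ + X](expRK w) -/r mulr2n; lra.
Qed.

Lemma curve_gt0 w : 0 < curve w.
Proof.
rewrite /curve; set r := expR _; have r0 : 0 < r by exact: expR_gt0.
rewrite subr_gt0 ltr_ln ?posrE; [|lra|by rewrite !addr_gt0 ?exprn_gt0].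
by rewrite ltrDl exprn_gt0.
Qed.

(** [1 + r + r^2 = (1 - r^3) / (1 - r)] and [1 + r = (1 - r^2) / (1 - r)], and the denominators
    cancel. *)
Lemma curve_bose w : 0 < w -> curve w = bose (2 * w) - bose (3 * w).
Proof.
move=> w0; have /andP[x0 x1] := expN_itv w0.
have e k : expR (- (k%:R * w)) = expR (- w) ^+ k by rewrite -expRM_natl mulrN.
rewrite /curve /bose !e; set r := expR (- w) in x0 x1 *.
have h1 : 0 < 1 + r + r ^+ 2 by rewrite !addr_gt0 ?exprn_gt0.
have h2 : 0 < 1 - r by lra.
have h3 : 0 < 1 + r by lra.
have -> : 1 - r ^+ 2 = (1 - r) * (1 + r) by ring.
have -> : 1 - r ^+ 3 = (1 - r) * (1 + r + r ^+ 2) by ring.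
rewrite !lnM ?posrE //; lra.
Qed.

(** The primitive of [curve] on the positive half line that vanishes at infinity. *)
Definition dil w : R := li2 (3 * w) / 3 - li2 (2 * w) / 2.

Lemma dil_bounds x y : 0 < x -> x <= y ->
  (y - x) * (bose (2 * y) - bose (3 * x)) <= dil y - dil x <= (y - x) * (bose (2 * x) - bose (3 * y)).
Proof.
move=> x0; rewrite le_eqVlt => /predU1P[<-|xy]; first by rewrite !subrr !mul0r lexx.
have A k : 0 < k -> k * (y - x) * bose (k * y) <= li2 (k * x) - li2 (k * y) <= k * (y - x) * bose (k * x).
  move=> k0; have kx : 0 < k * x by rewrite mulr_gt0.
  have kxy : k * x < k * y by rewrite ltr_pM2l.
  have h1 := li2_diff_ge (ltW kx) kxy; have h2 := li2_diff_le kx (ltW kxy).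
  by rewrite mulrBr h1 h2.
have /andP[a1 a2] := A 2 ltac:(lra); have /andP[b1 b2] := A 3 ltac:(lra).
rewrite /dil; lra.
Qed.

(** In [dil_bounds] the two terms of [curve] are evaluated at opposite ends of the interval. The
    mismatch is an increment of [bose (3 * t)], which disappears under refinement. *)
Lemma dil_diff_pos w w' : 0 < w -> w <= w' ->
  (w' - w) * curve w' <= dil w' - dil w <= (w' - w) * curve w.
Proof.
move=> w0 ww'; apply/andP; split.
- suff : dil w - curve w' * w <= dil w' - curve w' * w' by lra.
  apply: (@refine_nondecreasing _ (fun t => dil t - curve w' * t) (fun t => - bose (3 * t))) => // x y wx xy yw.
  have x0 : 0 < x by lra.
  have /andP[h _] := dil_bounds x0 xy.
  have c := curve_decr yw; have y0 : 0 < y by lra.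
  rewrite (curve_bose y0) in c.
  have := @ler_wpM2l _ (y - x) ltac:(lra) _ _ c; lra.
- suff : curve w * w - dil w <= curve w * w' - dil w' by lra.
  apply: (@refine_nondecreasing _ (fun t => curve w * t - dil t) (fun t => - bose (3 * t))) => // x y wx xy yw.
  have x0 : 0 < x by lra.
  have /andP[_ h] := dil_bounds x0 xy.
  have c := curve_decr wx.
  rewrite (curve_bose x0) in c.
  have := @ler_wpM2l _ (y - x) ltac:(lra) _ _ c; lra.
Qed.

Lemma dil_near0 e w : 0 < e -> 0 < w ->
  exists t, [/\ 0 < t, t <= w, t <= e & - e <= dil t - dil 0 <= e].
Proof.
move=> e0 w0; have [v v0 hv] := li2_cvg0 e0.
pose t := Num.min (Num.min w e) (v / 3).
have t0 : 0 < t by rewrite !lt_min w0 e0 divr_gt0.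
have tw : t <= w by rewrite /t !ge_min lexx.
have te : t <= e by rewrite /t !ge_min lexx orbT.
have tv : t <= v / 3 by rewrite /t ge_min lexx orbT.
exists t; split => //.
have h3 := @li2_decr _ (3 * t) v ltac:(lra) ltac:(lra).
have h2 := @li2_decr _ (2 * t) v ltac:(lra) ltac:(lra).
have k3 := @li2_decr _ 0 (3 * t) ltac:(lra) ltac:(lra).
have k2 := @li2_decr _ 0 (2 * t) ltac:(lra) ltac:(lra).
rewrite /dil !mulr0; lra.
Qed.

Lemma dil_diff w w' : 0 <= w -> w <= w' ->
  (w' - w) * curve w' <= dil w' - dil w <= (w' - w) * curve w.
Proof.
rewrite le_eqVlt => /predU1P[<-|w0]; last exact: dil_diff_pos.
rewrite le_eqVlt => /predU1P[<-|w0']; first by rewrite !subrr !mul0r lexx.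
rewrite subr0; apply/andP; split; apply/ler_addgt0Pr => e e0.
- have c0 := curve_gt0 w'.
  have e' : 0 < e / (1 + curve w') by rewrite divr_gt0 //; lra.
  have [t [t0 tw te /andP[h1 h2]]] := dil_near0 e' w0'.
  have /andP[k1 k2] := dil_diff_pos t0 tw.
  have E : e / (1 + curve w') * (1 + curve w') = e by rewrite divfK //; lra.
  have := @ler_wpM2r _ (curve w') (ltW c0) _ _ te; lra.
- have [t [t0 tw te /andP[h1 h2]]] := dil_near0 e0 w0'.
  have /andP[k1 k2] := dil_diff_pos t0 tw.
  have c := curve_decr (ltW t0); have c0 := curve_gt0 t; have c1 := curve_gt0 0.
  have m1 := @ler_wpM2l _ (w' - t) ltac:(lra) _ _ c.
  have m2 : 0 <= t * curve 0 by rewrite mulr_ge0 // ltW.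
  lra.
Qed.

(* A primitive of [curve] on the whole line; the negative half uses the
   reflection [curve (- w) = curve w + w]. *)
Definition hprim w : R := if 0 <= w then dil w else 2 * dil 0 - dil (- w) - w ^+ 2 / 2.

Lemma hprim_diff w w' : w <= w' ->
  (w' - w) * curve w' <= hprim w' - hprim w <= (w' - w) * curve w.
Proof.
have N x y : x <= y -> y <= 0 -> (y - x) * curve y <= hprim y - hprim x <= (y - x) * curve x.
  have E t : t <= 0 -> hprim t = 2 * dil 0 - dil (- t) - t ^+ 2 / 2.
    rewrite /hprim; case: ifP => // t0 t0'; have -> : t = 0 by lra.
    rewrite oppr0; ring.
  move=> xy y0.
  have B a b : x <= a -> a <= b -> b <= y ->
      (b - a) * (curve y - (b - a) / 2) <= hprim b - hprim a <= (b - a) * (curve x + (b - a) / 2).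
    move=> xa ab by_; rewrite !E; [|lra|lra].
    have := @dil_diff (- b) (- a) ltac:(lra) ltac:(lra); rewrite !curveN => /andP[h1 h2].
    have c1 := @curve_decr x b ltac:(lra); have c2 := @curve_decr a y ltac:(lra).
    have m1 := @ler_wpM2l _ (b - a) ltac:(lra) _ _ c1.
    have m2 := @ler_wpM2l _ (b - a) ltac:(lra) _ _ c2.
    apply/andP; split; lra.
  apply/andP; split.
  - suff : hprim x - curve y * x <= hprim y - curve y * y by lra.
    apply: (@refine_nondecreasing _ (fun t => hprim t - curve y * t) (fun t => t / 2)) => // a b xa ab by_.
    have /andP[h1 h2] := B a b xa ab by_; lra.
  - suff : curve x * x - hprim x <= curve x * y - hprim y by lra.
    apply: (@refine_nondecreasing _ (fun t => curve x * t - hprim t) (fun t => t / 2)) => // a b xa ab by_.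
    have /andP[h1 h2] := B a b xa ab by_; lra.
have P x y : 0 <= x -> x <= y -> (y - x) * curve y <= hprim y - hprim x <= (y - x) * curve x.
  by move=> x0 xy; rewrite /hprim x0 (le_trans x0 xy); exact: dil_diff.
move=> ww; have [w0|w0] := leP 0 w; first exact: P.
have [w0'|w0'] := leP w' 0; first exact: N.
have /andP[a1 a2] := N w 0 (ltW w0) (lexx _).
have /andP[b1 b2] := P 0 w' (lexx _) (ltW w0').
have c1 := curve_decr (ltW w0); have c2 := curve_decr (ltW w0').
have m1 := @ler_wpM2l _ (0 - w) ltac:(lra) _ _ c2.
have m2 := @ler_wpM2l _ (w' - 0) ltac:(lra) _ _ c1.
apply/andP; split; lra.
Qed.

(* The area under [gfun] up to [z]. *)
Definition gprim z : R := z * gfun z - z ^+ 2 / 2 - hprim (gfun z - z).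

(** Integration by parts: with [w = g - z], the integral of g dz is [z * w + z^2 / 2] minus the
    integral of [curve w] dw. No constant is added since [hprim] vanishes as [w] tends to infinity,
    that is, as [z] tends to 0. *)
Lemma gprim_diff z z' : 0 < z -> z <= z' ->
  (z' - z) * gfun z' <= gprim z' - gprim z <= (z' - z) * gfun z.
Proof.
move=> z0 zz'.
have B a b : 0 < a -> a <= b ->
    (b - a) * gfun b - (b - a) ^+ 2 / 2 <= gprim b - gprim a <= (b - a) * gfun a + (b - a) ^+ 2 / 2.
  move=> a0 ab; have b0 : 0 < b by lra.
  have d := gfun_decr a0 ab.
  have /andP := @hprim_diff (gfun b - b) (gfun a - a) ltac:(lra).
  rewrite !curve_gfun // => -[h1 h2].
  apply/andP; rewrite /gprim; split; lra.
apply/andP; split.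
- suff : gprim z - gfun z' * z <= gprim z' - gfun z' * z' by lra.
  apply: (@refine_nondecreasing _ (fun t => gprim t - gfun z' * t) (fun t => t / 2)) => // a b za ab bz.
  have a0 : 0 < a by lra.
  have /andP[h1 h2] := B a b a0 ab.
  have m := @ler_wpM2l _ (b - a) ltac:(lra) _ _ (@gfun_decr b z' ltac:(lra) bz); lra.
- suff : gfun z * z - gprim z <= gfun z * z' - gprim z' by lra.
  apply: (@refine_nondecreasing _ (fun t => gfun z * t - gprim t) (fun t => t / 2)) => // a b za ab bz.
  have a0 : 0 < a by lra.
  have /andP[h1 h2] := B a b a0 ab.
  have m := @ler_wpM2l _ (b - a) ltac:(lra) _ _ (gfun_decr z0 za); lra.
Qed.

End entropy.

(** * The Basel problem *)

Section basel.
Variable R : realType.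
Implicit Types (x y : R) (n m k : nat).

Lemma sin_bounds x : 0 < x -> x < pi / 2 -> x * cos x <= sin x <= x.
Proof.
move=> x0 xp.
have [|c] := @MVT R (@sin R) (@cos R) 0 x x0.
  by apply: continuous_subspaceT => y; exact: continuous_sin.
rewrite in_itv /= => /andP[c0 cx]; rewrite sin0 !subr0 => ->.
have pi0 := @pi_gt0 R.
apply/andP; split; last by rewrite ler_piMl ?cos_le1 // ltW.
rewrite mulrC; apply: ler_wpM2r; first exact: ltW.
by apply: ltW; rewrite ltr_cos // in_itv /=; lra.
Qed.

(** The angles of level [n.+1] are the halves of those of level [n] together with the complements of
    these halves to [pi / 2]. *)
Definition odd_angle n k : R := (2 * k%:R + 1) * pi / (4 * 2 ^+ n).

Lemma odd_angle_itv n k : (k < 2 ^ n)%N -> 0 < odd_angle n k < pi / 2.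
Proof.
move=> kn; have pi0 := @pi_gt0 R.
have n0 : 0 < 2 ^+ n :> R by rewrite exprn_gt0.
have k0 : 0 <= k%:R :> R by [].
have h : k%:R + 1 <= 2 ^+ n :> R by rewrite natr1 -natrX ler_nat.
apply/andP; split; first by apply: divr_gt0; [apply: mulr_gt0; lra|lra].
rewrite /odd_angle ltr_pdivrMr; last lra.
have := @ler_wpM2l R pi (ltW pi0) _ _ h; lra.
Qed.

Lemma inv_sin2_half x : 0 < x < pi / 2 ->
  (sin (x / 2) ^+ 2)^-1 + (sin (pi / 2 - x / 2) ^+ 2)^-1 = 4 / sin x ^+ 2.
Proof.
move=> /andP[x0 xp]; have pi0 := @pi_gt0 R.
have s0 : 0 < sin (x / 2) by apply: sin_gt0_pihalf; lra.
have c0 : 0 < cos (x / 2) by apply: cos_gt0_pihalf; lra.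
have -> : sin (pi / 2 - x / 2) = cos (x / 2).
  by rewrite sinB sin_pihalf cos_pihalf mul1r mul0r subr0.
have -> : sin x = 2 * (cos (x / 2) * sin (x / 2)).
  by rewrite mulr_natl -sin_mulr2n; congr sin; rewrite mulr2n; field.
have := cos2Dsin2 (x / 2); move: (cos (x / 2)) (sin (x / 2)) s0 c0 => c s s0 c0 h.
have -> : (s ^+ 2)^-1 + (c ^+ 2)^-1 = (c ^+ 2 + s ^+ 2) / (c * s) ^+ 2 by field; lra.
rewrite h; field; lra.
Qed.

Lemma sum_reflect (F : nat -> R) m :
  \sum_(k < m + m) F k = \sum_(k < m) (F k + F (m + m - 1 - k)%N).
Proof.
rewrite big_split_ord big_split /=; congr (_ + _).
rewrite (reindex_inj rev_ord_inj) /=; apply: eq_bigr => i _; congr F.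
by have := ltn_ord i; lia.
Qed.

Lemma sum_inv_sin2 n : \sum_(k < 2 ^ n) (sin (odd_angle n k) ^+ 2)^-1 = 2 * 4 ^+ n.
Proof.
elim: n => [|n IH].
  rewrite expn0 big_ord1 /odd_angle mulr0 add0r mul1r !expr0 !mulr1.
  have pi0 := @pi_gt0 R.
  have s2 : sin (pi / 4 : R) ^+ 2 = 2^-1.
    have := cos2Dsin2 (pi / 4 : R).
    have -> : cos (pi / 4 : R) = sin (pi / 4).
      have e : pi / 4 = pi / 2 - pi / 4 :> R by field.
      by rewrite {1}e cosB cos_pihalf sin_pihalf mul0r add0r mul1r.
    lra.
  by rewrite s2 invrK.
rewrite expnS mul2n -addnn (sum_reflect (fun k => (sin (odd_angle n.+1 k) ^+ 2)^-1)).
rewrite exprS mulrCA -IH mulr_sumr; apply: eq_bigr => k _.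
have kn := ltn_ord k; rewrite -inv_sin2_half ?odd_angle_itv //.
have n0 : 0 < 2 ^+ n :> R by rewrite exprn_gt0.
have e1 : odd_angle n.+1 k = odd_angle n k / 2 by rewrite /odd_angle exprS; field; lra.
have e2 : odd_angle n.+1 (2 ^ n + 2 ^ n - 1 - k) = pi / 2 - odd_angle n k / 2.
  have -> : (2 ^ n + 2 ^ n - 1 - k = 2 * 2 ^ n - (k + 1))%N by lia.
  rewrite /odd_angle natrB; last by move: kn; lia.
  by rewrite natrM natrD natrX exprS; field; lra.
by rewrite e1 e2.
Qed.

Definition odd_sum m : R := \sum_(k < m) ((2 * k%:R + 1) ^+ 2)^-1.

(** By [x * cos x <= sin x <= x], each 1 / sin^2 x exceeds 1 / x^2 by at most 1. There are 2^n terms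
    against a total of order 4^n, so the relative error is of order 2^-n. *)
Lemma odd_sum_bounds n :
  pi ^+ 2 / 8 - pi ^+ 2 / (16 * 2 ^+ n) <= odd_sum (2 ^ n) <= pi ^+ 2 / 8.
Proof.
have pi0 := @pi_gt0 R; have n0 : 0 < 2 ^+ n :> R by rewrite exprn_gt0.
have B (k : 'I_(2 ^ n)) : (odd_angle n k ^+ 2)^-1 <= (sin (odd_angle n k) ^+ 2)^-1 <= (odd_angle n k ^+ 2)^-1 + 1.
  have := odd_angle_itv (ltn_ord k); move: (odd_angle n k) => x /andP[x0 xp].
  have /andP[h1 h2] := sin_bounds x0 xp.
  have s0 : 0 < sin x by apply: sin_gt0_pihalf; rewrite x0.
  have c0 : 0 < cos x by apply: cos_gt0_pihalf; lra.
  have x2 : 0 < x ^+ 2 by rewrite exprn_gt0.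
  have s2 : 0 < sin x ^+ 2 by rewrite exprn_gt0.
  apply/andP; split; first by rewrite lef_pV2 ?posrE // lerXn2r // nnegrE ltW.
  have -> : (x ^+ 2)^-1 + 1 = (1 + x ^+ 2) / x ^+ 2 by field; lra.
  rewrite ler_pdivlMr // ler_pdivrMl //.
  have : (x * cos x) ^+ 2 <= sin x ^+ 2 by rewrite lerXn2r // nnegrE ltW // mulr_gt0.
  rewrite exprMn; have := cos2Dsin2 x => /(congr1 (fun y => x ^+ 2 * y)); rewrite mulr1 mulrDr.
  lra.
have E : \sum_(k < 2 ^ n) (odd_angle n k ^+ 2)^-1 = 16 * 4 ^+ n / pi ^+ 2 * odd_sum (2 ^ n).
  rewrite /odd_sum mulr_sumr; apply: eq_bigr => k _.
  have k0 : 0 <= k%:R :> R by [].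
  have -> : 4 ^+ n = (2 ^+ n) ^+ 2 :> R by rewrite -exprM mulnC exprM; congr (_ ^+ _); ring.
  by rewrite /odd_angle; field; lra.
have U : 16 * 4 ^+ n / pi ^+ 2 * odd_sum (2 ^ n) <= 2 * 4 ^+ n.
  by rewrite -E -sum_inv_sin2; apply: ler_sum => k _; have /andP[] := B k.
have L : 2 * 4 ^+ n <= 16 * 4 ^+ n / pi ^+ 2 * odd_sum (2 ^ n) + 2 ^+ n.
  rewrite -E -sum_inv_sin2 -natrX -[X in _ <= _ + X]mul1r -[(2 ^ n)%:R in X in _ <= X]/((2 ^ n)%:R).
  have -> : (2 ^ n)%:R = \sum_(k < 2 ^ n) (1 : R) by rewrite sumr_const card_ord.
  by rewrite mul1r -big_split; apply: ler_sum => k _; have /andP[] := B k.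
have e4 : 4 ^+ n = 2 ^+ n * 2 ^+ n :> R by rewrite -exprMn; congr (_ ^+ _); ring.
rewrite e4 in U L; move: (2 ^+ n) n0 (odd_sum _) U L => t t0 o U L.
have p2 : 0 < pi ^+ 2 :> R by rewrite exprn_gt0.
move: (pi ^+ 2) p2 U L => q q0 U L.
have g0 : 0 <= q / (16 * (t * t)) by rewrite divr_ge0 ?mulr_ge0 // ltW.
have e8 : 2 * (t * t) * (q / (16 * (t * t))) = q / 8 by field; lra.
apply/andP; split.
- have h : o + q / (16 * t) = (16 * (t * t) / q * o + t) * (q / (16 * (t * t))) by field; lra.
  have := ler_wpM2r g0 L; rewrite -h e8; lra.
- have h : o = (16 * (t * t) / q * o) * (q / (16 * (t * t))) by field; lra.
  by have := ler_wpM2r g0 U; rewrite -h e8.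
Qed.

Lemma li2_partial_double m : li2_partial (m + m) (0 : R) = odd_sum m + li2_partial m 0 / 4.
Proof.
have E N : li2_partial N (0 : R) = \sum_(i < N) (i.+1%:R ^+ 2)^-1.
  by apply: eq_bigr => i _; rewrite mulr0 oppr0 expR0 div1r.
rewrite !E /odd_sum; elim: m => [|m IH]; first by rewrite !big_ord0 mul0r addr0.
rewrite addnS addSn !big_ord_recr /= IH.
have -> : (m + m).+1%:R = 2 * m%:R + 1 :> R by rewrite -natr1 natrD; ring.
have -> : (m + m).+2%:R = 2 * m.+1%:R :> R by rewrite -!natr1 natrD; ring.
have m0 : m.+1%:R != 0 :> R by rewrite pnatr_eq0.
have m1 : 2 * m%:R + 1 != 0 :> R by have : 0 <= m%:R :> R by []; lra.
move: (\sum_(i < m) _) (\sum_(i < m) _) (m.+1%:R) m0 m1 => u v y m0 m1.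
by field; rewrite m0 m1.
Qed.

(** The odd terms sum to [pi^2 / 8] and the even ones to a quarter of the whole. *)
Lemma li2_0 : li2 (0 : R) = pi ^+ 2 / 6.
Proof.
have up N : li2_partial N (0 : R) <= pi ^+ 2 / 8 + li2 0 / 4.
  have h : (N <= 2 ^ N + 2 ^ N)%N by have := ltn_expl N (ltnSn 1); lia.
  apply: (le_trans (li2_partial_mono 0 h)); rewrite li2_partial_double.
  have /andP[_ h2] := odd_sum_bounds N; have := li2_ub (2 ^ N) (lexx (0 : R)); lra.
have lo N : li2_partial N (0 : R) <= 4 * (li2 0 - pi ^+ 2 / 8).
  suff : pi ^+ 2 / 8 + li2_partial N 0 / 4 <= li2 (0 : R) by lra.
  apply: (@ler_archi _ _ _ (pi ^+ 2) N) => n Nn.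
  have Nn' : (N <= 2 ^ n)%N by have := ltn_expl n (ltnSn 1); lia.
  have := li2_ub (2 ^ n + 2 ^ n) (lexx (0 : R)); rewrite li2_partial_double.
  have /andP[h2 _] := odd_sum_bounds n; have h3 := li2_partial_mono (0 : R) Nn'.
  have : pi ^+ 2 / (16 * 2 ^+ n) <= pi ^+ 2 / n.+1%:R :> R.
    apply: ler_wpM2l; first exact: sqr_ge0.
    have h4 : n.+1%:R <= 2 ^+ n :> R by rewrite -natrX ler_nat ltn_expl.
    have h5 : 0 < n.+1%:R :> R by [].
    rewrite lef_pV2 ?posrE //; lra.
  move: (pi ^+ 2 / n.+1%:R) (pi ^+ 2 / (16 * 2 ^+ n)) h2 => a b; lra.
have h1 := li2_le up; have h2 := li2_le lo; lra.
Qed.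

End basel.

(** * The constant *)

Section limits.
Variable R : realType.
Implicit Types (x y s t z w a b c e h : R).

Let lam : R := pi ^+ 2 / 18.

Lemma gfun_le_inv z : 0 < z -> gfun z <= z^-1.
Proof. by move=> z0; exact: le_trans (gfun_le_bose z0) (bose_le z0). Qed.

Lemma dil_itv w : 0 < w -> - (2 * w)^-1 <= dil w <= 0.
Proof.
move=> w0; rewrite /dil.
have h1 := @li2_decr _ (2 * w) (3 * w) ltac:(lra) ltac:(lra).
have h2 := @li2_ge0 _ (3 * w) ltac:(lra).
have h3 := @li2_le_inv _ (2 * w) ltac:(lra).
have h4 := @li2_ge0 _ (2 * w) ltac:(lra).
move: ((2 * w)^-1) h3 => i h3; apply/andP; split; lra.
Qed.

(** [z * bose z] is at most twice the drop of [li2] over [[z / 2, z]], which is small by continuity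
    at 0. *)
Lemma mul_gfun_small e : 0 < e -> exists2 z0, 0 < z0 & forall z, 0 < z -> z <= z0 -> z * gfun z <= e.
Proof.
move=> e0; have [v v0 hv] := @li2_cvg0 R (e / 2) ltac:(lra).
exists v => // z z0 zv.
have h1 := @li2_diff_ge R (z / 2) z ltac:(lra) ltac:(lra).
have h2 := @li2_decr R 0 (z / 2) ltac:(lra) ltac:(lra).
have h3 := li2_decr (ltW z0) zv.
have h4 := ler_wpM2l (ltW z0) (gfun_le_bose z0); lra.
Qed.

Lemma gprim_small e : 0 < e ->
  exists2 z0, 0 < z0 & forall z, 0 < z -> z <= z0 -> - (z ^+ 2 / 2) <= gprim z <= e.
Proof.
move=> e0; have [z1 z10 H1] := @mul_gfun_small (e / 2) ltac:(lra).
have [z2 z20 H2] := @gfun_large R (1 + e^-1) ltac:(by rewrite addr_ge0 // invr_ge0 ltW).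
have ei : 0 < e^-1 by rewrite invr_gt0.
exists (Num.min 1 (Num.min z1 z2)); first by rewrite !lt_min ltr01 z10 z20.
move=> z z0; rewrite !le_min => /and3P[za zb zc].
have h1 := H1 z z0 zb; have h2 := H2 z z0 zc.
have w0 : 0 < gfun z - z by lra.
rewrite /gprim /hprim (ltW w0); have /andP[d1 d2] := dil_itv w0.
have z2' : 0 <= z ^+ 2 / 2 by rewrite divr_ge0 // sqr_ge0.
have h3 : (2 * (gfun z - z))^-1 <= e / 2.
  rewrite -[leRHS]invrK lef_pV2 ?posrE ?mulr_gt0 ?invr_gt0 ?divr_gt0 // invf_div.
  have : 2 / e = 2 * e^-1 by []; lra.
have h4 : 0 <= z * gfun z by rewrite mulr_ge0 // ltW // gfun_gt0.
apply/andP; split; lra.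
Qed.

Lemma gprim_mono z z' : 0 < z -> z <= z' -> gprim z <= gprim z'.
Proof.
move=> z0 zz'; have /andP[h _] := gprim_diff z0 zz'.
have : 0 <= (z' - z) * gfun z' by rewrite mulr_ge0 ?subr_ge0 // ltW // gfun_gt0 //; lra.
lra.
Qed.

Lemma gprim_ge0 z : 0 < z -> 0 <= gprim z.
Proof.
move=> z0; apply/ler_addgt0Pr => e e0.
have [z1 z10 H] := gprim_small e0.
pose y := Num.min (Num.min z 1) (Num.min z1 (2 * e)).
have y0 : 0 < y by rewrite !lt_min z0 ltr01 z10 mulr_gt0.
have yz : y <= z by rewrite /y !ge_min lexx.
have y1 : y <= 1 by rewrite /y !ge_min lexx orbT.
have yz1 : y <= z1 by rewrite /y !ge_min lexx !orbT.
have ye : y <= 2 * e by rewrite /y !ge_min lexx !orbT.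
have /andP[h _] := H y y0 yz1; have h2 := gprim_mono y0 yz.
have : y ^+ 2 <= y by rewrite expr2 ler_piMl // ltW.
lra.
Qed.

(** [lam] arises as [- 2 * dil 0], where [dil 0] is [1 / 3 - 1 / 2] times [pi^2 / 6]. The other two
    terms vanish as [z] grows. *)
Lemma gprim_largeE z : 2 <= z ->
  gprim z = gfun z ^+ 2 / 2 + lam + dil (z - gfun z).
Proof.
move=> z2; have z0 : 0 < z by lra.
have h : gfun z < z.
  apply: (le_lt_trans (gfun_le_inv z0)); apply: (@le_lt_trans _ _ 1); last lra.
  by rewrite invf_le1 //; lra.
rewrite /gprim /hprim; case: ifP => [|_]; first lra.
have -> : - (gfun z - z) = z - gfun z by ring.
have -> : dil 0 = - (pi ^+ 2 / 36) :> R by rewrite /dil !mulr0 li2_0; field.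
by rewrite /lam; field.
Qed.

Lemma gfun_large_le z : 2 <= z -> gfun z <= 2^-1.
Proof.
move=> z2; apply: (le_trans (gfun_le_inv _)); first lra.
by rewrite lef_pV2 ?posrE; lra.
Qed.

Lemma gprim_le z : 0 < z -> gprim z <= lam.
Proof.
move=> z0; apply/ler_addgt0Pr => e e0.
pose y := Num.max z (2 + e^-1).
have ei : 0 < e^-1 by rewrite invr_gt0.
have yz : z <= y by rewrite /y le_max lexx.
have ye : 2 + e^-1 <= y by rewrite /y le_max lexx orbT.
have y2 : 2 <= y by lra.
have h1 := gprim_mono z0 yz; have h2 := gfun_large_le y2.
have g0 := @gfun_gt0 _ y ltac:(lra).
have h3 := @gfun_le_inv y ltac:(lra).
have h4 : y^-1 <= e by rewrite -[leRHS]invrK lef_pV2 ?posrE //; lra.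
have /andP[_ h5] := @dil_itv (y - gfun y) ltac:(lra).
have h6 : gfun y ^+ 2 <= gfun y by rewrite expr2 ler_piMl; lra.
rewrite (gprim_largeE y2) in h1; lra.
Qed.

Lemma gprim_large e : 0 < e -> exists2 Z, 0 < Z & forall z, Z <= z -> lam - e <= gprim z.
Proof.
move=> e0; have ei : 0 < e^-1 by rewrite invr_gt0.
exists (2 + e^-1); first lra.
move=> z hz; have z2 : 2 <= z by lra.
rewrite (gprim_largeE z2); have h2 := gfun_large_le z2.
have g0 := @gfun_gt0 _ z ltac:(lra).
have /andP[h5 _] := @dil_itv (z - gfun z) ltac:(lra).
have h6 : (2 * (z - gfun z))^-1 <= e by rewrite -[leRHS]invrK lef_pV2 ?posrE //; lra.
have := sqr_ge0 (gfun z); lra.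
Qed.

Lemma gprim_total e : 0 < e -> exists a A, [/\ 0 < a, a < A &
  forall z, A <= z -> lam - e <= gprim z - gprim a].
Proof.
move=> e0; have [a a0 Ha] := @gprim_small (e / 2) ltac:(lra).
have [A A0 HA] := @gprim_large (e / 2) ltac:(lra).
exists a, (a + A); split => //; first lra.
move=> z hz; have := HA z ltac:(lra); have /andP[_] := Ha a a0 (lexx _); lra.
Qed.

Lemma gfun_first h : 0 < h -> h * gfun h <= gprim h.
Proof.
move=> h0; apply/ler_addgt0Pr => e e0.
have g0 := gfun_gt0 h0.
pose t := Num.min (h / 2) (e / gfun h).
have t0 : 0 < t by rewrite lt_min !divr_gt0.
have th : t <= h / 2 by rewrite /t ge_min lexx.
have te : t <= e / gfun h by rewrite /t ge_min lexx orbT.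
have /andP[h1 _] := @gprim_diff _ t h t0 ltac:(lra).
have h2 := gprim_ge0 t0.
have h3 : t * gfun h <= e by rewrite -ler_pdivlMr.
lra.
Qed.

Lemma sum_gfun_le h n : 0 < h -> \sum_(i < n) h * gfun (h * i.+1%:R) <= lam.
Proof.
move=> h0; case: n => [|n].
  by rewrite big_ord0 /lam divr_ge0 // sqr_ge0.
suff H : \sum_(i < n.+1) h * gfun (h * i.+1%:R) <= gprim (h * n.+1%:R).
  by apply: (le_trans H); apply: gprim_le; rewrite mulr_gt0.
elim: n => [|n IH]; first by rewrite big_ord1 mulr1; exact: gfun_first.
rewrite big_ord_recr /=; apply: (le_trans (lerD IH (lexx _))).
have hh : h * n.+2%:R = h * n.+1%:R + h by rewrite -[n.+2%:R]natr1; ring.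
have p0 : 0 < h * n.+1%:R by rewrite mulr_gt0.
have /andP[d _] := @gprim_diff _ (h * n.+1%:R) (h * n.+2%:R) p0 ltac:(rewrite hh; lra).
rewrite {1}hh in d.
have E : h * n.+1%:R + h - h * n.+1%:R = h by ring.
rewrite E in d; lra.
Qed.

Lemma sum_gfun_ge h a n : 0 < h -> 0 < a ->
  gprim (h * n%:R + a) - gprim a <= \sum_(i < n) h * gfun (h * i%:R + a).
Proof.
move=> h0 a0; elim: n => [|n IH]; first by rewrite big_ord0 mulr0 add0r subrr.
rewrite big_ord_recr /=; apply: le_trans (lerD IH (lexx _)).
have hh : h * n.+1%:R = h * n%:R + h by rewrite -[n.+1%:R]natr1; ring.
have p0 : 0 <= h * n%:R by rewrite mulr_ge0 // ltW.
rewrite hh.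
have /andP[_ d] := @gprim_diff _ (h * n%:R + a) (h * n%:R + h + a) ltac:(lra) ltac:(lra).
have E : h * n%:R + h + a - (h * n%:R + a) = h by ring.
rewrite E in d; lra.
Qed.

(** These terms are the losses 1 - exp (- q k), one per run of lines; their total is of order
    [1 / h]. *)
Lemma sum_bose_le h n : 0 < h -> \sum_(i < n) h * bose (h * i.+1%:R) <= 2.
Proof.
move=> h0; suff H : \sum_(i < n) h * bose (h * i.+1%:R) <= li2 0 - li2 (h * n%:R).
  apply: (le_trans H); have := @li2_ge0 R (h * n%:R); rewrite mulr_ge0 ?(ltW h0) // => /(_ isT).
  have : li2 (0 : R) <= 2 by apply: li2_le => N; exact: li2_partial_le2.
  lra.
elim: n => [|n IH]; first by rewrite big_ord0 mulr0 subrr.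
rewrite big_ord_recr /=; apply: (le_trans (lerD IH (lexx _))).
have hh : h * n.+1%:R = h * n%:R + h by rewrite -[n.+1%:R]natr1; ring.
have p0 : 0 <= h * n%:R by rewrite mulr_ge0 // ltW.
have := @li2_diff_ge R (h * n%:R) (h * n.+1%:R) p0 ltac:(rewrite hh; lra).
rewrite {1}hh (_ : h * n%:R + h - h * n%:R = h); last ring.
lra.
Qed.

End limits.

(** * Estimates for small p *)

Section small.
Variable K : realType.

Definition small (P : K -> Prop) := exists2 p0 : K, 0 < p0 & forall p, 0 < p -> p <= p0 -> P p.

Lemma small_and (P Q : K -> Prop) : small P -> small Q -> small (fun p => P p /\ Q p).
Proof.
move=> [a a0 Pa] [b b0 Qb]; exists (Num.min a b); first by rewrite lt_min a0 b0.
by move=> p p0; rewrite le_min => /andP[pa pb]; split; [exact: Pa|exact: Qb].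
Qed.

Lemma small_imp (P Q : K -> Prop) : (forall p, 0 < p -> P p -> Q p) -> small P -> small Q.
Proof. by move=> PQ [a a0 Pa]; exists a => // p p0 pa; apply: PQ => //; exact: Pa. Qed.

Lemma small_le (c : K) : 0 < c -> small (fun p => p <= c).
Proof. by move=> c0; exists c. Qed.

Lemma expR_pow_decay (k : nat) (c y : K) : 0 < c -> 0 < y ->
  y ^+ k * expR (- (c * y)) <= (k.+1)`!%:R / c ^+ k.+1 / y.
Proof.
move=> c0 y0; have cy : 0 < c * y by exact: mulr_gt0.
have := expR_ge1Dxn k (ltW cy); set f := (k.+1)`!%:R => h.
have f0 : 0 < f by rewrite ltr0n fact_gt0.
have {}h : (c * y) ^+ k.+1 / f <= expR (c * y) by lra.
rewrite expRN ler_pdivrMr ?expR_gt0 //.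
have c1 : 0 < c ^+ k.+1 by rewrite exprn_gt0.
have y1 : 0 < y ^+ k by rewrite exprn_gt0.
have e : y ^+ k = f / c ^+ k.+1 / y * ((c * y) ^+ k.+1 / f).
  by rewrite exprMn (exprS y); field; rewrite !gt_eqF // exprn_gt0.
rewrite {1}e ler_wpM2l // !divr_ge0 // ltW //; exact: exprn_gt0.
Qed.

Lemma small_inv (c : K) : 0 < c -> small (fun p => c <= p^-1).
Proof.
move=> c0; exists c^-1; first by rewrite invr_gt0.
by move=> p p0 pc; rewrite -(invrK c) lef_pV2 ?posrE ?invr_gt0.
Qed.

Lemma small_decay (k : nat) (c C e : K) : 0 < c -> 0 < e ->
  small (fun p => C * p^-1 ^+ k * expR (- (c / p)) <= e).
Proof.
move=> c0 e0; have f0 : 0 < (k.+1)`!%:R / c ^+ k.+1 :> K.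
  by rewrite divr_gt0 ?exprn_gt0 // ltr0n fact_gt0.
set f := _ / _ in f0.
have [C0|C0] := leP C 0.
  exists 1 => // p p0 _; apply: le_trans (ltW e0); rewrite -mulrA mulr_le0_ge0 //.
  by rewrite mulr_ge0 ?expR_ge0 // exprn_ge0 // invr_ge0 ltW.
exists (e / (C * f)); first by rewrite divr_gt0 // mulr_gt0.
move=> p p0 hp; have pi0 : 0 < p^-1 by rewrite invr_gt0.
have := expR_pow_decay k c0 pi0; rewrite -/f invrK => h.
rewrite -mulrA; apply: (le_trans (ler_wpM2l (ltW C0) h)).
by rewrite mulrA mulrC -ler_pdivlMr // mulr_gt0.
Qed.

End small.

Section rate.
Variable K : realType.
Implicit Type p : K.

Definition rate p : K := - ln (1 - p).

Lemma expR_rate p : p < 1 -> expR (- rate p) = 1 - p.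
Proof. by move=> p1; rewrite /rate opprK lnK // posrE subr_gt0. Qed.

Lemma expR_rateM p k : p < 1 -> (1 - p) ^+ k = expR (- (rate p * k%:R)).
Proof. by move=> p1; rewrite -expR_rate // -expRM_natr mulNr. Qed.

Lemma rate_ge p : p < 1 -> p <= rate p.
Proof. by move=> p1; have /andP[_] := @ln_ge1 K (1 - p) ltac:(lra); rewrite /rate; lra. Qed.

Lemma rate_le2 p : 0 <= p -> p <= 2^-1 -> rate p <= 2 * p.
Proof.
move=> p0 p2; have /andP[h _] := @ln_ge1 K (1 - p) ltac:(lra); rewrite /rate.
suff : (1 - p)^-1 <= 1 + 2 * p by lra.
rewrite -[leLHS]mul1r ler_pdivrMr; last lra.
have : 0 <= p * (1 - 2 * p) by rewrite mulr_ge0 //; lra.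
lra.
Qed.

(** Replacing [rate p] by [p] in an exponent of order [1 / p] thus costs only a bounded factor. *)
Lemma rate_inv p : 0 < p -> p <= 2^-1 -> p^-1 - 1 <= (rate p)^-1.
Proof.
move=> p0 p2; have /andP[h _] := @ln_ge1 K (1 - p) ltac:(lra).
have h2 : rate p <= p / (1 - p).
  have -> : p / (1 - p) = (1 - p)^-1 - 1 by field; lra.
  by rewrite /rate; lra.
have r0 : 0 < rate p by have := @rate_ge p ltac:(lra); lra.
have -> : p^-1 - 1 = (p / (1 - p))^-1 by field; lra.
by rewrite lef_pV2 ?posrE // divr_gt0 //; lra.
Qed.

Lemma occ_gap_root p (k : nat) (b : K) : 0 < p < 1 -> 0 < b ->
  gap_root (expR (- (rate p * k%:R))) <= b ->
  let u := 1 - (1 - p) ^+ k in u * b + u * (1 - u) <= b ^+ 2.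
Proof.
move=> /andP[p0 p1] b0 h; cbv zeta; rewrite expR_rateM //.
have r0 : 0 < rate p by have := rate_ge p1; lra.
move: h; rewrite gap_root_le //.
  by rewrite subKr [X in _ + X]mulrC.
by rewrite expR_ge0 -[leRHS]expR0 ler_expR oppr_le0 mulr_ge0 // ltW.
Qed.

(** Only the lines across the longer side are examined: in a spanned rectangle no two adjacent ones
    are empty. *)
Lemma PrSpan_cols p (s : seq Site) (R : rect) (b : K) : 0 <= p <= 1 ->
  valid R -> {subset rsites R <= s} -> 0 < b <= 1 ->
  (let u := 1 - (1 - p) ^+ minn (width R) (height R) in u * b + u * (1 - u) <= b ^+ 2) ->
  PrSpan p s R <= b^-1 * b ^+ long R.
Proof.
move=> p01 vR Rs b01 ub.
have szw : size (zseq (lft R) (rgt R)) = width R.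
  by move: vR; rewrite /valid /width => /andP[v _]; rewrite size_zseq; clear -v; lia.
have szh : size (zseq (bot R) (top R)) = height R.
  by move: vR; rewrite /valid /height => /andP[_ v]; rewrite size_zseq; clear -v; lia.
rewrite /long; have [wh|hw] := leqP (width R) (height R).
- rewrite (minn_idPl wh) in ub.
  pose L := [seq (false, rows j (lft R) (rgt R)) | j <- zseq (bot R) (top R)].
  have EL : sites L = flatten [seq rows j (lft R) (rgt R) | j <- zseq (bot R) (top R)].
    by rewrite /sites /L -map_comp.
  apply: (@le_trans _ _ (Ex p s (fun w => (sorted orb [seq occ w x | x <- L])%:R) (fun=> false))).
    apply: ler_Ex => // w; rewrite ler_nat; case: asboolP => // sR.
    have [_ [h _ _]] := Span_cov (Span_restrict sR).
    rewrite (_ : sorted _ _) // /L -map_comp.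
    apply: (sorted_zseq (f := fun j => has w (rows j (lft R) (rgt R)))) => i a c.
    have [z /andP[wz Rz] hz] := h i a c isT isT.
    move: hz Rz; rewrite /inR => /orP[hz|hz] /andP[h1 h2]; apply/orP; [left|right];
      by apply/hasP; exists z => //; rewrite mem_rows hz.
  apply: le_trans (Ex_sorted_le p01 (h := width R) (b := b) _ b01 ub _ _ _) _.
  + by move=> x /mapP[j _ ->] _; rewrite size_map szw.
  + rewrite EL; have := allpairs_uniq (f := fun y x => (x, y)) (uniq_zseq (bot R) (top R)) (uniq_zseq (lft R) (rgt R)).
    by apply; move=> [? ?] [? ?] _ _ [-> ->].
  + move=> z; rewrite EL => /flattenP[l /mapP[j jR ->]]; rewrite mem_rows => /andP[/eqP zj zz].
    by apply: Rs; rewrite mem_rsites /inR zz zj -mem_zseq.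
  + by rewrite big_map /= big_const_seq count_predT szh -/(b ^+ _) iter_mulr_1.
- rewrite (minn_idPr (ltnW hw)) in ub.
  pose L := [seq (false, cols j (bot R) (top R)) | j <- zseq (lft R) (rgt R)].
  have EL : sites L = flatten [seq cols j (bot R) (top R) | j <- zseq (lft R) (rgt R)].
    by rewrite /sites /L -map_comp.
  apply: (@le_trans _ _ (Ex p s (fun w => (sorted orb [seq occ w x | x <- L])%:R) (fun=> false))).
    apply: ler_Ex => // w; rewrite ler_nat; case: asboolP => // sR.
    have [[h _ _] _] := Span_cov (Span_restrict sR).
    rewrite (_ : sorted _ _) // /L -map_comp.
    apply: (sorted_zseq (f := fun j => has w (cols j (bot R) (top R)))) => i a c.
    have [z /andP[wz Rz] hz] := h i a c isT isT.
    move: hz Rz; rewrite /inR => /orP[hz|hz] /andP[h1 h2]; apply/orP; [left|right];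
      by apply/hasP; exists z => //; rewrite mem_cols hz.
  apply: le_trans (Ex_sorted_le p01 (h := height R) (b := b) _ b01 ub _ _ _) _.
  + by move=> x /mapP[j _ ->] _; rewrite size_map szh.
  + rewrite EL; have := allpairs_uniq (f := pair) (uniq_zseq (lft R) (rgt R)) (uniq_zseq (bot R) (top R)).
    by apply; move=> [? ?] [? ?] _ _ [-> ->].
  + move=> z; rewrite EL => /flattenP[l /mapP[j jR ->]]; rewrite mem_cols => /andP[/eqP zj zz].
    by apply: Rs; rewrite mem_rsites /inR zz zj -mem_zseq jR.
  + by rewrite big_map /= big_const_seq count_predT szw -/(b ^+ _) iter_mulr_1.
Qed.

Lemma PrSpan_short p (s : seq Site) (R : rect) (m : K) : 0 < p <= 2^-1 ->
  valid R -> {subset rsites R <= s} -> 0 <= m -> 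
  m <= gfun (rate p * (minn (width R) (height R))%:R) ->
  PrSpan p s R <= expR m * expR (- (m * (long R)%:R)).
Proof.
move=> /andP[p0 p2] vR Rs m0 mg.
have r0 : 0 < rate p by have := @rate_ge p ltac:(lra); lra.
have a0 : 0 < (minn (width R) (height R))%:R :> K.
  by rewrite ltr0n; move: vR; clear; rewrite /valid /width /height; rlia.
have b01 : 0 < expR (- m) <= 1 by rewrite expR_gt0 -[leRHS]expR0 ler_expR oppr_le0.
apply: le_trans (PrSpan_cols _ vR Rs b01 _) _.
- by apply/andP; split; lra.
- apply: occ_gap_root; [lra|by have /andP[] := b01|].
  by rewrite -expR_gfun ?mulr_gt0 // ler_expR lerN2.
- by rewrite -expRM_natr mulNr -expRN opprK.
Qed.

End rate.

Section subcritical.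
Variable K : realType.
Implicit Type p : K.

(** The shift bounds all weights by [gfun eta], also at [k = 0], where g itself would be infinite.
    As g decreases, the shifted exponent is smaller and still meets the inequality required of
    [b]. *)
Definition gwt (eta q : K) (k : nat) : K := gfun (q * k%:R + eta).

Section weights.
Variables (eta q : K).
Hypotheses (eta0 : 0 < eta) (q0 : 0 < q).

Let arg_gt0 (k : nat) : 0 < q * k%:R + eta.
Proof. by rewrite ltr_wpDl // mulr_ge0 // ltW. Qed.

Lemma gwt_gt0 k : 0 < gwt eta q k.
Proof. exact: gfun_gt0. Qed.

Lemma gwt_le k : gwt eta q k <= gfun eta.
Proof. by apply: gfun_decr => //; rewrite lerDr mulr_ge0 // ltW. Qed.

Lemma gwt_decr k : gwt eta q k.+1 <= gwt eta q k.
Proof. by apply: gfun_decr => //; rewrite lerD2r ler_pM2l // ler_nat. Qed.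

Lemma gwt_cvx k : 2 * gwt eta q k.+1 <= gwt eta q k + gwt eta q k.+2.
Proof.
have := gfun_midpoint (arg_gt0 k) (arg_gt0 k.+2); rewrite /gwt.
by rewrite (_ : (q * k%:R + eta + (q * k.+2%:R + eta)) / 2 = q * k.+1%:R + eta) // -!natr1; field.
Qed.

Lemma diag_costE (g : nat -> K) n : diag_cost g n = 2 * \sum_(k < n) g k - g 0%N + g n.
Proof.
elim: n => [|n IH]; first by rewrite /diag_cost !big_ord0; ring.
by rewrite /diag_cost big_ord_recr /= -/(diag_cost g n) IH big_ord_recr /=; ring.
Qed.

(** If the shorter side reaches [A / q], the diagonal part alone costs [2 * c1 / q] up to
    [gfun eta]. Otherwise every straight step costs at least [gfun (A + eta)], and [b] is large
    enough to supply sufficiently many of them. *)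
Lemma cost_lower (A c1 : K) (a b : nat) : 0 < A -> 0 < c1 ->
  (forall z, A <= z -> c1 <= gprim z - gprim eta) -> (a <= b)%N ->
  (A + 2 * c1 / gfun (A + eta)) / q <= b%:R ->
  2 * c1 / q - gfun eta <= cost (gwt eta q) a b.
Proof.
move=> A0 c0 H ab hb; have e0 := eta0; have r0 := q0.
have d0 n : 0 <= diag_cost (gwt eta q) n.
  by apply: sumr_ge0 => i _; rewrite addr_ge0 // ltW // gwt_gt0.
have g0 : 0 < gfun eta by exact: gfun_gt0.
have mE : minn a b = a by exact/minn_idPl.
have ME : maxn a b = b by exact/maxn_idPr.
rewrite /cost mE ME.
have [Aa|aA] := leP A (q * a%:R).
- have h3 : 0 <= (b - a)%:R * gwt eta q a by rewrite mulr_ge0 // ltW // gwt_gt0.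
  have h2 := sum_gfun_ge a q0 eta0.
  rewrite -mulr_sumr in h2; rewrite diag_costE.
  have h1 := H (q * a%:R + eta) ltac:(lra).
  have {}h2 : c1 <= q * \sum_(k < a) gwt eta q k by exact: le_trans h1 h2.
  move: (\sum_(k < a) _) h2 => s h2.
  have h4 : c1 / q <= s by rewrite ler_pdivrMr // mulrC.
  have h5 := gwt_le 0; have h6 := gwt_gt0 a.
  have -> : 2 * c1 / q = 2 * (c1 / q) by rewrite mulrA.
  move: (c1 / q) h4 => x h4; clear -h4 h5 h6 h3; lra.
- have gA : 0 < gfun (A + eta) by apply: gfun_gt0; lra.
  have h1 : gfun (A + eta) <= gwt eta q a by apply: gfun_decr => //; lra.
  have h2 : a%:R <= A / q by rewrite ler_pdivlMr // mulrC ltW.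
  have h3 : 2 * c1 / gfun (A + eta) / q <= (b - a)%:R.
    by rewrite natrB //; move: hb; rewrite mulrDl; lra.
  have h4 : 2 * c1 / q <= (b - a)%:R * gwt eta q a.
    have -> : 2 * c1 / q = 2 * c1 / gfun (A + eta) / q * gfun (A + eta) by field; rewrite !gt_eqF.
    apply: ler_pM => //; last exact: ltW.
    by rewrite !divr_ge0 ?mulr_ge0 // ltW.
  have := d0 a; clear -h4 g0; lra.
Qed.

End weights.

Lemma gwt_occ (eta p : K) : 0 < eta -> 0 < p < 1 -> forall k : nat,
  let u := 1 - (1 - p) ^+ k in let b := expR (- gwt eta (rate p) k) in
  u * b + u * (1 - u) <= b ^+ 2.
Proof.
move=> eta0 p01 k; have [p0 p1] := andP p01.
have r0 : 0 < rate p by have := rate_ge p1; lra.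
apply: occ_gap_root => //; first exact: expR_gt0.
have rk : 0 <= rate p * k%:R by rewrite mulr_ge0 // ltW.
rewrite /gwt expR_gfun; last lra.
apply: gap_root_decr; rewrite ?expR_ge0 //.
- by rewrite -[ltRHS]expR0 ltr_expR; lra.
- by rewrite ler_expR; lra.
- by rewrite -[leRHS]expR0 ler_expR; lra.
Qed.

(** All sizes are of order [1 / q], so the number [d] of levels depends on the constants only. *)
Lemma subcrit_sizes (p B del c0 : K) : 0 < p -> p <= 2^-1 -> p <= del / 4 -> p <= c0 / 12 ->
  0 < del -> del <= c0 / 2 -> 1 <= B ->
  let q := rate p in let N := (2 * (Num.truncn (B / q)).+1)%N in
  let T := Num.truncn (del / q) in let phi0 := Num.truncn (c0 / q) in
  let d := (Num.truncn (4 * (2 * B + 2) / del)).+1 in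
  [/\ N%:R <= (2 * B + 2) / q, T%:R <= del / q, phi0%:R <= c0 / q &
    [/\ (0 < T)%N, (T + 2 <= phi0)%N & (N + N <= d * T)%N]].
Proof.
move=> p0 p2 pd pc del0 dc B1 q N T phi0 d.
have pq : p <= q by apply: rate_ge; lra.
have q2 : q <= 2 * p by apply: rate_le2; lra.
have q0 : 0 < q by lra.
have q1 : q <= 1 by lra.
have Bq0 : 0 <= B / q by rewrite divr_ge0 //; lra.
have NB : N%:R <= (2 * B + 2) / q.
  have h : (Num.truncn (B / q)).+1%:R <= B / q + 1 by rewrite -natr1 lerD2r truncn_le.
  rewrite /N natrM (_ : (2 * B + 2) / q = 2 * (B / q) + 2 / q); last by rewrite mulrDl mulrA.
  have : 2 <= 2 / q by rewrite ler_pdivlMr //; lra.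
  move: (B / q) (2 / q) h => x y h; lra.
have dq2 : 2 <= del / q by rewrite ler_pdivlMr //; lra.
have cq6 : 6 <= c0 / q by rewrite ler_pdivlMr //; lra.
have dcq : del / q <= c0 / q / 2 by rewrite mulrAC ler_pM2r ?invr_gt0.
have TU : T%:R <= del / q by rewrite truncn_le; lra.
have TL : del / q < T%:R + 1 by rewrite natr1 truncnS_gt.
have PU : phi0%:R <= c0 / q by rewrite truncn_le; lra.
have PL : c0 / q < phi0%:R + 1 by rewrite natr1 truncnS_gt.
have B20 : 0 < 2 * B + 2 by lra.
have dT : 2 * ((2 * B + 2) / q) <= d%:R * T%:R.
  have h1 : 4 * (2 * B + 2) / del <= d%:R by rewrite ltW // truncnS_gt.
  have h2 : del / q / 2 <= T%:R by lra.
  have -> : 2 * ((2 * B + 2) / q) = 4 * (2 * B + 2) / del * (del / q / 2) by field; rewrite !gt_eqF.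
  by apply: ler_pM => //; rewrite !divr_ge0 ?mulr_ge0 // ltW.
split=> //; split.
- by rewrite -(ltr_nat K); lra.
- by rewrite -ltnS -(ltr_nat K) -natr1 natrD; lra.
- by rewrite -(ler_nat K) natrD natrM; lra.
Qed.

Lemma PrSpan_recursion (p eta rho c0 : K) (s : seq Site) (N T phi0 d : nat) R :
  0 < p -> p <= 2^-1 -> 0 < eta -> 0 < rho -> rho < 1 ->
  (forall z, 0 < z -> z <= c0 -> 2 * gfun eta <= gfun z) ->
  p * expR (4 * gfun eta) * T%:R <= (1 - rho) * gwt eta (rate p) N ->
  phi0%:R <= c0 / rate p -> (0 < T)%N -> (T + 2 <= phi0)%N -> (0 < N)%N ->
  valid R -> {subset rsites R <= s} -> (width R <= N)%N -> (height R <= N)%N ->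
  (phi R <= phi0 + d * T)%N ->
  PrSpan p s R <= (expR (6 * gfun eta) * (N ^ 8)%:R) ^+ (2 ^ d.+1 - 1) *
    expR (- rho * cost (gwt eta (rate p)) (width R) (height R)).
Proof.
move=> p0 p2 eta0 rho0 rho1 Hc0 err PU T1 Tphi N1 vR Rs lw lh hphi.
set M := gfun eta in Hc0 err *; set q := rate p in PU err *.
have M0 : 0 < M by exact: gfun_gt0.
have q0 : 0 < q.
  by have := @rate_ge _ p ltac:(clear -p2; lra); rewrite -/q; clear -p0; lra.
have e6 : 1 <= expR (6 * M) by rewrite -[leLHS]expR0 ler_expR mulr_ge0 // ltW.
have n8 : 1 <= (N ^ 8)%:R :> K by rewrite ler1n expn_gt0 N1.
have rho01 : 0 <= rho <= 1 by rewrite !ltW.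
have p01 : 0 < p < 1 by rewrite p0 /=; clear -p2; lra.
pose gam := gwt eta q.
have gle0 k : 0 <= gam k by rewrite ltW // gwt_gt0.
have gleM k : gam k <= M by exact: gwt_le.
(* Below [phi0] the bound from one direction decays at rate [2 * M] per unit of the long side, while
   the cost is at most [M] times width plus height, hence at most [2 * M] times the long side. *)
have base R' : valid R' -> {subset rsites R' <= s} -> (phi R' <= phi0)%N ->
    PrSpan p s R' <= expR (6 * M) * (N ^ 8)%:R * expR (- rho * cost gam (width R') (height R')).
  move=> vR' Rs' hphi'.
  have short : (minn (width R') (height R'))%:R <= c0 / q.
    by apply: le_trans PU; rewrite ler_nat (leq_trans _ hphi') // /phi (leq_trans (geq_minl _ _)) // leq_addr.
  have wpos : 0 < (minn (width R') (height R'))%:R :> K.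
    by rewrite ltr0n; move: vR'; clear; rewrite /valid /width /height; rlia.
  have hg : 2 * M <= gfun (rate p * (minn (width R') (height R'))%:R).
    by apply: Hc0; [rewrite mulr_gt0|rewrite mulrC -ler_pdivlMr].
  apply: (le_trans (PrSpan_short _ vR' Rs' _ hg)); [by rewrite p0|by rewrite mulr_ge0 // ltW|].
  apply: ler_pM; rewrite ?expR_ge0 //.
    rewrite -[leLHS]mulr1; apply: ler_pM; rewrite ?expR_ge0 //.
    by rewrite ler_expR; clear -M0; lra.
  rewrite ler_expR mulNr lerN2.
  have h1 := cost_le gle0 gleM (width R') (height R').
  have h0 : 0 <= cost gam (width R') (height R') by exact: cost_ge0.
  have h2 : (width R' + height R')%:R <= 2 * (long R')%:R :> K.
    by rewrite -natrM ler_nat /long mul2n -addnn leq_add ?leq_maxl ?leq_maxr.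
  have h3 := ler_wpM2r (ltW M0) h2.
  have h4 : rho * cost gam (width R') (height R') <= cost gam (width R') (height R') by rewrite ler_piMl // ltW.
  by apply: (le_trans h4); apply: (le_trans h1); apply: (le_trans h3); rewrite mulrAC.
apply: (@PrSpan_le K p gam M rho p0 p2 gle0 gleM (gwt_decr eta0 q0) (gwt_cvx eta0 q0) (gwt_occ eta0 p01)
   rho01 s N T phi0 _ err T1 Tphi (lexx _) _ base) => //.
by rewrite -[leLHS]mul1r; apply: ler_pM.
Qed.

(** The gap between [c3] and [c1] pays for [rho = c3 / c1]; the gap between [c1] and [pi ^+ 2 / 18]
    pays for the cutoffs [eta] and [A] of the area under g. *)
Lemma subcrit_rect (c1 c3 : K) : 0 < c3 -> c3 < c1 -> c1 < pi ^+ 2 / 18 ->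
  exists B C k, [/\ 1 <= B, 0 <= C & small (fun p => forall s R, valid R -> {subset rsites R <= s} ->
    let m1 := (Num.truncn (B / rate p)).+1 in
    (m1 <= long R <= 2 * m1)%N -> PrSpan p s R <= C * p^-1 ^+ k * expR (- (2 * c3 / p)))].
Proof.
move=> c30 c31 c1lam; have c10 : 0 < c1 by lra.
have [eta [A [eta0 etaA HA]]] := @gprim_total K (pi ^+ 2 / 18 - c1) ltac:(lra).
have {}HA z : A <= z -> c1 <= gprim z - gprim eta by move=> /HA; clear; lra.
have A0 : 0 < A by lra.
pose M := gfun eta; have M0 : 0 < M by exact: gfun_gt0.
have gA : 0 < gfun (A + eta) by apply: gfun_gt0; clear -A0 eta0; lra.
pose B := A + 2 * c1 / gfun (A + eta) + 1.
have B1 : 1 <= B.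
  have h : 0 < 2 * c1 / gfun (A + eta) by rewrite divr_gt0 // mulr_gt0.
  rewrite /B; clear -h A0; lra.
pose B2 := 2 * B + 2.
have B20 : 0 < B2 by rewrite /B2; clear -B1; lra.
pose gm := gfun (B2 + eta).
have gm0 : 0 < gm by apply: gfun_gt0; clear -B20 eta0; lra.
pose rho := c3 / c1.
have rho0 : 0 < rho by exact: divr_gt0.
have rho1 : rho < 1 by rewrite ltr_pdivrMr // mul1r.
have [c0 c00 Hc0] := @gfun_large K (2 * M) ltac:(clear -M0; lra).
pose K4 := expR (4 * M); have K40 : 0 < K4 by exact: expR_gt0.
(* The first bound keeps the corner error below [(1 - rho) * gm], where [gm] is a lower bound for
   the weights at all sizes considered; the second keeps [T] below [phi0]. *)
pose del := Num.min ((1 - rho) * gm / K4) (c0 / 2).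
have del0 : 0 < del.
  by rewrite lt_min !divr_gt0 // mulr_gt0 // subr_gt0.
have dc : del <= c0 / 2 by rewrite /del ge_min lexx orbT.
have dK : K4 * del <= (1 - rho) * gm by rewrite mulrC -ler_pdivlMr // /del ge_min lexx.
pose d := (Num.truncn (4 * B2 / del)).+1.
pose e := (2 ^ d.+1 - 1)%N.
exists B, (expR (M + 2 * c3) * (expR (6 * M) * B2 ^+ 8) ^+ e), (8 * e)%N.
split => //.
  by rewrite mulr_ge0 ?expR_ge0 // exprn_ge0 // mulr_ge0 ?expR_ge0 // exprn_ge0 // ltW.
have S1 := @small_le K 2^-1 ltac:(clear; lra).
have S2 := @small_le K (del / 4) ltac:(clear -del0; lra).
have S3 := @small_le K (c0 / 12) ltac:(clear -c00; lra).
apply: small_imp (small_and S1 (small_and S2 S3)) => p p0 [p2 [pd pc]] s R vR Rs m1 /andP[lo hi].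
have := subcrit_sizes p0 p2 pd pc del0 dc B1; cbv zeta.
rewrite -/m1 -/B2 -/d; set q := rate p in m1 lo hi *; set N := (2 * m1)%N in hi *.
set T := Num.truncn (del / q); set phi0 := Num.truncn (c0 / q) => -[NB TU PU [T1 Tphi NT]].
have pq : p <= q by apply: rate_ge; clear -p2; lra.
have q0 : 0 < q by exact: lt_le_trans pq.
pose gam := gwt eta q.
have gN : gm <= gam N.
  apply: gfun_decr; first by rewrite ltr_wpDl // mulr_ge0 // ltW.
  by rewrite lerD2r mulrC -ler_pdivlMr.
have err : p * expR (4 * M) * T%:R <= (1 - rho) * gam N.
  apply: (@le_trans _ _ ((1 - rho) * gm)); last by apply: ler_wpM2l => //; rewrite subr_ge0 ltW.
  apply: le_trans dK; rewrite -/K4 mulrAC mulrC; apply: ler_wpM2l; first exact: ltW.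
  apply: (@le_trans _ _ (q * (del / q))).
    by apply: ler_pM => //; exact: ltW.
  by rewrite mulrC divfK // gt_eqF.
have N1 : (0 < N)%N by rewrite /N muln_gt0.
have lw : (width R <= N)%N by rewrite (leq_trans _ hi) // leq_maxl.
have lh : (height R <= N)%N by rewrite (leq_trans _ hi) // leq_maxr.
have hphi : (phi R <= phi0 + d * T)%N.
  apply: (@leq_trans (N + N)); first exact: leq_add.
  by apply: leq_trans (leq_addl _ _).
have main := @PrSpan_recursion p eta rho c0 s N T phi0 d R p0 p2 eta0 rho0 rho1 Hc0 err PU T1 Tphi N1 vR Rs lw lh hphi.
apply: (le_trans main).
have lb : 2 * c1 / q - M <= cost gam (width R) (height R).
  have hl : (A + 2 * c1 / gfun (A + eta)) / q <= (long R)%:R.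
    apply: (@le_trans _ _ (B / q)); first by rewrite ler_pM2r ?invr_gt0 // /B lerDl.
    by apply: le_trans (ltW (truncnS_gt _)) _; rewrite ler_nat.
  move: hl; rewrite /long; have [wh|/ltnW hw] := leqP (width R) (height R) => hl.
    exact: cost_lower hl.
  by rewrite costC; apply: cost_lower hl.
have e1 : expR (- rho * cost gam (width R) (height R)) <= expR (M + 2 * c3) * expR (- (2 * c3 / p)).
  rewrite -expRD ler_expR.
  have h1 := ler_wpM2l (ltW rho0) lb.
  have h2 : rho * (2 * c1 / q) = 2 * c3 * q^-1 by rewrite /rho; field; rewrite !gt_eqF.
  have h3 := @ler_wpM2l _ (2 * c3) ltac:(clear -c30; lra) _ _ (rate_inv p0 p2); rewrite -/q in h3.
  have h4 : rho * M <= M by rewrite ler_piMl // ltW.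
  rewrite mulrBr h2 in h1; move: h1 h3 h4; rewrite mulNr.
  move: (q^-1) (p^-1) (rho * _) (rho * M) => x y u v; clear; lra.
have e2 : (expR (6 * M) * (N ^ 8)%:R) ^+ e <= (expR (6 * M) * B2 ^+ 8) ^+ e * p^-1 ^+ (8 * e).
  rewrite exprM -exprMn -mulrA -exprMn; have B2p : 0 <= B2 * p^-1 by rewrite mulr_ge0 ?invr_ge0 // ltW.
  apply: lerXn2r; rewrite ?nnegrE.
  - by apply: mulr_ge0; [exact: expR_ge0|].
  - by apply: mulr_ge0; [exact: expR_ge0|exact: exprn_ge0].
  apply: ler_wpM2l; first exact: expR_ge0.
  rewrite natrX; apply: lerXn2r; rewrite ?nnegrE //.
  apply: (le_trans NB); apply: ler_wpM2l; first exact: ltW.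
  by rewrite lef_pV2 ?posrE.
have Qe0 : 0 <= (expR (6 * M) * (N ^ 8)%:R) ^+ e by rewrite exprn_ge0 // mulr_ge0 // expR_ge0.
apply: (le_trans (ler_pM Qe0 (expR_ge0 _) e2 e1)).
have re (a b x y : K) : a * b * (x * y) <= x * a * b * y.
  by rewrite le_eqVlt; apply/orP; left; apply/eqP; clear; ring.
exact: re.
Qed.

End subcritical.

(** * Subcritical times *)

Lemma Pr_or (K : realType) (T : eqType) (p : K) (s : seq T) (A B : (T -> bool) -> bool) : 0 <= p <= 1 ->
  Pr p s (fun w => A w || B w) <= Pr p s A + Pr p s B.
Proof.
move=> p01; rewrite /Pr -ExD; apply: ler_Ex => // w.
by rewrite -natrD ler_nat; case: (A w); case: (B w).
Qed.


(** * From the activity of the origin to spanned rectangles *)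

Section origin.
Implicit Types (w : Site -> bool) (R S : rect) (z : Site).

Lemma Span_sub w R S : (forall z, w z -> inR S z) -> Span w R -> subR R S.
Proof.
move=> + h; elim: h => {w R} [w x wx|w w1 w2 R1 R2 h1 h2 _ _ IH1 _ IH2 _] wS.
  by move: (wS _ wx); rewrite /inR /subR /=; rlia.
move: (IH1 (fun z h => wS z (h1 z h))) (IH2 (fun z h => wS z (h2 z h))).
by rewrite /subR /join /=; rlia.
Qed.

Lemma Span_mem w R : Span w R -> exists2 z, w z & inR R z.
Proof.
elim=> {w R} [w x wx|w w1 w2 R1 R2 h1 _ _ _ [z wz zR] _ _ _].
  by exists x => //; rewrite /inR /= !lexx.
by exists z; [exact: h1|apply: subR_inR zR; exact: subR_joinl].
Qed.

Definition small_rects (t m : nat) : seq rect :=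
  [seq Rect z.1 (z.1 + d.1%:Z) z.2 (z.2 + d.2%:Z) | z <- rsites (ball t),
    d <- [seq (i, j) | i <- iota 0 m, j <- iota 0 m]].

Lemma size_ball t : size (rsites (ball t)) = ((2 * t + 1) ^ 2)%N.
Proof. rewrite size_allpairs !size_zseq /=; lia. Qed.

Lemma size_small_rects t m : size (small_rects t m) = ((2 * t + 1) ^ 2 * m ^ 2)%N.
Proof. by rewrite size_allpairs size_ball size_allpairs size_iota. Qed.

Lemma mem_small_rects t m R : valid R -> subR R (ball t) -> (long R <= m)%N -> R \in small_rects t m.
Proof.
move=> vR sR lR; apply/allpairsP.
exists ((lft R, bot R), ((width R).-1, (height R).-1)); split => /=.
- by rewrite mem_rsites; move: vR sR {lR}; rewrite /valid /subR /inR /ball; rlia.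
- apply/allpairsP; exists ((width R).-1, (height R).-1); rewrite !mem_iota; split => //=.
  + by move: vR lR {sR}; rewrite /valid /long /width /height; rlia.
  + by move: vR lR {sR}; rewrite /valid /long /width /height; rlia.
- by move: vR {sR lR}; rewrite /valid /width /height; case: R => -[a b] [c d] /= h; congr (_, _, (_, _)); lia.
Qed.

(** The spanned rectangle around the origin is classified by its long side. Below [m1] it lies in
    [ball m1], so the union bound is polynomial in [m1]; only rectangles of scale [m1] have to be
    sought in all of [ball t]. *)
Lemma act_origin_cases w t m0 m1 : (0 < m0)%N -> (0 < m1)%N -> act w t (0, 0) ->
  [\/ exists2 z, z \in rsites (ball m0) & w z && inR (ball t) z,
      exists2 R, R \in subrects (ball m1) & Span w R /\ subR R (ball t) && (m0 <= long R <= 2 * m0)%N |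
      exists2 R, R \in small_rects t (2 * m1) & Span w R /\ subR R (ball t) && (m1 <= long R <= 2 * m1)%N].
Proof.
move=> m00 m10 /act_Span[R []].
set w' := (fun z => _ && _) => sR R0.
have w't z : w' z -> inR (ball t) z.
  case/andP=> _ /mapP[[a b]]; rewrite mem_rsites => h ->.
  by rewrite (_ : (a, b) + (0, 0) = (a, b)) //; congr (_, _) => /=; rewrite addr0.
have w'w z : w' z -> w z by case/andP.
have vR := Span_valid sR.
have [l0|l0] := ltnP (long R) m0.
  have [z wz zR] := Span_mem sR; apply: Or31; exists z; last by rewrite w'w // w't.
  by rewrite mem_rsites; move: R0 zR l0 {vR sR}; rewrite /inR /ball /long /width /height; rlia.
have [l1|l1] := ltnP (long R) m1.
  have [R' [sR' R'R lR']] := Span_scale m00 sR l0.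
  apply: Or32; exists R'; last by rewrite (Span_sub w't sR') lR'; split => //; exact: Span_inc sR'.
  apply: mem_subrects; first exact: Span_valid sR'.
  apply: subR_trans R'R _.
  by move: R0 l1 {vR sR}; rewrite /inR /subR /ball /long /width /height; rlia.
have [R' [sR' R'R lR']] := Span_scale m10 sR l1.
apply: Or33; exists R'; last by rewrite (Span_sub w't sR') lR'; split => //; exact: Span_inc sR'.
by apply: mem_small_rects; [exact: Span_valid sR'|exact: Span_sub sR'|case/andP: lR'].
Qed.

Section upper.
Variable K : realType.
Implicit Type p : K.

Lemma sum_le_size (T : eqType) (r : seq T) (F : T -> K) (c : K) : 
  (forall x, x \in r -> F x <= c) -> \sum_(x <- r) F x <= (size r)%:R * c.
Proof.
move=> H; rewrite mulrC; apply: (@le_trans _ _ (\sum_(x <- r) c)).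
  by rewrite big_seq [leRHS]big_seq; apply: ler_sum.
by rewrite big_const_seq count_predT iter_addr_0 mulr_natr.
Qed.

Lemma Pr_origin_le p t m0 m1 (c0 c1 : K) : 0 <= p <= 1 -> (0 < m0)%N -> (0 < m1)%N ->
  0 <= c0 -> 0 <= c1 ->
  (forall R, valid R -> subR R (ball t) -> (m0 <= long R <= 2 * m0)%N ->
     PrSpan p (rsites (ball t)) R <= c0) ->
  (forall R, valid R -> subR R (ball t) -> (m1 <= long R <= 2 * m1)%N ->
     PrSpan p (rsites (ball t)) R <= c1) ->
  Pr p (rsites (ball t)) (fun w => `[< act w t (0, 0) >]) <=
  ((2 * m0 + 1) ^ 2)%:R * p + ((2 * m1 + 1) ^ 4)%:R * c0 + ((2 * t + 1) ^ 2 * (2 * m1) ^ 2)%:R * c1.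
Proof.
move=> p01 m00 m10 c00 c10 H0 H1; set s := rsites (ball t).
pose A0 w := has (fun z => w z && inR (ball t) z) (rsites (ball m0)).
pose A1 m L (w : Site -> bool) :=
  has (fun R => `[< Span w R >] && (subR R (ball t) && (m <= long R <= 2 * m)%N)) L.
apply: (@le_trans _ _ (Pr p s (fun w => (A0 w || A1 m0 (subrects (ball m1)) w) ||
    A1 m1 (small_rects t (2 * m1)) w))).
  apply: le_Pr => // w /asboolP /(act_origin_cases m00 m10)[[z zm wz]|[R Rm [sR lR]]|[R Rm [sR lR]]].
  - by apply/orP; left; apply/orP; left; apply/hasP; exists z.
  - by apply/orP; left; apply/orP; right; apply/hasP; exists R; rewrite // lR andbT; apply/asboolP.
  - by apply/orP; right; apply/hasP; exists R; rewrite // lR andbT; apply/asboolP.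
have PA1 m L c : (0 < m)%N -> 0 <= c -> (forall R, valid R -> subR R (ball t) -> (m <= long R <= 2 * m)%N ->
     PrSpan p s R <= c) -> Pr p s (A1 m L) <= (size L)%:R * c.
  move=> m_gt0 c_ge0 H.
  apply: (le_trans (@Pr_union _ _ p p01 s (A1 m L) _ L (fun R w => `[< Span w R >] && (subR R (ball t) && (m <= long R <= 2 * m)%N)) _)).
    by move=> w /hasP.
  apply: sum_le_size => R _.
  have [vR|vR] := boolP (valid R); last first.
    apply: le_trans c_ge0; rewrite -(Ex_cst p s 0 (fun=> false)); apply: ler_Ex => // w.
    by rewrite asboolF // => /Span_valid; apply/negP.
  have [/andP[h1 h2]|h] := boolP (subR R (ball t) && (m <= long R <= 2 * m)%N).
    by apply: le_trans (H R vR h1 h2); apply: le_Pr => // w; rewrite andbT.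
  by apply: le_trans c_ge0; rewrite -(Ex_cst p s 0 (fun=> false)); apply: ler_Ex => // w; rewrite andbF.
have PA0 : Pr p s A0 <= ((2 * m0 + 1) ^ 2)%:R * p.
  apply: (le_trans (@Pr_union _ _ p p01 s A0 _ (rsites (ball m0)) (fun z w => w z && inR (ball t) z) _)).
    by move=> w /hasP.
  rewrite -size_ball; apply: sum_le_size => z _.
  have [zt|zt] := boolP (inR (ball t) z).
    rewrite -[leRHS](@Ex_site _ _ p s z (fun=> false)) ?mem_rsites //.
    by apply: ler_Ex => // w; rewrite andbT.
  have [p0 _] := andP p01; apply: le_trans p0.
  by rewrite -(Ex_cst p s 0 (fun=> false)); apply: ler_Ex => // w; rewrite andbF.
apply: (le_trans (Pr_or _ _ _ p01)); apply: lerD; last first.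
  by rewrite -size_small_rects; exact: PA1.
apply: (le_trans (Pr_or _ _ _ p01)); apply: lerD => //.
have -> : ((2 * m1 + 1) ^ 4 = size (subrects (ball m1)))%N.
  rewrite size_subrects; last by rewrite /valid /=; lia.
  have -> : width (ball m1) = (2 * m1 + 1)%N by rewrite /width /=; lia.
  have -> : height (ball m1) = (2 * m1 + 1)%N by rewrite /height /=; lia.
  by rewrite -expnD.
exact: PA1.
Qed.

End upper.

End origin.

Section subcritical_limit.
Variable K : realType.
Implicit Type p : K.

(** The intermediate scale [y = p^(-1/4)]: a square of side [y] holds only about [p^(1/2)] occupied
    sites on average, yet exp (- y) beats every power of [1 / p]. *)
Lemma small_root (Y : K) : small (fun p => exists y : K, [/\ 1 <= y, Y <= y & y ^+ 4 = p^-1]).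
Proof.
pose Z := Num.max 1 Y; have Z1 : 1 <= Z by rewrite le_max lexx.
have Z0 : 0 < Z by exact: lt_le_trans Z1.
apply: small_imp (small_inv (exprn_gt0 4 Z0)) => p p0 h.
have ip : 0 <= p^-1 by rewrite invr_ge0 ltW.
exists (Num.sqrt (Num.sqrt p^-1)); set y := Num.sqrt _.
have y4 : y ^+ 4 = p^-1.
  by rewrite (exprM y 2 2) !sqr_sqrtr // sqrtr_ge0.
have yZ : Z <= y.
  by rewrite -(ler_pXn2r (_ : 0 < 4)%N) ?nnegrE ?sqrtr_ge0 ?y4 // ltW.
by split; rewrite // (le_trans _ yZ) // le_max lexx orbT.
Qed.

Lemma term_sites (p y : K) (m0 : nat) : 0 < p -> 1 <= y -> y ^+ 4 = p^-1 -> m0%:R <= y + 1 ->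
  ((2 * m0 + 1) ^ 2)%:R * p <= 25 / y.
Proof.
move=> p0 y1 y4 hm; have y0 : 0 < y by lra.
have -> : p = (y ^+ 4)^-1 by rewrite y4 invrK.
have h : ((2 * m0 + 1) ^ 2)%:R <= 25 * y ^+ 2.
  have -> : 25 * y ^+ 2 = (5 * y) ^+ 2 by ring.
  rewrite natrX; apply: lerXn2r; rewrite ?nnegrE ?mulr_ge0 //; first exact: ltW.
  by rewrite natrD natrM; lra.
rewrite ler_pdivrMr ?exprn_gt0 // (_ : 25 / y * y ^+ 4 = 25 * y ^+ 2 * y); last by field; rewrite gt_eqF.
by apply: (le_trans h); rewrite ler_peMr //; apply: mulr_ge0; [|exact/exprn_ge0/ltW].
Qed.

Lemma gap_at_mesoscale (p y z0 : K) (m0 k : nat) : 0 < p -> p <= 2^-1 -> 1 <= y -> y ^+ 4 = p^-1 ->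
  (forall z, 0 < z -> z <= z0 -> 1 <= gfun z) -> 8 / z0 <= y -> 0 < z0 ->
  m0%:R <= y + 1 -> (0 < k <= 2 * m0)%N -> 1 <= gfun (rate p * k%:R).
Proof.
move=> p0 p2 y1 y4 H yz z00 hm /andP[k0 km]; have y0 : 0 < y by lra.
have r0 : 0 < rate p by have := @rate_ge _ p ltac:(lra); lra.
apply: H; first by rewrite mulr_gt0 // ltr0n.
have h1 : k%:R <= 4 * y.
  apply: (@le_trans _ _ (2 * m0)%:R); first by rewrite ler_nat.
  by rewrite natrM; lra.
have h2 := rate_le2 (ltW p0) p2.
have h3 : rate p * k%:R <= 2 * p * (4 * y) by apply: ler_pM => //; exact: ltW.
apply: (le_trans h3).
have -> : p = (y ^+ 4)^-1 by rewrite y4 invrK.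
have -> : 2 / y ^+ 4 * (4 * y) = 8 / y ^+ 3 by field; rewrite gt_eqF.
rewrite ler_pdivrMr ?exprn_gt0 //.
rewrite ler_pdivrMr // in yz; rewrite mulrC; apply: (le_trans yz).
by rewrite ler_pM2r // exprS ler_peMr ?exprn_ege1 // ltW.
Qed.

Lemma truncnS_bound (x : K) : 0 <= x -> x <= (Num.truncn x).+1%:R <= x + 1.
Proof. by move=> x0; rewrite ltW ?truncnS_gt //= -natr1 lerD2r truncn_le. Qed.

Lemma sq_count_le (t : nat) (p c : K) : 0 < p -> (0 < t)%N -> p * ln t%:R <= c ->
  ((2 * t + 1) ^ 2)%:R <= 9 * expR (2 * c / p).
Proof.
move=> p0 t0 h.
have ht : t%:R <= expR (c / p).
  by rewrite -[leLHS]lnK ?posrE ?ltr0n // ler_expR ler_pdivlMr // mulrC.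
have -> : 9 * expR (2 * c / p) = (3 * expR (c / p)) ^+ 2.
  rewrite exprMn -expRM_natr; congr (_ * expR _); by ring.
rewrite natrX; apply: lerXn2r; rewrite ?nnegrE ?mulr_ge0 ?expR_ge0 //.
apply: (@le_trans _ _ (3 * t)%:R); first by rewrite ler_nat; move: t0; clear; lia.
by rewrite natrM ler_pM2l.
Qed.

Lemma subcritical (c e : K) : 0 < c -> c < pi ^+ 2 / 18 -> 0 < e ->
  small (fun p => forall t, (0 < t)%N -> p * ln t%:R <= c ->
    Pr p (rsites (ball t)) (fun w => `[< act w t (0, 0) >]) <= e).
Proof.
move=> c0 clam e0; set lam : K := pi ^+ 2 / 18 in clam *.
(* Equal gaps in [c < c3 < c1 < lam]; the first one beats the number of positions, which is of order
   exp (2 c / p). *)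
pose c3 := (2 * c + lam) / 3; pose c1 := (c + 2 * lam) / 3.
have c3c : 0 < c3 - c by rewrite /c3; lra.
have [B [C [k [B1 C0 Hr]]]] := @subcrit_rect K c1 c3 ltac:(rewrite /c3; lra)
  ltac:(rewrite /c3 /c1; lra) ltac:(rewrite -/lam /c1; lra).
have [z0 z00 Hz] := @gfun_large K 1 ler01.
pose D := 2 * B + 3; have D0 : 0 < D by rewrite /D; lra.
(* The lower bounds on [y] serve, in order, the occupied sites near the origin, the validity of
   [1 <= gfun] at the intermediate scale, and the rectangles of that scale. The factorial comes from
   the decay of y^16 exp (- y), where y^16 = (1 / p)^4. *)
have [p1 p10 Hp1] : small (fun p : K => exists y, [/\ 1 <= y,
   Num.max (75 / e) (Num.max (8 / z0) (3 * (D ^+ 4 * expR 1 * (17`!%:R)) / e)) <= y & y ^+ 4 = p^-1]).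
  exact: small_root.
have S3 := @small_decay K (k + 2) (2 * (c3 - c)) (9 * D ^+ 2 * C) (e / 3)
  ltac:(clear -c3c; lra) ltac:(clear -e0; lra).
have S2 := @small_le K 2^-1 ltac:(clear; lra).
have {}Hp1 : small (fun p : K => exists y, [/\ 1 <= y,
   Num.max (75 / e) (Num.max (8 / z0) (3 * (D ^+ 4 * expR 1 * (17`!%:R)) / e)) <= y & y ^+ 4 = p^-1]).
  by exists p1.
apply: small_imp (small_and S2 (small_and Hr (small_and S3 Hp1))).
move=> p p0 [p2 [{}Hr [{}S3 [y [y1 + y4]]]]] t t0 ht.
rewrite !ge_max => /andP[ye /andP[yz yD]].
have y0 : 0 < y by clear -y1; lra.
have p01 : 0 <= p <= 1 by rewrite ltW //=; clear -p2; lra.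
have p02 : 0 < p <= 2^-1 by rewrite p0.
have pq : p <= rate p by apply: rate_ge; clear -p2; lra.
have q0 : 0 < rate p by exact: lt_le_trans pq.
pose m0 := (Num.truncn y).+1; pose m1 := (Num.truncn (B / rate p)).+1.
have /andP[m0l m0u] := truncnS_bound (ltW y0).
have m1u : (2 * m1 + 1)%:R <= D / p.
  have B0 : 0 <= B by clear -B1; lra.
  have /andP[_ h] := truncnS_bound (divr_ge0 B0 (ltW q0)); rewrite -/m1 in h.
  have h2 : B / rate p <= B / p by apply: ler_wpM2l => //; rewrite lef_pV2 ?posrE.
  have h3 : 1 <= p^-1 by rewrite invf_ge1 //; clear -p2; lra.
  rewrite /D mulrDl natrD natrM -mulrA; clear -h h2 h3.
  move: (B / p) (B / rate p) (p^-1) (m1%:R) h h2 h3 => a b d m; lra.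
have Dp0 : 0 <= D / p by rewrite divr_ge0 // ltW.
have H0 R : valid R -> subR R (ball t) -> (m0 <= long R <= 2 * m0)%N ->
     PrSpan p (rsites (ball t)) R <= expR 1 * expR (- y).
  move=> vR sR /andP[lo hi].
  have Rs : {subset rsites R <= rsites (ball t)}.
    by move=> z; rewrite !mem_rsites; exact: subR_inR.
  apply: (le_trans (@PrSpan_short _ p (rsites (ball t)) R 1 p02 vR Rs ler01 _)).
    apply: (gap_at_mesoscale p0 p2 y1 y4 Hz yz z00 m0u).
    rewrite leq_min; apply/andP; split.
      by move: vR; clear; rewrite /valid /width /height; rlia.
    by apply: leq_trans hi; rewrite /long (leq_trans (geq_minl _ _)) // leq_maxl.
  apply: ler_wpM2l; first exact: expR_ge0.
  by rewrite ler_expR mul1r lerN2 (le_trans m0l) // ler_nat.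
have H1 R : valid R -> subR R (ball t) -> (m1 <= long R <= 2 * m1)%N ->
     PrSpan p (rsites (ball t)) R <= C * p^-1 ^+ k * expR (- (2 * c3 / p)).
  move=> vR sR lR; apply: Hr => // z; rewrite !mem_rsites; exact: subR_inR.
have ip0 : 0 <= p^-1 by rewrite invr_ge0 ltW.
have C1 : 0 <= C * p^-1 ^+ k * expR (- (2 * c3 / p)) by rewrite !mulr_ge0 ?expR_ge0 ?exprn_ge0.
have E0 : 0 <= expR 1 * expR (- y) by rewrite mulr_ge0 ?expR_ge0.
apply: (le_trans (Pr_origin_le p01 (ltn0Sn _) (ltn0Sn _) E0 C1 H0 H1)).
have T1 : ((2 * m0 + 1) ^ 2)%:R * p <= e / 3.
  apply: (le_trans (term_sites p0 y1 y4 m0u)).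
  rewrite ler_pdivrMr //; rewrite ler_pdivrMr // in ye; clear -ye; lra.
have T2 : ((2 * m1 + 1) ^ 4)%:R * (expR 1 * expR (- y)) <= e / 3.
  apply: (@le_trans _ _ (D ^+ 4 * expR 1 * (y ^+ 16 * expR (- (1 * y))))).
    rewrite mul1r.
    have -> : D ^+ 4 * expR 1 * (y ^+ 16 * expR (- y)) = (D / p) ^+ 4 * (expR 1 * expR (- y)).
      rewrite exprMn -y4 -exprM; move: (D ^+ 4) (y ^+ _) => a b; clear; ring.
    apply: ler_wpM2r => //; rewrite natrX; apply: lerXn2r; rewrite ?nnegrE //.
  have P0 : 0 <= D ^+ 4 * expR 1 by rewrite mulr_ge0 ?expR_ge0 // exprn_ge0 // ltW.
  apply: (le_trans (ler_wpM2l P0 (expR_pow_decay 16 ltr01 y0))).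
  rewrite expr1n divr1 mulrA ler_pdivrMr //; rewrite ler_pdivrMr // in yD.
  by move: yD; move: (D ^+ 4 * _ * _) => x; clear; lra.
have T3 : ((2 * t + 1) ^ 2 * (2 * m1) ^ 2)%:R * (C * p^-1 ^+ k * expR (- (2 * c3 / p))) <= e / 3.
  apply: le_trans S3.
  have h1 := sq_count_le p0 t0 ht.
  have h2 : ((2 * m1) ^ 2)%:R <= (D / p) ^+ 2.
    rewrite natrX; apply: lerXn2r; rewrite ?nnegrE //; apply: le_trans m1u; rewrite ler_nat leq_addr //.
  apply: (@le_trans _ _ (9 * expR (2 * c / p) * (D / p) ^+ 2 * (C * p^-1 ^+ k * expR (- (2 * c3 / p))))).
    by apply: ler_wpM2r => //; rewrite natrM; apply: ler_pM.
  rewrite (_ : - (2 * (c3 - c) / p) = 2 * c / p + - (2 * c3 / p)); last by clear; ring.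
  rewrite expRD exprMn addnC exprD.
  move: (expR _) (expR _) (p^-1 ^+ 2) (p^-1 ^+ k) (D ^+ 2) => a b f g h; clear.
  by rewrite le_eqVlt; apply/orP; left; apply/eqP; ring.
move: T1 T2 T3; move: (_ * p) (_ * (expR 1 * _)) (_ * (C * _ * _)) => a b d; clear; lra.
Qed.

End subcritical_limit.

(** * Growth of a full square *)

Section filling.
Implicit Types (w : Site -> bool) (f : nat -> nat -> Site).

(** Lattice coordinates in which [k] numbers the lines and [i] the sites of a line; the four
    directions of growth are four instances. *)
Definition grid f :=
  [/\ forall k i, nbr (f k.+1 i) (f k i), forall k i, nbr (f k i) (f k.+1 i),
      forall k i, nbr (f k i) (f k i.+1), forall k i, nbr (f k i.+1) (f k i) &
      forall k i k' i', f k i = f k' i' -> k = k' /\ i = i'].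

Lemma fill_line w f tau h k j : grid f -> (j < h)%N ->
  (forall i, (i < h)%N -> act w tau (f k i)) -> act w tau (f k.+1 j) ->
  forall i, (i < h)%N -> act w (tau + h) (f k.+1 i).
Proof.
move=> [n1 n2 n3 n4 inj] jh full aj.
suff H d i : (i < h)%N -> (`|i%:Z - j%:Z| <= d)%N -> act w (tau + d) (f k.+1 i).
  by move=> i ih; apply: H => //; lia.
elim: d i => [|d IH] i ih id.
  by rewrite addn0 (_ : i = j) //; lia.
have [->|ij] := eqVneq i j; first by apply: act_le aj; exact: leq_addr.
have below : act w (tau + d) (f k i) by apply: act_le (full i ih); exact: leq_addr.
rewrite addnS; have [lt|ge] := ltnP i j.
  apply: (@act_nbrs _ _ _ (f k i) (f k.+1 i.+1)) => //.
    by apply/eqP => /inj[]; lia.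
  by apply: IH; lia.
apply: (@act_nbrs _ _ _ (f k i) (f k.+1 i.-1)) => //.
- by apply/eqP => /inj[]; lia.
- by rewrite -{1}(@prednK i) //; lia.
- by apply: IH; lia.
Qed.

(** Beside a full line, one active site fills its line in [h] steps. If the next line is empty, a
    site of it lies between the full line and an occupied site of the line after; activating this
    seed takes the additional step in [h.+1]. *)
Lemma fill_lines w f tau h n : grid f ->
  (forall i, (i < h)%N -> act w tau (f 0%N i)) ->
  (forall k, (k < n)%N -> exists2 j, (j < h)%N & w (f k.+1 j) || w (f k.+2 j)) ->
  forall k i, (k <= n)%N -> (i < h)%N -> act w (tau + k * h.+1) (f k i).
Proof.
move=> gf full occ; elim=> [|k IH] i kn ih; first by rewrite mul0n addn0; exact: full.
have [n1 n2 n3 n4 inj] := gf.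
have prev : forall i, (i < h)%N -> act w (tau + k * h.+1) (f k i) by move=> ?; apply: IH; exact: ltnW.
have [j jh /orP wj] := occ k kn.
have -> : (tau + k.+1 * h.+1 = tau + k * h.+1 + 1 + h)%N by rewrite mulSn; lia.
apply: (fill_line gf jh) => //.
  by move=> i' i'h; rewrite addn1; apply: act_step; exact: prev.
rewrite addn1; case: wj => wj; first exact: act_init.
apply: act_nbrs (n1 k j) (n2 k.+1 j) (prev j jh) (act_init _ wj).
by apply/eqP => /inj[]; lia.
Qed.

Definition cells f n h : seq (seq Site) := [seq [seq f k i | i <- iota 0 h] | k <- iota 1 n].

Definition ext f n h w := sorted orb (rcons [seq has w c | c <- cells f n h] false).

Lemma sorted_orb_rcons (l : seq bool) k : sorted orb (rcons l false) -> (k < size l)%N ->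
  nth false l k || nth false l k.+1.
Proof.
elim: l k => [//|a l IH] [|k] /=; case: l IH => [|b l] IH /=.
- by case: a.
- by move=> /andP[].
- by [].
- by move=> /andP[_ h] kl; apply: IH.
Qed.

Lemma ext_occupied f n h w k : ext f n h w -> (k < n)%N ->
  exists2 j, (j < h)%N & w (f k.+1 j) || w (f k.+2 j).
Proof.
move=> /(@sorted_orb_rcons _ k); rewrite !size_map size_iota => H kn; have {}H := H kn.
have E m : (m < n)%N -> nth false [seq has w c | c <- cells f n h] m -> 
    exists2 j, (j < h)%N & w (f m.+1 j).
  move=> mn; rewrite (nth_map [::]) ?size_map ?size_iota // (nth_map 0%N) ?size_iota // nth_iota //.
  by move=> /hasP[z /mapP[j]]; rewrite mem_iota add1n => /andP[_ jh] -> wz; exists j.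
case/orP: H => hk; first by have [j jh wj] := E k kn hk; exists j; rewrite ?wj.
have [kn1|kn1] := ltnP k.+1 n; last by move: hk; rewrite nth_default // !size_map size_iota.
by have [j jh wj] := E k.+1 kn1 hk; exists j; rewrite ?wj ?orbT.
Qed.

Definition rightw (o : Site) (k j i : nat) : Site := (o.1 + k%:Z - 1 + j%:Z, o.2 + i%:Z).
Definition upw (o : Site) (k j i : nat) : Site := (o.1 + i%:Z, o.2 + k%:Z - 1 + j%:Z).
Definition leftw (o : Site) (j i : nat) : Site := (o.1 - j%:Z, o.2 + i%:Z).
Definition downw (o : Site) (j i : nat) : Site := (o.1 + i%:Z, o.2 - j%:Z).

Lemma grid_rightw o k : grid (rightw o k).
Proof. split=> [j i|j i|j i|j i|j i j' i' []]; rewrite /nbr /rightw /=; lia. Qed.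

Lemma grid_upw o k : grid (upw o k).
Proof. split=> [j i|j i|j i|j i|j i j' i' []]; rewrite /nbr /upw /=; lia. Qed.

Lemma grid_leftw o : grid (leftw o).
Proof. split=> [j i|j i|j i|j i|j i j' i' []]; rewrite /nbr /leftw /=; lia. Qed.

Lemma grid_downw o : grid (downw o).
Proof. split=> [j i|j i|j i|j i|j i j' i' []]; rewrite /nbr /downw /=; lia. Qed.

Definition square (o : Site) (k : nat) : rect :=
  Rect o.1 (o.1 + k%:Z - 1) o.2 (o.2 + k%:Z - 1).

(** New rows are examined over the old width and new columns over the old height, and the new corner
    is never read. Hence the events of a stage are independent of each other and of the past, and
    the corner fills by growth alone. *)
Fixpoint grown (o : Site) (n i : nat) w : bool :=
  if i is j.+1 then
    [&& grown o n j w, ext (rightw o (n * i)) n (n * i) w & ext (upw o (n * i)) n (n * i) w]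
  else all w (rsites (square o n)).

Lemma grow_square o n k tau w : (0 < n)%N -> (0 < k)%N ->
  (forall z, z \in rsites (square o k) -> act w tau z) ->
  ext (rightw o k) n k w -> ext (upw o k) n k w ->
  forall z, z \in rsites (square o (k + n)) -> act w (tau + 2 * n * (k + n).+1) z.
Proof.
move=> n0 k0 full er eu.
have R1 := fill_lines (tau := tau) (h := k) (n := n) (grid_rightw o k) _ (fun i => ext_occupied er (k := i)).
have {}R1 : forall j i, (j <= n)%N -> (i < k)%N -> act w (tau + j * k.+1) (rightw o k j i).
  by apply: R1 => i ik; apply: full; rewrite mem_rsites /inR /square /rightw /=; lia.
have R2 : forall j i, (j <= n)%N -> (i < k + n)%N -> act w (tau + n * k.+1 + j * (k + n).+1) (upw o k j i).
  apply: (fill_lines (grid_upw o k)) => [i ik|j jn].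
    have [lt|ge] := ltnP i k.
      apply: (@act_le _ tau); first exact: leq_addr.
      by apply: full; rewrite mem_rsites /inR /square /upw /=; lia.
    (* To the right of the old square, the starting row is the top of the columns just filled. *)
    have -> : upw o k 0 i = rightw o k (i - k).+1 k.-1 by rewrite /upw /rightw; congr (_, _); lia.
    apply: act_le (R1 _ _ _ _); last 2 first.
    - lia.
    - lia.
    - by rewrite leq_add2l leq_mul2r; apply/orP; right; lia.
  by have [i ik h] := ext_occupied eu jn; exists i => //; lia.
move=> [x y]; rewrite mem_rsites /inR /square /= => zR.
have nk : (tau + n * k.+1 + n * (k + n).+1 <= tau + 2 * n * (k + n).+1)%N.
  rewrite -addnA leq_add2l -mulnA mul2n -addnn leq_add2r leq_mul2l; apply/orP; right; lia.
have [lt|ge] := ltrP (y : int) (o.2 + k%:Z).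
  have [xlt|xge] := ltrP (x : int) (o.1 + k%:Z).
    apply: (@act_le _ tau); first exact: leq_addr.
    by apply: full; rewrite mem_rsites /inR /square /=; lia.
  have -> : (x, y) = rightw o k (absz (x - o.1 - k%:Z)%R).+1 (absz (y - o.2)%R).
    by rewrite /rightw; congr (_, _); lia.
  apply: (@act_le _ (tau + (absz (x - o.1 - k%:Z)%R).+1 * k.+1)); last by apply: R1; lia.
  apply: leq_trans nk; rewrite -addnA leq_add2l; apply: leq_trans (leq_addr _ _).
  by rewrite leq_mul2r; apply/orP; right; lia.
have -> : (x, y) = upw o k (absz (y - o.2 - k%:Z)%R).+1 (absz (x - o.1)%R).
  by rewrite /upw; congr (_, _); lia.
apply: act_le (R2 _ _ _ _); [|lia|lia].
apply: leq_trans nk; rewrite leq_add2l leq_mul2r; apply/orP; right; lia.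
Qed.

Lemma grown_full o n i w : (0 < n)%N -> grown o n i w ->
  forall z, z \in rsites (square o (n * i.+1)) -> act w (2 * n * i * (n * i.+1).+1) z.
Proof.
move=> n0; elim: i => [|i IH] /=.
  by rewrite muln1 => /allP h z /h wz; exact: act_init.
move=> /and3P[/IH{}IH er eu] z; rewrite mulnS addnC => zR.
have := grow_square n0 _ IH er eu zR; rewrite muln_gt0 n0 => /(_ isT).
apply: act_le; rewrite -mulnA -[in leqRHS]mulnA.
set a := (n * i.+1)%N.
rewrite (_ : (a + n).+1 = (a.+1 + n)%N) ?addSn // ?addnS //.
by rewrite -/a; nia.
Qed.

Definition vseg (m x j : nat) : seq Site := [seq (x%:Z, (m * j)%:Z + i%:Z) | i <- iota 0 m].
Definition hseg (m y : nat) : seq Site := [seq (i%:Z, y%:Z) | i <- iota 0 m].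

Lemma square_to_origin m X Y w tau : (0 < m)%N ->
  (forall z, z \in rsites (square ((m * X)%:Z, (m * Y)%:Z) m) -> act w tau z) ->
  (forall x, (x < m * X)%N -> has w (vseg m x Y)) ->
  (forall y, (y < m * Y)%N -> has w (hseg m y)) ->
  act w (tau + m * X * m.+1 + m * Y * m.+1) (0, 0).
Proof.
move=> m0 full hv hh; set o := ((m * X)%:Z, (m * Y)%:Z) in full.
have L j i : (j <= m * X)%N -> (i < m)%N -> act w (tau + j * m.+1) (leftw o j i).
  move=> jX im; apply: (fill_lines (n := (m * X)%N) (grid_leftw o)) => // [i' i'm|k kX].
    by apply: full; rewrite mem_rsites /inR /square /leftw /=; lia.
  have /hasP[z /mapP[a]] := hv (m * X - k.+1)%N ltac:(lia).
  rewrite mem_iota => am -> wa; exists a; first by lia.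
  by apply/orP; left; move: wa; rewrite /leftw /= (_ : (m * X - k.+1)%:Z = (m * X)%:Z - k.+1%:Z) //; lia.
(* After the move to the left, the bottom row of the square has swept over the columns from 0 to
   [m - 1]; for [X = 0] it starts there. *)
have full' i : (i < m)%N -> act w (tau + m * X * m.+1) (downw (0, (m * Y)%:Z) 0 i).
  move=> im; have [X0|X0] := posnP X.
    rewrite X0 muln0 mul0n addn0; apply: full; rewrite mem_rsites /inR /square /downw /= X0; lia.
  have mX : (m <= m * X)%N by rewrite leq_pmulr.
  have -> : downw (0, (m * Y)%:Z) 0 i = leftw o (m * X - i) 0.
    by rewrite /downw /leftw /=; congr (_, _); lia.
  apply: act_le (L _ _ _ m0); last by lia.
  by rewrite leq_add2l leq_mul2r; apply/orP; right; lia.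
have -> : (0, 0) = downw (0, (m * Y)%:Z) (m * Y) 0 by rewrite /downw /=; congr (_, _); lia.
apply: (fill_lines (n := (m * Y)%N) (h := m) (grid_downw (0, (m * Y)%:Z))) => // k kY.
have /hasP[z /mapP[a]] := hh (m * Y - k.+1)%N ltac:(lia).
rewrite mem_iota => am -> wa; exists a; first by lia.
by apply/orP; left; move: wa; rewrite /downw /= add0r (_ : (m * Y - k.+1)%:Z = (m * Y)%:Z - k.+1%:Z) //; lia.
Qed.

End filling.

(** * Supercritical times *)

Lemma mem_cells f n h z : z \in flatten (cells f n h) ->
  exists j i, [/\ (j < n)%N, (i < h)%N & z = f j.+1 i].
Proof.
move=> /flattenP[_ /mapP[k kn ->]] /mapP[i ih ->]; move: kn ih; rewrite !mem_iota => kn ih.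
by exists k.-1, i; split; [lia|lia|rewrite prednK //; lia].
Qed.

Lemma uniq_cells f n h : grid f -> uniq (flatten (cells f n h)).
Proof.
move=> [_ _ _ _ inj]; apply: allpairs_uniq; rewrite ?iota_uniq // => -[k i] [k' i'] _ _ /=.
by move=> /inj[-> ->].
Qed.

Lemma dep_ext f n h : dep (mem (flatten (cells f n h))) (ext f n h).
Proof.
move=> w w' ww'; rewrite /ext; congr (sorted _ (rcons _ _)); apply/eq_in_map => c cL.
by apply: eq_in_has => z zc; apply: ww'; apply/flattenP; exists c.
Qed.

Lemma dep_grown o n i : dep (mem (rsites (square o (n * i.+1)))) (grown o n i).
Proof.
elim: i => [|i IH] w w' ww'.
  by apply: eq_in_all => z zs; apply: ww'; rewrite muln1.
have nE : (n * i.+2 = n * i.+1 + n)%N by rewrite [RHS]addnC -mulnS.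
rewrite nE in ww'; rewrite [LHS]/= [RHS]/=.
move: (n * i.+1)%N IH ww' {nE} => k IH ww'; congr [&& _, _ & _].
- apply: IH => z; rewrite /= mem_rsites => zs; apply: ww'; rewrite /= mem_rsites.
  by move: zs; rewrite /inR /square /=; lia.
- apply: (@dep_ext _ n k) => z /mem_cells[j [l [jn ln ->]]]; apply: ww'.
  by rewrite /= mem_rsites /inR /square /rightw /=; lia.
- apply: (@dep_ext _ n k) => z /mem_cells[j [l [jn ln ->]]]; apply: ww'.
  by rewrite /= mem_rsites /inR /square /upw /=; lia.
Qed.

Lemma Pr_all_indep (K : realType) (T : eqType) (p : K) (s : seq T) (I : eqType) (r : seq I)
    (D : I -> pred T) (A : I -> (T -> bool) -> bool) :
  uniq r -> (forall i, i \in r -> dep (D i) (A i)) ->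
  (forall i j z, i \in r -> j \in r -> i != j -> D i z -> ~~ D j z) ->
  Pr p s (fun w => all (A^~ w) r) = \prod_(i <- r) Pr p s (A i).
Proof.
elim: r => [|i r IH] /=; first by rewrite big_nil /Pr Ex_cst.
move=> /andP[ir ur] dA disj; rewrite big_cons -IH //; last 2 first.
- by move=> j jr; apply: dA; rewrite inE jr orbT.
- by move=> j k z jr kr; apply: disj; rewrite inE ?jr ?kr orbT.
apply: (@Pr_indep _ _ _ (D i) (fun z => has (fun j => D j z) r)).
- by apply: dA; rewrite inE eqxx.
- move=> w w' ww'; apply: eq_in_all => j jr; apply: dA; first by rewrite inE jr orbT.
  by move=> z Dz; apply: ww'; apply/hasP; exists j.
- move=> z Dz; apply/hasPn => j jr; apply: disj Dz; rewrite ?inE ?eqxx ?jr ?orbT //.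
  by apply: contraNneq ir => ->.
Qed.

Section grown_probability.
Variables (K : realType) (p : K) (s : seq Site).
Hypothesis p01 : 0 < p < 1.

Let p01w : 0 <= p <= 1. Proof. by case/andP: p01 => /ltW -> /ltW. Qed.
Let q0 : 0 < rate p.
Proof. by have [p0 p1] := andP p01; exact: lt_le_trans (rate_ge p1). Qed.

Lemma Pr_all_sites (l : seq Site) : uniq l -> {subset l <= s} -> Pr p s (fun w => all w l) = p ^+ size l.
Proof.
move=> ul ls; rewrite (@Pr_all_indep _ _ p s _ l (fun z => pred1 z) (fun z w => w z)) //.
- rewrite big_seq; under eq_bigr => z zl do rewrite /Pr Ex_site ?ls //.
  by rewrite -big_seq big_const_seq count_predT iter_mulr_1.
- by move=> z _; exact: dep_site.
- by move=> x y z _ _ xy /= /eqP ->.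
Qed.

(** The prefactor [u / b] is at least [u], which is [expR (- bose _)]. *)
Lemma Pr_ext_ge f n h : grid f -> (0 < h)%N -> {subset flatten (cells f n h) <= s} ->
  expR (- (bose (rate p * h%:R) + n%:R * gfun (rate p * h%:R))) <= Pr p s (ext f n h).
Proof.
move=> gf h0 fs; have [p0 p1] := andP p01.
have qh : 0 < rate p * h%:R by rewrite mulr_gt0 // ltr0n.
have /andP[x0 x1] := expN_itv qh; set x := expR _ in x0 x1.
have x01 : 0 <= x <= 1 by rewrite !ltW.
have b0 : 0 < gap_root x by apply: gap_root_gt0; rewrite ltW.
have b1 : gap_root x < 1 by apply: gap_root_lt1; rewrite x0 ltW.
have xE : 1 - (1 - p) ^+ h = 1 - x by rewrite expR_rateM.
have := @Ex_sorted_ge _ _ p s p01w h (gap_root x) (cells f n h) (fun=> false).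
rewrite /= xE => /(_ b0 (gap_root_ge x01)).
move=> H.
apply: le_trans (H _ _ (uniq_cells _ _ gf) fs); last 2 first.
- by rewrite gap_rootE // (_ : 1 - (1 - x) = x) ?[x * _]mulrC //; ring.
- by move=> c /mapP[k _ ->]; rewrite size_map size_iota.
rewrite opprD expRD /bose opprK -/x lnK ?posrE; last by rewrite subr_gt0.
have -> : expR (- (n%:R * gfun (rate p * h%:R))) = gap_root x ^+ n.
  by rewrite /gfun mulrN opprK -/x mulrC expRM_natr lnK // posrE.
rewrite size_map size_iota; apply: ler_wpM2r; first by rewrite exprn_ge0 // ltW.
rewrite ler_pdivlMr // ler_piMr ?ltW //; lra.
Qed.

Lemma Pr_grown_ge o n i : (0 < n)%N -> {subset rsites (square o (n * i.+1)) <= s} ->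
  p ^+ (n ^ 2) * expR (- (2 * \sum_(j < i) (bose (rate p * (n * j.+1)%:R) +
    n%:R * gfun (rate p * (n * j.+1)%:R)))) <= Pr p s (grown o n i).
Proof.
move=> n0; elim: i => [|i IH] sub.
  rewrite big_ord0 mulr0 oppr0 expR0 mulr1 Pr_all_sites ?uniq_rsites //; last by move: sub; rewrite muln1.
  by rewrite size_allpairs !size_zseq /=; rewrite (_ : _ * _ = n ^ 2)%N //; nia.
have nE : (n * i.+2 = n * i.+1 + n)%N by rewrite [RHS]addnC -mulnS.
have k0 : (0 < n * i.+1)%N by rewrite muln_gt0 n0.
rewrite nE in sub.
set k := (n * i.+1)%N in nE sub k0 IH *.
pose DR := mem (flatten (cells (rightw o k) n k)).
pose DU := mem (flatten (cells (upw o k) n k)).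
have subR : {subset flatten (cells (rightw o k) n k) <= s}.
  by move=> z /mem_cells[j [l [jn ln ->]]]; apply: sub; rewrite mem_rsites /inR /square /rightw /=; lia.
have subU : {subset flatten (cells (upw o k) n k) <= s}.
  by move=> z /mem_cells[j [l [jn ln ->]]]; apply: sub; rewrite mem_rsites /inR /square /upw /=; lia.
have -> : Pr p s (grown o n i.+1) =
    Pr p s (grown o n i) * (Pr p s (ext (rightw o k) n k) * Pr p s (ext (upw o k) n k)).
  rewrite -(@Pr_indep _ _ p DR DU); [|exact: dep_ext|exact: dep_ext|]; last first.
    move=> z /= /mem_cells[j [l [jn ln ->]]]; apply/negP => /mem_cells[j' [l' [jn' ln' []]]]; lia.
  apply: (@Pr_indep _ _ p (mem (rsites (square o k))) (fun z => DR z || DU z)).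
  - exact: dep_grown.
  - apply: dep_comp2.
      by apply: depS (@dep_ext _ _ _) => z; rewrite /DR /= => ->.
    by apply: depS (@dep_ext _ _ _) => z; rewrite /DU /= => ->; rewrite orbT.
  - move=> z /=; rewrite mem_rsites /inR /square /= => zs; apply/negP => /orP[] /= /mem_cells[j [l [jn ln zE]]];
    by move: zs; rewrite zE /=; lia.
rewrite big_ord_recr /= -/k; set S := \sum_(j < i) _ in IH *; set b := (_ + _ * gfun _).
have -> : p ^+ (n ^ 2) * expR (- (2 * (S + b))) = p ^+ (n ^ 2) * expR (- (2 * S)) * (expR (- b) * expR (- b)).
  by rewrite -mulrA -!expRD; congr (_ * expR _); ring.
have [p0 _] := andP p01.
apply: ler_pM.
- by rewrite mulr_ge0 ?expR_ge0 // exprn_ge0 // ltW.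
- by rewrite mulr_ge0 ?expR_ge0.
- by apply: IH => z zs; apply: sub; move: zs; rewrite !mem_rsites /inR /square /=; lia.
- by apply: ler_pM; rewrite ?expR_ge0 //; apply: Pr_ext_ge => //; [exact: grid_rightw|exact: grid_upw].
Qed.

(** Both sums are Riemann sums of mesh [rate p * n]. The [gfun] terms carry the weight [n] and give
    [pi ^+ 2 / 9], twice the area under g; the [bose] terms carry weight 1 and give [4 / n]. *)
Lemma Pr_grown_bound o n i : (0 < n)%N -> {subset rsites (square o (n * i.+1)) <= s} ->
  p ^+ (n ^ 2) * expR (- ((pi ^+ 2 / 9 + 4 / n%:R) / p)) <= Pr p s (grown o n i).
Proof.
move=> n0 /(Pr_grown_ge n0); apply: le_trans; have [p0 p1] := andP p01.
apply: ler_wpM2l; first by rewrite exprn_ge0 // ltW.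
rewrite ler_expR lerN2.
have nR : 0 < n%:R :> K by rewrite ltr0n.
have h0 : 0 < rate p * n%:R by rewrite mulr_gt0.
have hg := sum_gfun_le i h0; have hb := sum_bose_le i h0.
rewrite -!mulr_sumr in hg hb.
under eq_bigr do rewrite natrM mulrA.
rewrite big_split /= -mulr_sumr.
move: (\sum_(j < i) gfun _) (\sum_(j < i) bose _) hg hb => G B hg hb.
have pq := rate_ge p1; have ip0 : 0 < p^-1 by rewrite invr_gt0.
have qp : (rate p)^-1 <= p^-1 by rewrite lef_pV2 ?posrE.
have hG : n%:R * G <= pi ^+ 2 / 18 / p.
  apply: (@le_trans _ _ (pi ^+ 2 / 18 / rate p)); first by rewrite ler_pdivlMr // mulrC mulrA.
  by apply: ler_wpM2l => //; rewrite divr_ge0 // sqr_ge0.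
have hB : B <= 2 / n%:R / p.
  apply: (@le_trans _ _ (2 / n%:R / rate p)).
    by rewrite ler_pdivlMr // ler_pdivlMr // -mulrA mulrC.
  by apply: ler_wpM2l => //; rewrite divr_ge0 // ltW.
have -> : (pi ^+ 2 / 9 + 4 / n%:R) / p = 2 * (pi ^+ 2 / 18 / p + 2 / n%:R / p).
  by field; rewrite !gt_eqF.
by rewrite ler_pM2l // addrC lerD.
Qed.

End grown_probability.

Definition corner (m : nat) (X : nat * nat) : Site := ((m * X.1)%:Z, (m * X.2)%:Z).

Definition grid_index (a b : nat) : seq (nat * nat) := [seq (x, y) | x <- iota 0 a, y <- iota 0 b].

Lemma mem_grid_index a b x : (x \in grid_index a b) = (x.1 < a)%N && (x.2 < b)%N.
Proof.
case: x => x y; apply/allpairsP/andP => [[[x' y'] /=]|/= [xa yb]].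
  by rewrite !mem_iota => -[h1 h2 [-> ->]].
by exists (x, y); rewrite !mem_iota.
Qed.

Lemma corner_sub m M t X : (m * M <= t)%N -> (X.1 < M)%N -> (X.2 < M)%N ->
  {subset rsites (square (corner m X) m) <= rsites (ball t)}.
Proof.
move=> mMt XM YM [a b]; rewrite !mem_rsites /inR /square /corner /ball /=.
have mX : (m * X.1 + m <= m * M)%N by rewrite -mulnSr leq_mul2l XM orbT.
have mY : (m * X.2 + m <= m * M)%N by rewrite -mulnSr leq_mul2l YM orbT.
by lia.
Qed.

Lemma vseg_sub m M t x : (m * M <= t)%N -> (x.1 < m * M)%N -> (x.2 < M)%N ->
  {subset vseg m x.1 x.2 <= rsites (ball t)}.
Proof.
move=> mMt x1 x2 z /mapP[k]; rewrite mem_iota => km ->.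
have mY : (m * x.2 + m <= m * M)%N by rewrite -mulnSr leq_mul2l x2 orbT.
by rewrite mem_rsites /inR /ball /=; lia.
Qed.

Lemma hseg_sub m M t y : (0 < M)%N -> (m * M <= t)%N -> (y < m * M)%N ->
  {subset hseg m y <= rsites (ball t)}.
Proof.
move=> M0 mMt ym z /mapP[k]; rewrite mem_iota => km ->.
have mM : (m <= m * M)%N by rewrite leq_pmulr.
by rewrite mem_rsites /inR /ball /=; lia.
Qed.

(** Growth takes at most [2 * m * m.+1] steps, each of the two moves at most [m * M * m.+1], and
    [m.+1 <= 2 * m]. *)
Lemma origin_active n i M w X : (0 < n)%N -> X \in grid_index M M ->
  let m := (n * i.+1)%N in grown (corner m X) n i w ->
  (forall x, x \in grid_index (m * M) M -> has w (vseg m x.1 x.2)) ->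
  (forall y, y \in iota 0 (m * M) -> has w (hseg m y)) ->
  act w (8 * m ^ 2 * M) (0, 0).
Proof.
move=> n0; rewrite mem_grid_index => /andP[XM YM] m /(grown_full n0) full hv hh.
have m0 : (0 < m)%N by rewrite muln_gt0 n0.
have mX : (m * X.1 < m * M)%N by rewrite ltn_pmul2l.
have mY : (m * X.2 < m * M)%N by rewrite ltn_pmul2l.
have := square_to_origin m0 full.
move=> /(_ _ _)/wrap[x xX|y yY|].
- by apply: (hv (x, X.2)); rewrite mem_grid_index /= YM andbT; exact: ltn_trans mX.
- by apply: hh; rewrite mem_iota add0n /=; exact: ltn_trans mY.
apply: act_le.
have nim : (n * i <= m)%N by rewrite /m leq_mul2l leqnSn orbT.
have : (2 * n * i * m.+1 <= 2 * m * m.+1)%N by rewrite leq_mul2r -!mulnA leq_mul2l nim orbT.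
rewrite -/m; move: mX mY nim XM m0; clear; move: m (n * i)%N (X.1) (X.2) => m a x y mX mY _ xM m0 h.
have h1 : (m * x * m.+1 <= m * M * m.+1)%N by rewrite leq_mul2r (ltnW mX) orbT.
have h2 : (m * y * m.+1 <= m * M * m.+1)%N by rewrite leq_mul2r (ltnW mY) orbT.
have h3 : (2 * m * m.+1 <= 2 * (m * M * m.+1))%N.
  by rewrite mulnA leq_mul2r mulnA leq_pmulr ?orbT //; lia.
have h4 : (m * M * m.+1 <= 2 * (m ^ 2 * M))%N.
  have -> : (2 * (m ^ 2 * M) = m * M * (m + m))%N by ring.
  by rewrite leq_mul2l; apply/orP; right; lia.
rewrite -mulnA; lia.
Qed.

Section supercritical_limit.
Variable K : realType.
Implicit Type p : K.

(** The squares placed at multiples of [m] are disjoint, so the probabilities that they fail to grow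
    multiply; empty segments are handled by a union bound. *)
Lemma Pr_inactive_le (p P : K) (n i M t : nat) : 0 < p < 1 -> (0 < n)%N ->
  let m := (n * i.+1)%N in let s := rsites (ball t) in
  (forall o, {subset rsites (square o m) <= s} -> P <= Pr p s (grown o n i)) ->
  (0 < M)%N -> (8 * m ^ 2 * M <= t)%N ->
  1 - Pr p s (fun w => `[< act w t (0, 0) >]) <=
  expR (- ((M ^ 2)%:R * P)) + (2 * m * M ^ 2)%:R * (1 - p) ^+ m.
Proof.
move=> p01 n0 m s HP M0 tM; have [p0 p1] := andP p01.
have p01w : 0 <= p <= 1 by rewrite !ltW.
have m0 : (0 < m)%N by rewrite muln_gt0 n0.
have mMt : (m * M <= t)%N.
  apply: leq_trans tM; rewrite leq_mul2r; apply/orP; right; rewrite -mulnn mulnA.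
  by rewrite leq_pmull // muln_gt0.
rewrite -Pr_setC //.
pose no_box (w : Site -> bool) := all (fun X => ~~ grown (corner m X) n i w) (grid_index M M).
pose no_v (w : Site -> bool) := has (fun x => ~~ has w (vseg m x.1 x.2)) (grid_index (m * M) M).
pose no_h (w : Site -> bool) := has (fun y => ~~ has w (hseg m y)) (iota 0 (m * M)).
apply: (@le_trans _ _ (Pr p s (fun w => no_box w || (no_v w || no_h w)))).
  apply: le_Pr => // w; apply: contraNT; rewrite !negb_or => /andP[/allPn[X XM /negPn gX]] /andP[hv hh].
  apply/asboolP; apply: act_le tM _; apply: (origin_active n0 XM gX).
  - by move=> x xm; apply: contraNT hv => h; apply/hasP; exists x.
  - by move=> x xm; apply: contraNT hh => h; apply/hasP; exists x.
apply: (le_trans (Pr_or _ _ _ p01w)); apply: lerD.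
  rewrite /no_box (@Pr_all_indep _ _ p s _ (grid_index M M)
    (fun X => mem (rsites (square (corner m X) m))) (fun X w => ~~ grown (corner m X) n i w)); last 3 first.
  - by apply: allpairs_uniq; rewrite ?iota_uniq // => -[a b] [c d] _ _ [-> ->].
  - by move=> X _; apply: (dep_comp negb); exact: dep_grown.
  - move=> [a b] [c d] z _ _ abcd; rewrite /= !mem_rsites /inR /square /corner /= => h1.
    apply/negP => h2; move/eqP: abcd; apply; congr (_, _).
      by move: h1 h2 m0; clear; move: z => [z1 z2] /=; nia.
    by move: h1 h2 m0; clear; move: z => [z1 z2] /=; nia.
  have -> : expR (- ((M ^ 2)%:R * P)) = expR (- P) ^+ size (grid_index M M).
    by rewrite -expRM_natr size_allpairs !size_iota mulnn mulNr mulrC.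
  rewrite -[leRHS]mulr1 -(count_predT (grid_index M M)) -iter_mulr -big_const_seq.
  rewrite big_seq [leRHS]big_seq; apply: ler_prod => X; rewrite mem_grid_index => /andP[XM YM].
  rewrite Pr_ge0 //= Pr_setC //.
  have sub : {subset rsites (square (corner m X) m) <= s}.
    exact: (corner_sub mMt XM YM).
  apply: le_trans (expR_ge1Dx _); rewrite lerD2l lerN2; exact: HP.
have hm k : uniq (hseg m k) by rewrite map_inj_uniq ?iota_uniq // => ? ? []; lia.
have vm x k : uniq (vseg m x k) by rewrite map_inj_uniq ?iota_uniq // => ? ? []; lia.
have P1m : 0 <= (1 - p) ^+ m by rewrite exprn_ge0 // subr_ge0 ltW.
apply: (le_trans (Pr_or _ _ _ p01w)).
have hv : Pr p s no_v <= (m * M * M)%:R * (1 - p) ^+ m.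
  apply: (le_trans (@Pr_union _ _ p p01w s no_v _ (grid_index (m * M) M) (fun x w => ~~ has w (vseg m x.1 x.2)) _)).
    by move=> w /hasP.
  rewrite (_ : m * M * M = size (grid_index (m * M) M))%N; last by rewrite size_allpairs !size_iota.
  apply: sum_le_size => x; rewrite mem_grid_index => /andP[x1 x2].
  by rewrite /Pr Ex_hasN ?size_map ?size_iota //; exact: (vseg_sub mMt x1 x2).
have hh : Pr p s no_h <= (m * M)%:R * (1 - p) ^+ m.
  apply: (le_trans (@Pr_union _ _ p p01w s no_h _ (iota 0 (m * M)) (fun y w => ~~ has w (hseg m y)) _)).
    by move=> w /hasP.
  rewrite -[in leRHS](size_iota 0 (m * M)).
  apply: sum_le_size => x; rewrite mem_iota => xm.
  by rewrite /Pr Ex_hasN ?size_map ?size_iota //; exact: (hseg_sub M0 mMt xm).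
apply: (le_trans (lerD hv hh)); rewrite -mulrDl -natrD; apply: ler_wpM2r => //; rewrite ler_nat.
have -> : (2 * m * M ^ 2 = m * M * M + m * M * M)%N by ring.
by rewrite leq_add2l leq_pmulr.
Qed.

Lemma supercritical (c e : K) : pi ^+ 2 / 18 < c -> 0 < e ->
  small (fun p => forall t, c <= p * ln t%:R ->
    1 - e <= Pr p (rsites (ball t)) (fun w => `[< act w t (0, 0) >])).
Proof.
set lam : K := pi ^+ 2 / 18 => lamc e0.
have lam0 : 0 <= lam by rewrite divr_ge0 ?sqr_ge0.
pose eps := (c - lam) / 2; have eps0 : 0 < eps by rewrite /eps; lra.
pose d := lam + eps; have d0 : 0 < d by rewrite /d; lra.
have dc : c = d + eps by rewrite /d /eps; lra.
(* [4 / n <= eps] controls the losses during growth, and [2 * d + 1 <= n] makes empty segments rare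
   against the [M ^ 2] squares. *)
pose n := (Num.truncn (4 / eps + 2 * d + 1)).+1.
have e40 : 0 < 4 / eps by rewrite divr_gt0.
have /andP[nl _] := @truncnS_bound K (4 / eps + 2 * d + 1) ltac:(clear -e40 d0; lra).
rewrite -/n in nl.
have n0 : 0 < n%:R :> K by rewrite ltr0n.
have n4 : 4 / n%:R <= eps.
  by rewrite ler_pdivrMr // mulrC -ler_pdivrMr //; clear -nl d0; lra.
have n2 : 2 * d + 1 <= n%:R by clear -nl e40; lra.
have S0 := @small_le K 2^-1 ltac:(clear; lra).
have S1 := @small_decay K (n ^ 2) eps 1 (e / 2) eps0 ltac:(clear -e0; lra).
have S2 := @small_decay K 2 1 (32 * n%:R) (e / 2) ltr01 ltac:(clear -e0; lra).
have S3 := @small_decay K 4 eps (256 * n%:R ^+ 2) 1 eps0 ltr01.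
apply: small_imp (small_and S0 (small_and S1 (small_and S2 S3))).
move=> p p0 [p2 [{}S1 [{}S2 {}S3]]] t ht.
have p01 : 0 < p < 1 by rewrite p0 /=; clear -p2; lra.
have [_ p1] := andP p01.
have ip2 : 2 <= p^-1 by rewrite -[2]invrK lef_pV2 ?posrE ?invr_gt0.
have ip0 : 0 < p^-1 by rewrite invr_gt0.
pose N := (Num.truncn p^-1).+1.
have /andP[Nl Nu] := truncnS_bound (ltW ip0); rewrite -/N in Nl Nu.
have {}Nu : N%:R <= 2 * p^-1 by clear -Nu ip2; lra.
pose E := expR (d / p); have E0 : 0 < E by exact: expR_gt0.
have E1 : 1 <= E by rewrite -[leLHS]expR0 ler_expR divr_ge0 // ltW.
pose M := (Num.truncn E).+1.
have /andP[Ml Mu] := truncnS_bound (ltW E0); rewrite -/M in Ml Mu.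
have {}Mu : M%:R <= 2 * E by clear -Mu E1; lra.
(* The side [m] is of order [n / p^2], so a given segment is empty with probability at most exp (- n
   / p). *)
pose i := (N ^ 2).-1; pose m := (n * i.+1)%N.
have iE : i.+1 = (N ^ 2)%N by rewrite prednK.
have mE : m%:R = n%:R * N%:R ^+ 2 :> K by rewrite /m iE natrM natrX.
have ml : n%:R * p^-1 ^+ 2 <= m%:R.
  rewrite mE; apply: ler_wpM2l; first exact: ltW.
  by apply: lerXn2r; rewrite ?nnegrE // ltW.
have mu : m%:R <= 4 * n%:R * p^-1 ^+ 2.
  have -> : 4 * n%:R * p^-1 ^+ 2 = n%:R * (2 * p^-1) ^+ 2 by ring.
  rewrite mE; apply: ler_wpM2l; first exact: ltW.
  by apply: lerXn2r; rewrite ?nnegrE ?mulr_ge0 // ltW.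
(* With the convention [ln 0 = 0], the case [t = 0] contradicts the positivity of [c]. *)
have t0 : (0 < t)%N.
  rewrite lt0n; apply: contraTneq ht => ->; rewrite ln0 // mulr0 -ltNge dc; clear -d0 eps0; lra.
have tge : expR (c / p) <= t%:R.
  by rewrite -[leRHS]lnK ?posrE ?ltr0n // ler_expR ler_pdivrMr // mulrC.
have cE : expR (c / p) = E * expR (eps / p) by rewrite dc mulrDl expRD.
have time : (8 * m ^ 2 * M <= t)%N.
  rewrite -(ler_nat K); apply: le_trans tge.
  rewrite cE 2!natrM natrX.
  apply: (@le_trans _ _ (8 * (4 * n%:R * p^-1 ^+ 2) ^+ 2 * (2 * E))).
    apply: ler_pM; rewrite ?mulr_ge0 ?exprn_ge0 //.
    by rewrite ler_pM2l //; apply: lerXn2r; rewrite ?nnegrE ?mulr_ge0 // ?exprn_ge0 // ltW.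
  have -> : 8 * (4 * n%:R * p^-1 ^+ 2) ^+ 2 * (2 * E) = E * (256 * n%:R ^+ 2 * p^-1 ^+ 4).
    by move: (p^-1) => x; clear; ring.
  by rewrite ler_pM2l //; rewrite expRN ler_pdivrMr ?expR_gt0 // mul1r in S3.
pose P := p ^+ (n ^ 2) * expR (- ((pi ^+ 2 / 9 + 4 / n%:R) / p)).
have HP o : {subset rsites (square o m) <= rsites (ball t)} -> P <= Pr p (rsites (ball t)) (grown o n i).
  by move=> sub; exact: Pr_grown_bound.
have := Pr_inactive_le p01 (ltn0Sn _) HP (ltn0Sn _) time; rewrite -/n -/M -/m.
have T2 : (2 * m * M ^ 2)%:R * (1 - p) ^+ m <= e / 2.
  apply: le_trans S2; rewrite expR_rateM //.
  have h1 : expR (- (rate p * m%:R)) <= expR (- (1 / p)) * (E ^+ 2)^-1.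
    rewrite /E -expRM_natr -expRN -expRD ler_expR -opprD lerN2.
    have -> : 1 / p + d / p * 2 = (2 * d + 1) * p^-1 by ring.
    apply: (@le_trans _ _ (p * (n%:R * p^-1 ^+ 2))).
      rewrite (_ : p * _ = n%:R * p^-1); last by field; rewrite gt_eqF.
      by rewrite ler_pM2r.
    by apply: ler_pM => //; [exact: ltW|rewrite mulr_ge0 // exprn_ge0 // ltW|exact: rate_ge].
  have h2 : (2 * m * M ^ 2)%:R <= 32 * n%:R * p^-1 ^+ 2 * E ^+ 2.
    have -> : 32 * n%:R * p^-1 ^+ 2 * E ^+ 2 = 2 * (4 * n%:R * p^-1 ^+ 2) * (2 * E) ^+ 2.
      by move: (p^-1) (E) => x y; clear; ring.
    rewrite 2!natrM natrX; apply: ler_pM; rewrite ?mulr_ge0 ?exprn_ge0 //; first by rewrite ler_pM2l.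
    by apply: lerXn2r; rewrite ?nnegrE ?mulr_ge0 // ltW.
  apply: (le_trans (ler_pM _ (expR_ge0 _) h2 h1)); first exact: ler0n.
  rewrite [expR _ * _]mulrC mulrA mulfK //; by rewrite expf_neq0 // gt_eqF.
have T1 : expR (- ((M ^ 2)%:R * P)) <= e / 2.
  apply: le_trans S1; rewrite mul1r expRN.
  (* Here [2 * d = 2 * lam + 2 * eps], and growth uses up at most [2 * lam + eps]. *)
  have h3 : p ^+ (n ^ 2) * expR (eps / p) <= (M ^ 2)%:R * P.
    have h4 : E ^+ 2 <= (M ^ 2)%:R by rewrite natrX; apply: lerXn2r; rewrite ?nnegrE // ltW.
    have pn0 : 0 <= p ^+ (n ^ 2) by rewrite exprn_ge0 // ltW.
    have P0 : 0 <= P by rewrite mulr_ge0 ?expR_ge0.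
    apply: le_trans (ler_wpM2r P0 h4); rewrite /P mulrCA; apply: ler_wpM2l => //.
    rewrite /E -expRM_natr -expRD ler_expR.
    have -> : d / p * 2 - (pi ^+ 2 / 9 + 4 / n%:R) / p = (2 * d - (pi ^+ 2 / 9 + 4 / n%:R)) * p^-1 by ring.
    rewrite ler_pM2r // (_ : pi ^+ 2 / 9 = 2 * lam); last by rewrite /lam; field.
    by rewrite /d; clear -n4; lra.
  have h0 : 0 < p ^+ (n ^ 2) * expR (eps / p) by rewrite mulr_gt0 ?expR_gt0 // exprn_gt0.
  rewrite exprVn expRN -invfM lef_pV2 ?posrE ?expR_gt0 //.
  apply: (le_trans h3); apply: le_trans (expR_ge1Dx _); rewrite lerDr //.
move=> H; have {H} := le_trans H (lerD T1 T2).
by move: (Pr _ _ _) => x; clear; lra.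
Qed.

End supercritical_limit.

Local Open Scope classical_set_scope.
Local Open Scope ring_scope.
Local Open Scope card_scope.

(** * The product measure and finite boxes *)

Lemma card_ge2P (A : set Site) :
  reflect (exists y1 y2, [/\ y1 != y2, A y1 & A y2]) (`I_2 #<= A).
Proof.
apply: (iffP idP) => [/card_leP[f]|[y1 [y2 [y12 A1 A2]]]].
  have m0 : 0%N \in (`I_2 : set nat) by rewrite inE.
  have m1 : 1%N \in (`I_2 : set nat) by rewrite inE.
  pose z0 := f (exist _ 0%N m0); pose z1 := f (exist _ 1%N m1).
  exists (val z0), (val z1); split; last 2 first.
  - exact: set_valP.
  - exact: set_valP.
  apply/eqP => /val_inj /(@inj _ _ _ f); rewrite !inE /= => /(_ I I) /(congr1 val) /=; lia.
rewrite -(card_le_eql (_ : [set` [fset y1; y2]%fset] #= `I_2)); last first.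
  by apply/card_eq_fsetP; rewrite cardfs2 y12.
by apply: subset_card_le => z /=; rewrite !inE => /orP[/eqP ->|/eqP ->].
Qed.

(** For integers, u^2 + v^2 = 1 exactly when |u| + |v| = 1. *)
Lemma nbrsE (R : realType) (x y : Site) : nbrs R x y = nbr x y.
Proof.
rewrite /nbrs /euclid_norm /=; apply/propext.
rewrite /nbr /=; set u := x.1 - y.1; set v := x.2 - y.2.
have E : u%:~R ^+ 2 + v%:~R ^+ 2 = (`|u| ^ 2 + `|v| ^ 2)%N%:R :> R.
  have K (z : int) : z%:~R ^+ 2 = (`|z| ^ 2)%N%:R :> R.
    by rewrite natrX natr_absz intr_norm real_normK ?num_real.
  by rewrite natrD !K.
rewrite E; split.
  move=> /(congr1 (fun z => z ^+ 2)); rewrite sqr_sqrtr ?ler0n // expr1n.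
  move/eqP; rewrite -[1]/(1%:R) eqr_nat; nia.
move=> h; rewrite (_ : (`|u| ^ 2 + `|v| ^ 2)%N = 1%N) ?sqrtr1 //; nia.
Qed.

Lemma iter_bootstrap (R : realType) (w : Site -> bool) n x :
  iter n (bootstrap R) [set z | w z] x <-> act w n x.
Proof.
split.
  elim: n x => [|n IH] x /=; first exact: act_init.
  rewrite /bootstrap => -[/IH h|]; first exact: act_step.
  move=> /= /card_ge2P[y1 [y2 [y12 [n1 h1] [n2 h2]]]].
  by rewrite !nbrsE in n1 n2; apply: (act_nbrs y12 n1 n2); exact: IH.
elim=> {n x} [n x wx|n x _ h|n x y1 y2 y12 n1 n2 _ h1 _ h2].
- by elim: n => //= n IH; left.
- by left.
- right => /=; apply/card_ge2P; exists y1, y2; split => //; split => //; by rewrite nbrsE.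
Qed.

Section bernoulli.
Variables (R : realType) (p : R).
Hypothesis p01 : 0 <= p <= 1.

Definition cfg (X : set Site) : Site -> bool := fun z => `[< X z >].

Let P := bernoulli_product p.

Definition cyl (F : {fset Site}) : set config := \bigcap_(z in [set` F]) site_event z.

Lemma measurable_cylinder F : measurable (cyl F).
Proof. by apply: fin_bigcap_measurable => // z _; exact: measurable_site_event. Qed.

Lemma bernoulli_cyl F : P (cyl F) = (p ^+ #|` F|)%:E.
Proof.
have [P1 Pi] := bernoulli_productP p01.
rewrite /P /cyl; apply: etrans (Pi F) _.
under eq_bigr do rewrite P1.
by rewrite prodEFin big_const_seq count_predT iter_mulr_1.
Qed.

(** Induction on the sites read by the event. The product rule concerns occupied sites, so [cyl F]
    collects those found occupied, and the case of an empty site is obtained by subtraction. *)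
Lemma bernoulli_dep (s : seq Site) (A : (Site -> bool) -> bool) (F : {fset Site}) :
  uniq s -> dep (mem s) A -> (forall z, z \in s -> z \notin F) ->
  measurable ([set X | A (cfg X)] : set config) /\
  P (cyl F `&` [set X | A (cfg X)]) = (p ^+ #|` F| * Pr p s A)%:E.
Proof.
elim: s A F => [|x s IH] A F /=.
  move=> _ dA _.
  have E X : A (cfg X) = A (fun=> false) by apply: dA.
  case a: (A (fun=> false)).
    rewrite (_ : [set X | A (cfg X)] = setT); last first.
      by apply/seteqP; split => X //= _; rewrite E a.
    split; first exact: measurableT.
    by rewrite setIT bernoulli_cyl /Pr /= a mulr1.
  rewrite (_ : [set X | A (cfg X)] = set0); last first.
    by apply/seteqP; split => X //=; rewrite E a.
  split; first exact: measurable0.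
  by rewrite setI0 measure0 /Pr /= a mulr0.
move=> /andP[xs us] dA sF.
have dAb b : dep (mem s) (fun w => A (upd w x b)).
  move=> w w' ww'; apply: dA => z; rewrite /= inE /upd; case: eqP => //= _; exact: ww'.
have xF : x \notin F by apply: sF; rewrite inE eqxx.
have sF' z : z \in s -> z \notin F by move=> zs; apply: sF; rewrite inE zs orbT.
have sxF z : z \in s -> z \notin (x |` F)%fset.
  by move=> zs; rewrite !inE negb_or sF' // andbT; apply: contraNneq xs => <-.
have [mT PT] := IH _ _ us (dAb true) sxF.
have [m0 P0] := IH _ _ us (dAb false) sF'.
have [_ P0x] := IH _ _ us (dAb false) sxF.
set AT := [set X | A (upd (cfg X) x true)] in mT PT.
set A0 := [set X | A (upd (cfg X) x false)] in m0 P0 P0x.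
have mx : measurable (site_event x : set config) by exact: measurable_site_event.
have EA : [set X | A (cfg X)] = (AT `&` site_event x) `|` (A0 `\` site_event x).
  apply/seteqP; split => X; rewrite /AT /A0 /site_event /=.
    have [Xx|Xx] := pselect (X x) => AX; [left|right]; split => //.
      by rewrite (_ : upd _ _ _ = cfg X) //; apply/funext => z; rewrite /upd; case: eqP => // ->;
        rewrite /cfg asboolT.
    by rewrite (_ : upd _ _ _ = cfg X) //; apply/funext => z; rewrite /upd; case: eqP => // ->;
        rewrite /cfg asboolF.
  move=> [[+ Xx]|[+ Xx]]; rewrite (_ : upd _ _ _ = cfg X) //;
    apply/funext => z; rewrite /upd; case: eqP => // ->; apply/esym.
    exact/asboolP.
  exact/negbTE/asboolPn.
have mA : measurable ([set X | A (cfg X)] : set config).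
  by rewrite EA; apply: measurableU; [exact: measurableI|exact: measurableD].
split => //.
have cylx : cyl (x |` F)%fset = cyl F `&` site_event x.
  by rewrite /cyl set_fsetU1 bigcap_setU1 setIC.
have mF := measurable_cylinder F.
have E1 : P (cyl F `&` [set X | A (cfg X)]) =
    (P ((cyl F `&` A0) `\` site_event x) + P (cyl (x |` F)%fset `&` AT))%E.
  have mU := measurableI _ _ mF mA.
  apply: etrans (measureDI P mU mx) _; congr (P _ + P _)%E.
    rewrite EA; apply/seteqP; split => X /=; rewrite /setD /=; tauto.
  rewrite cylx EA; apply/seteqP; split => X /=; rewrite /setD /=; tauto.
have E2 : P (cyl F `&` A0) = (P ((cyl F `&` A0) `\` site_event x) + P (cyl (x |` F)%fset `&` A0))%E.
  have mU := measurableI _ _ mF m0.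
  apply: etrans (measureDI P mU mx) _; congr (_ + P _)%E.
  by rewrite cylx setIAC.
rewrite E1 PT; move: E2; rewrite P0 P0x.
case: (P _) => [r| |] //= [E2].
rewrite -EFinD /Pr /=; congr (_%:E).
have := cardfsU1 x F; rewrite xF add1n => c; rewrite c exprS in E2 *.
rewrite -[Ex p s (fun w => (A (upd w x true))%:R) _]/(Pr p s (fun w => A (upd w x true))).
rewrite -[Ex p s (fun w => (A (upd w x false))%:R) _]/(Pr p s (fun w => A (upd w x false))).
by rewrite (_ : r = p ^+ #|` F| * Pr p s (fun w => A (upd w x false)) -
   p * p ^+ #|` F| * Pr p s (fun w => A (upd w x false))); [ring|rewrite E2; ring].
Qed.

Lemma J_Pr t : J t p = Pr p (rsites (ball t)) (fun w => `[< act w t (0, 0) >]).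
Proof.
have [_] := @bernoulli_dep (rsites (ball t)) _ fset0 (uniq_rsites _) (@dep_act t) (fun _ _ => isT).
rewrite cardfs0 expr0 mul1r /cyl set_fset0 bigcap_set0 setTI => E.
rewrite /J (_ : [set X | _] = [set X | `[< act (cfg X) t (0, 0) >] ]).
  by rewrite -/P E.
apply/seteqP; split => X /=.
  move=> h; apply/asboolP; rewrite -(iter_bootstrap R).
  by rewrite (_ : [set z | cfg X z] = X) //; apply/seteqP; split => z /asboolP.
move=> /asboolP; rewrite -(iter_bootstrap R).
by rewrite (_ : [set z | cfg X z] = X) //; apply/seteqP; split => z /asboolP.
Qed.

End bernoulli.

(** * The threshold *)

Lemma lt_limn_esup (R : realType) (u : nat -> R) (a : R) :
  (limn_esup (fun n => (u n)%:E) < a%:E)%E ->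
  exists2 c, c < a & \forall n \near \oo, u n <= c.
Proof.
move=> /ereal_inf_lt[y [V hV <-]] ya.
have H n : V n -> ((u n)%:E <= ereal_sup [set (u n)%:E | n in V])%E.
  by move=> Vn; apply: ereal_sup_ubound; exists n.
move: ya H; case: (ereal_sup _) => [r| |] //= ra H.
- exists r; first by rewrite -lte_fin.
  by apply: filterS hV => n /H; rewrite lee_fin.
- exists (a - 1); first by rewrite ltrBlDr ltrDl.
  by apply: filterS hV => n /H; rewrite leeNy_eq.
Qed.

Lemma gt_limn_einf (R : realType) (u : nat -> R) (a : R) :
  (a%:E < limn_einf (fun n => (u n)%:E))%E ->
  exists2 c, a < c & \forall n \near \oo, c <= u n.
Proof.
rewrite /limn_einf lteNr => h.
have [c ca hc] := @lt_limn_esup R (fun n => - u n) (- a) h.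
exists (- c); first by rewrite ltrNr.
by apply: filterS hc => n; rewrite lerNl.
Qed.

(** [small] speaks of positive [p] only, so the value 0 is kept as a separate alternative. *)
Lemma small_near (R : realType) (P : R -> Prop) (p : nat -> R) :
  p n @[n --> \oo] --> (0 : R) -> (forall n, 0 <= p n) -> small P ->
  \forall n \near \oo, p n = 0 \/ P (p n).
Proof.
move=> /cvgrPdist_le pc p0 [e e0 He]; apply: filterS (pc _ e0) => n.
rewrite sub0r normrN ger0_norm // => pe; have := p0 n.
by rewrite le_eqVlt => /predU1P[<-|pn]; [left|right; exact: He].
Qed.

Lemma act_empty n x : ~ act (fun=> false) n x.
Proof. by elim. Qed.

Lemma Pr_act0 (R : realType) t :
  Pr (0 : R) (rsites (ball t)) (fun w => `[< act w t (0, 0) >]) <= 0.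
Proof.
have p01 : 0 <= (0 : R) <= 1 by rewrite lexx ler01.
apply: (@le_trans _ _ (Pr 0 (rsites (ball t)) (fun w => has w (rsites (ball t))))).
  apply: le_Pr => // w /asboolP a; apply/negPn/negP => /hasPn h.
  apply: (@act_empty t (0, 0)); apply: act_local a => z /= z1 z2 wz; suff /h : z \in rsites (ball t) by rewrite wz.
  by rewrite mem_rsites /inR /ball /=; lia.
by rewrite /Pr Ex_has ?uniq_rsites // subr0 expr1n subrr.
Qed.

Theorem theorem3 (R : realType) (t : nat -> nat) (p : nat -> R)
    (t_gt0 : forall n, (0 < t n)%N)
    (p01 : forall n, 0 <= p n <= 1)
    (t_cvg : t n @[n --> \oo] --> \oo)
    (p_cvg : p n @[n --> \oo] --> (0 : R)) :
  let lambda : R := pi ^+ 2 / 18%:R in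
  ((lambda%:E < limn_einf (fun n => (p n * ln (t n)%:R)%:E))%E ->
     J (t n) (p n) @[n --> \oo] --> (1 : R)) /\
  ((limn_esup (fun n => (p n * ln (t n)%:R)%:E) < lambda%:E)%E ->
     J (t n) (p n) @[n --> \oo] --> (0 : R)).
Proof.
move=> lambda; have p0 n : 0 <= p n by case/andP: (p01 n).
have lam0 : 0 < lambda by rewrite divr_gt0 ?exprn_gt0 ?pi_gt0.
split.
- move=> /gt_limn_einf[c lc hc]; apply/cvgrPdist_le => e e0.
  have := small_near p_cvg p0 (supercritical lc e0).
  move=> h; apply: filterS2 hc h => n hn [pn|hp].
    by move: hn; rewrite pn mul0r leNgt (lt_trans lam0 lc).
  rewrite J_Pr // ger0_norm; first by have := hp _ hn; move: (Pr _ _ _) => x; clear; lra.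
  by rewrite subr_ge0; apply: Pr_le1.
- move=> /lt_limn_esup[c lc hc]; apply/cvgrPdist_le => e e0.
  (* [subcritical] asks for a positive constant, and [c] may be negative. *)
  pose c' := Num.max c (lambda / 2).
  have c'0 : 0 < c' by rewrite lt_max; apply/orP; right; rewrite divr_gt0.
  have c'l : c' < lambda by rewrite gt_max lc /= gtr_pMr // invf_lt1 // ltr1n.
  have := small_near p_cvg p0 (subcritical c'0 c'l e0).
  move=> h; apply: filterS2 hc h => n hn hp.
  rewrite J_Pr // sub0r normrN ger0_norm; last exact: Pr_ge0.
  case: hp => [->|hp]; first exact: le_trans (Pr_act0 _ _) (ltW e0).
  by apply: hp => //; rewrite le_max hn.
Qed.
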